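(* Let $a,b\in\mathbb{C}$ with $ab\neq0$ and $\mathbf{G}=\mathbf{G}(a,b)$. The function $u(x)$ defined for $x\in\mathbb{R}\cup(\mathrm{i}\mathbb{R})$ by $$u(x):=2\left(\frac{\mathrm{d}}{\mathrm{d}x}\log\left(x^2\,\Psi(-\tfrac18x^2,0;\mathbf{G})\right)\right)^{-1}$$ is an odd function of $x$ that is analytic at the origin with Taylor expansion $$u(x)=x+\frac{u'''(0)}{3!}x^3+O(x^5),\quad x\to0,\qquad u'''(0)=3(\mathfrak{b}^2-\mathfrak{a}^2)=3\,\frac{|b|^2-|a|^2}{|a|^2+|b|^2},$$ where $\mathfrak{a}:=|a|/\sqrt{|a|^2+|b|^2}$ and $\mathfrak{b}:=|b|/\sqrt{|a|^2+|b|^2}$.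
   Context: Notation: $*$ is complex conjugation; $\sigma_3=\mathrm{diag}(1,-1)$; $\mathrm{e}^{f\sigma_3}=\mathrm{diag}(\mathrm{e}^{f},\mathrm{e}^{-f})$. For $(a,b)\in\mathbb{C}^2\setminus\{(0,0)\}$ let $$\mathbf{G}(a,b)=\frac{1}{\sqrt{|a|^2+|b|^2}}\begin{bmatrix}a & b^*\\ -b & a^*\end{bmatrix}.$$ For $(X,T)\in\mathbb{R}^2$ and $\mathbf{G}=\mathbf{G}(a,b)$, $\mathbf{P}(\Lambda;X,T,\mathbf{G})$ denotes the unique (it is known to exist and to depend real-analytically on $(X,T)$) $2\times 2$ matrix function of $\Lambda$ such that: (i) it is analytic for $|\Lambda|\neq 1$ and takes continuous boundary values on the unit circle from the interior and from the exterior; (ii) writing $\mathbf{P}_+$ (resp. $\mathbf{P}_-$) for the boundary value on $|\Lambda|=1$ from the exterior (resp. interior), $$\mathbf{P}_+=\mathbf{P}_-\,\mathrm{e}^{-\mathrm{i}(\Lambda X+\Lambda^2T+2\Lambda^{-1})\sigma_3}\,\mathbf{G}\,\mathrm{e}^{\mathrm{i}(\Lambda X+\Lambda^2T+2\Lambda^{-1})\sigma_3},\quad |\Lambda|=1;$$ (iii) $\mathbf{P}\to\mathbb{I}$ as $\Lambda\to\infty$. Then $\Psi(X,T;\mathbf{G}):=2\mathrm{i}\lim_{\Lambda\to\infty}\Lambda P_{12}(\Lambda;X,T,\mathbf{G})$. *)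

(* Defs.v *)
From Stdlib Require Import Reals Lra Lia ClassicalEpsilon.
From Coquelicot Require Import Coquelicot.

Open Scope C_scope.

(** * Limits, derivatives and analyticity over C *)

(* The filter of neighbourhoods of the point at infinity of the Riemann sphere. *)
Definition C_infty : (C -> Prop) -> Prop :=
  fun Q => exists M : R, forall z : C, (M < Cmod z)%R -> Q z.

Global Instance C_infty_proper : ProperFilter C_infty.
Proof.
  constructor.
  - intros Q [M HM]. exists (RtoC (Rabs M + 1)). apply HM.
    rewrite Cmod_R, Rabs_pos_eq.
    + pose proof (Rle_abs M). lra.
    + pose proof (Rabs_pos M). lra.
  - constructor.
    + exists 0%R. easy.
    + intros P Q [M HM] [N HN]. exists (Rmax M N). intros z Hz. split.
      * apply HM. eapply Rle_lt_trans; [apply Rmax_l | exact Hz].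
      * apply HN. eapply Rle_lt_trans; [apply Rmax_r | exact Hz].
    + intros P Q HPQ [M HM]. exists M. auto.
Qed.

(* Total limit operator, with value 0 when there is no limit.  (Coquelicot's
   [C_lim] and [C_derive] only look along the horizontal direction.) *)
Definition Clim (F : (C -> Prop) -> Prop) (f : C -> C) : C :=
  match excluded_middle_informative (exists l : C, filterlim f F (locally l)) with
  | left H => proj1_sig (constructive_indefinite_description _ H)
  | right _ => 0
  end.

(* Derivative at [x] of a function whose domain is [D]: the increments stay in [D]. *)
Definition D_within (D : C -> Prop) (f : C -> C) (x : C) : C :=
  Clim (within D (locally' x)) (fun y => (f y - f x) / (y - x)).

Fixpoint Dn_within (D : C -> Prop) (n : nat) (f : C -> C) : C -> C :=
  match n with
  | O => f
  | S m => D_within D (Dn_within D m f)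
  end.

(* d/dx log f, which does not depend on the local branch of the logarithm:
   any differentiable L with exp L = f satisfies L' = f' / f. *)
Definition Dlog_within (D : C -> Prop) (f : C -> C) (x : C) : C :=
  D_within D f x / f x.

Definition analytic_within (D : C -> Prop) (f : C -> C) (z0 : C) : Prop :=
  exists (c : nat -> C) (r : R), (0 < r)%R /\
    forall z : C, D z -> (Cmod (z - z0) < r)%R ->
      @is_pseries C_AbsRing C_NormedModule c (z - z0) (f z).

Definition analytic_at (f : C -> C) (z0 : C) : Prop :=
  analytic_within (fun _ => True) f z0.

(** * 2 x 2 matrices *)

Definition mat2 : Type := @matrix C 2 2.

(* Indices start at 0, so the entry written P_12 is [entry P 0 1]. *)
Definition entry (A : mat2) (i j : nat) : C := coeff_mat (RtoC 0) A i j.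

Definition mk2 (m11 m12 m21 m22 : C) : mat2 :=
  mk_matrix 2 2 (fun i j =>
    match i, j with
    | O, O => m11
    | O, _ => m12
    | _, O => m21
    | _, _ => m22
    end).

Definition mul2 (A B : mat2) : mat2 := @Mmult C_Ring 2 2 2 A B.

Definition id2 : mat2 := @Mone C_Ring 2.

Definition mat_analytic_at (A : C -> mat2) (z0 : C) : Prop :=
  forall i j : nat, (i < 2)%nat -> (j < 2)%nat ->
    analytic_at (fun z => entry (A z) i j) z0.

Definition mat_continuous_on (D : C -> Prop) (A : C -> mat2) : Prop :=
  forall i j : nat, (i < 2)%nat -> (j < 2)%nat ->
    continuous_on D (fun z => entry (A z) i j).

Definition mat_tends_to (F : (C -> Prop) -> Prop) (A : C -> mat2) (L : mat2) : Prop :=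
  forall i j : nat, (i < 2)%nat -> (j < 2)%nat ->
    filterlim (fun z => entry (A z) i j) F (locally (entry L i j)).

Definition Cexp (z : C) : C :=
  ((exp (Re z) * cos (Im z))%R, (exp (Re z) * sin (Im z))%R).

(* e^{f sigma_3} *)
Definition exp_sigma3 (f : C) : mat2 := mk2 (Cexp f) 0 0 (Cexp (- f)).

(** * The Riemann-Hilbert problem and the function Psi *)

Definition norm2 (a b : C) : R := sqrt (Cmod a ^ 2 + Cmod b ^ 2).

Definition Gmat (a b : C) : mat2 :=
  mk2 (a / norm2 a b) (Cconj b / norm2 a b)
      (- b / norm2 a b) (Cconj a / norm2 a b).

Definition phase (X T : R) (z : C) : C := z * X + z ^ 2 * T + 2 / z.

Definition jump (X T : R) (G : mat2) (z : C) : mat2 :=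
  mul2 (mul2 (exp_sigma3 (- (Ci * phase X T z))) G) (exp_sigma3 (Ci * phase X T z)).

(* Taking continuous boundary values on the unit circle from one side means
   extending continuously to the closed region on that side; [Pm] and [Pp] are
   the extensions from the interior and from the exterior.  The values of [P]
   on the circle itself are irrelevant. *)
Definition is_RHP_solution (X T : R) (G : mat2) (P : C -> mat2) : Prop :=
  (forall z : C, Cmod z <> 1%R -> mat_analytic_at P z) /\
  (exists Pm Pp : C -> mat2,
      (forall z : C, (Cmod z < 1)%R -> Pm z = P z) /\
      mat_continuous_on (fun z => (Cmod z <= 1)%R) Pm /\
      (forall z : C, (1 < Cmod z)%R -> Pp z = P z) /\
      mat_continuous_on (fun z => (1 <= Cmod z)%R) Pp /\
      (forall z : C, Cmod z = 1%R -> Pp z = mul2 (Pm z) (jump X T G z))) /\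
  mat_tends_to C_infty P id2.

Definition RHP_solution (X T : R) (G : mat2) : C -> mat2 :=
  epsilon (inhabits (fun _ : C => id2)) (is_RHP_solution X T G).

Definition Psi (X T : R) (G : mat2) : C :=
  2 * Ci * Clim C_infty (fun z => z * entry (RHP_solution X T G z) 0 1).

(** * The function u *)

Definition real_or_imag (x : C) : Prop := Im x = 0%R \/ Re x = 0%R.

(* For x real or imaginary, x^2 is real, so Re only performs the cast to R. *)
Definition x2Psi (G : mat2) (x : C) : C :=
  x ^ 2 * Psi (- (1 / 8) * Re (x ^ 2)) 0 G.

(* At x = 0, where x^2 Psi vanishes, the convention / 0 = 0 gives u(0) = 0,
   which is the limit of u at the origin. *)
Definition u (G : mat2) (x : C) : C :=
  2 * / (Dlog_within real_or_imag (x2Psi G) x).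

(* Main.v *)
Require Import Defs.
From Stdlib Require Import Reals.
From Coquelicot Require Import Coquelicot.
From Stdlib Require Import Lra Lia Factorial Classical ClassicalEpsilon FunctionalExtensionality.
Open Scope C_scope.

(** At [T = 0] the matrix [W = P exp (-i (L X + 2/L) sigma3)] has a jump independent of [X] and
    [L], so it satisfies a Lax pair in [X] and [L] whose compatibility is a system of ODEs in [X]
    for [Q = [[0,psi],[phi,0]]] and [N = [[nn,al],[be,-nn]]], with [psi] the function [Psi].
    Conversely, start from the convergent power series solution of this system with
    [N = G^-1 sigma3 G] at [X = 0].  The X-equation, solved from [G^-1], gives an interior factor
    that is entire in [L].  The combination of both equations,
    [X P_X - L P_L = -(2i/L) (N P - P sigma3)], determines the coefficients of [X^k L^-m] of the
    exterior factor with a gain of [1/(k+m)], so that it converges up to [L = infinity]; the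
    zero-curvature equations imply that it solves the X-equation as well, and at [X = 0] it is the
    interior factor times the jump, hence so it is for all small [X].  Uniqueness
    follows by gluing Wronskians of rows across the unit circle with Cauchy's theorem.
    Therefore [Psi(X,0) = psi(X)] with [psi'(0) = -4 nn(0) psi(0)], [psi(0) <> 0] and
    [nn(0) = a^2 - b^2] (with [a], [b] the normalised moduli), and
    [u x = x psi / (psi + X psi')] at [X = -x^2/8]. *)

(** [Psi] is read off a matrix chosen by [epsilon], so nothing is known about it before a solution
    is exhibited and shown to determine the entry P_12. Only the germ at X = 0 matters, because x ->
    -x^2/8 fixes the origin; every estimate is therefore made for small X, with explicit geometric
    majorants. The obstacle is the exterior factor near L = infinity: the X-equation contains L
    itself, and solving it from X = 0 gives bounds that deteriorate as L grows. The combined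
    equation contains only 1/L, which is why the exterior factor comes from there. Its
    X-coefficients nevertheless solve the X-equation, and this makes each of them explicit in L. At
    T = 0 the phase is odd in L, so the second column is a first column for exchanged data at -L,
    and one column is estimated for both. The complex analysis rests on one fact: the mean of a
    holomorphic function over a circle does not depend on the radius. Finally -3 = 3! (-1/8) 4: the
    factor -1/8 comes from X, and 4 from psi'(0)/psi(0) = -4 nn(0). *)

Definition tends {T : Type} (F : (T -> Prop) -> Prop) (f : T -> C) (l : C) : Prop :=
  forall eps : R, (0 < eps)%R -> F (fun x => (Cmod (f x - l) < eps)%R).

Lemma locally_Cmod (z : C) (P : C -> Prop) :
  locally z P <-> exists d : R, (0 < d)%R /\ forall w, (Cmod (w - z) < d)%R -> P w.
Proof.
  split.
  - intros H. apply locally_C in H. destruct H as [d Hd].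
    exists d. split; [apply cond_pos |]. intros w Hw. apply Hd. exact Hw.
  - intros [d [Hd H]]. apply locally_C. exists (mkposreal d Hd).
    intros w Hw. apply H. exact Hw.
Qed.

Lemma locally_Cball (z : C) (d : R) :
  (0 < d)%R -> locally z (fun w => (Cmod (w - z) < d)%R).
Proof. intros Hd. apply locally_Cmod. exists d. auto. Qed.

Lemma tends_filterlim {T : Type} (F : (T -> Prop) -> Prop) {FF : Filter F} (f : T -> C) (l : C) :
  tends F f l <-> filterlim f F (locally l).
Proof.
  split.
  - intros H P HP. apply locally_Cmod in HP. destruct HP as [d [Hd HP]].
    unfold filtermap. generalize (H d Hd). apply filter_imp. intros x. apply HP.
  - intros H eps He. apply (H (fun w => (Cmod (w - l) < eps)%R)).
    now apply locally_Cball.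
Qed.

Lemma tends_ext_loc {T : Type} (F : (T -> Prop) -> Prop) {FF : Filter F} (f g : T -> C) (l : C) :
  F (fun x => f x = g x) -> tends F f l -> tends F g l.
Proof.
  intros E H eps He. generalize (filter_and _ _ E (H eps He)).
  apply filter_imp. intros x [-> Hx]. exact Hx.
Qed.

Lemma tends_ext {T : Type} (F : (T -> Prop) -> Prop) {FF : Filter F} (f g : T -> C) (l : C) :
  (forall x, f x = g x) -> tends F f l -> tends F g l.
Proof. intros E. apply tends_ext_loc; auto. now apply filter_forall. Qed.

Lemma tends_le {T : Type} (F G : (T -> Prop) -> Prop) (f : T -> C) (l : C) :
  (forall P, F P -> G P) -> tends F f l -> tends G f l.
Proof. intros H Hf eps He. now apply H, Hf. Qed.

Lemma tends_unique {T : Type} (F : (T -> Prop) -> Prop) {FF : ProperFilter F} (f : T -> C) (l m : C) :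
  tends F f l -> tends F f m -> l = m.
Proof.
  intros Hl Hm. apply NNPP. intros Hne.
  assert (H0 : (0 < Cmod (l - m))%R) by now apply Cmod_gt_0, Cminus_eq_contra.
  destruct (filter_ex (F := F) _ (filter_and (F := F) _ _ (Hl (Cmod (l - m) / 2)%R ltac:(lra)) (Hm (Cmod (l - m) / 2)%R ltac:(lra)))) as [x [H1 H2]].
  assert (Cmod (l - m) <= Cmod (f x - l) + Cmod (f x - m))%R; [| lra].
  replace (l - m) with (- (f x - l) + (f x - m)) by ring.
  eapply Rle_trans; [apply Cmod_triangle |]. rewrite Cmod_opp. lra.
Qed.

Lemma tends_const {T : Type} (F : (T -> Prop) -> Prop) {FF : Filter F} (c : C) :
  tends F (fun _ => c) c.
Proof.
  intros eps He. apply filter_forall. intros _.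
  replace (c - c) with (RtoC 0) by ring. now rewrite Cmod_0.
Qed.

Lemma tends_plus {T : Type} (F : (T -> Prop) -> Prop) {FF : Filter F} (f g : T -> C) (l m : C) :
  tends F f l -> tends F g m -> tends F (fun x => f x + g x) (l + m).
Proof.
  intros Hf Hg eps He.
  assert (He2 : (0 < eps / 2)%R) by lra.
  generalize (filter_and _ _ (Hf _ He2) (Hg _ He2)). apply filter_imp. intros x [H1 H2].
  replace (f x + g x - (l + m)) with ((f x - l) + (g x - m)) by ring.
  eapply Rle_lt_trans; [apply Cmod_triangle | lra].
Qed.

Lemma tends_bounded {T : Type} (F : (T -> Prop) -> Prop) {FF : Filter F} (f : T -> C) (l : C) :
  tends F f l -> F (fun x => (Cmod (f x) < Cmod l + 1)%R).
Proof.
  intros Hf. generalize (Hf 1%R Rlt_0_1). apply filter_imp. intros x Hx.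
  replace (f x) with ((f x - l) + l) by ring.
  eapply Rle_lt_trans; [apply Cmod_triangle | lra].
Qed.

Lemma tends_0_mult {T : Type} (F : (T -> Prop) -> Prop) {FF : Filter F} (f g : T -> C) (K : R) :
  tends F f 0 -> F (fun x => (Cmod (g x) < K)%R) -> tends F (fun x => f x * g x) 0.
Proof.
  intros Hf Hg eps He.
  assert (HK : (0 < Rabs K + 1)%R) by (pose proof (Rabs_pos K); lra).
  assert (Hd : (0 < eps / (Rabs K + 1))%R) by now apply Rdiv_lt_0_compat.
  generalize (filter_and _ _ (Hf _ Hd) Hg). apply filter_imp. intros x [H1 H2].
  replace (f x - 0) with (f x) in H1 by ring.
  replace (f x * g x - 0) with (f x * g x) by ring. rewrite Cmod_mult.
  apply Rle_lt_trans with (Cmod (f x) * (Rabs K + 1))%R.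
  - apply Rmult_le_compat_l; [apply Cmod_ge_0 |]. pose proof (Rle_abs K). lra.
  - replace eps with (eps / (Rabs K + 1) * (Rabs K + 1))%R by (field; lra).
    now apply Rmult_lt_compat_r.
Qed.

Lemma tends_0_iff {T : Type} (F : (T -> Prop) -> Prop) {FF : Filter F} (f : T -> C) (l : C) :
  tends F f l <-> tends F (fun x => f x - l) 0.
Proof.
  split; intros H eps He; generalize (H eps He); apply filter_imp; intros x;
  replace (f x - l - 0) with (f x - l) by ring; auto.
Qed.

Lemma tends_mult {T : Type} (F : (T -> Prop) -> Prop) {FF : Filter F} (f g : T -> C) (l m : C) :
  tends F f l -> tends F g m -> tends F (fun x => f x * g x) (l * m).
Proof.
  intros Hf Hg. apply tends_0_iff; auto.
  apply tends_ext with (fun x => (f x - l) * g x + (g x - m) * l); [auto | intros x; ring |].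
  replace (RtoC 0) with (0 + 0) by ring. apply tends_plus; auto.
  - apply tends_0_mult with (Cmod m + 1)%R; auto; [now apply (proj1 (tends_0_iff F f l)) | now apply tends_bounded].
  - apply tends_0_mult with (Cmod l + 1)%R; auto; [now apply (proj1 (tends_0_iff F g m)) |].
    apply filter_forall. intros _. lra.
Qed.

Lemma tends_opp {T : Type} (F : (T -> Prop) -> Prop) {FF : Filter F} (f : T -> C) (l : C) :
  tends F f l -> tends F (fun x => - f x) (- l).
Proof.
  intros H. replace (- l) with ((-(1)) * l) by ring.
  apply tends_ext with (fun x => (-(1)) * f x); [auto | intros; ring |].
  apply tends_mult; auto. now apply tends_const.
Qed.

Lemma tends_minus {T : Type} (F : (T -> Prop) -> Prop) {FF : Filter F} (f g : T -> C) (l m : C) :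
  tends F f l -> tends F g m -> tends F (fun x => f x - g x) (l - m).
Proof. intros Hf Hg. apply tends_plus; auto. now apply tends_opp. Qed.

Lemma tends_inv {T : Type} (F : (T -> Prop) -> Prop) {FF : Filter F} (f : T -> C) (l : C) :
  l <> 0 -> tends F f l -> tends F (fun x => / f x) (/ l).
Proof.
  intros Hl Hf. apply tends_0_iff; auto.
  assert (H0 : (0 < Cmod l)%R) by now apply Cmod_gt_0.
  assert (Hbig : F (fun x => (Cmod l / 2 < Cmod (f x))%R)).
  { generalize (Hf (Cmod l / 2)%R ltac:(lra)). apply filter_imp. intros x Hx.
    assert (Cmod l <= Cmod (f x) + Cmod (f x - l))%R; [| lra].
    replace l with (f x + - (f x - l)) at 1 by ring.
    eapply Rle_trans; [apply Cmod_triangle |]. rewrite Cmod_opp. lra. }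
  apply tends_ext_loc with (fun x => (f x - l) * (- / (f x * l))); auto.
  - generalize Hbig. apply filter_imp. intros x Hx.
    assert (f x <> 0) by (apply Cmod_gt_0; lra). field. auto.
  - apply tends_0_mult with (2 * / (Cmod l / 2 * Cmod l))%R; auto; [now apply (proj1 (tends_0_iff F f l)) |].
    generalize Hbig. apply filter_imp. intros x Hx.
    assert (Hfx : f x <> 0) by (apply Cmod_gt_0; lra).
    rewrite Cmod_opp, Cmod_inv, Cmod_mult by now apply Cmult_neq_0.
    assert (H1 : (0 < Cmod l / 2 * Cmod l)%R) by (apply Rmult_lt_0_compat; lra).
    apply Rle_lt_trans with (/ (Cmod l / 2 * Cmod l))%R.
    + apply Rinv_le_contravar; auto. apply Rmult_le_compat_r; lra.
    + pose proof (Rinv_0_lt_compat _ H1). lra.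
Qed.

Lemma tends_comp {T U : Type} (F : (T -> Prop) -> Prop) (G : (U -> Prop) -> Prop)
  (g : T -> U) (f : U -> C) (l : C) :
  filterlim g F G -> tends G f l -> tends F (fun x => f (g x)) l.
Proof. intros Hg Hf eps He. exact (Hg _ (Hf eps He)). Qed.

Lemma tends_comp_cont {T : Type} (F : (T -> Prop) -> Prop) {FF : Filter F}
  (g : T -> C) (f : C -> C) (l m : C) :
  tends F g l -> tends (locally l) f m -> tends F (fun x => f (g x)) m.
Proof. intros Hg. apply tends_comp. now apply tends_filterlim. Qed.

(** * Difference quotients along a filter *)

(* Covers derivatives over C ([i] the identity) and derivatives of curves ([i] the inclusion of
   the reals). *)
Record approach {T : Type} (F : (T -> Prop) -> Prop) (i : T -> C) (x : T) : Prop := {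
  app_filter : Filter F;
  app_neq : F (fun y => i y <> i x);
  app_lim : tends F i (i x) }.

Definition dquot {T : Type} (F : (T -> Prop) -> Prop) (i : T -> C) (x : T) (f : T -> C) (l : C) : Prop :=
  tends F (fun y => (f y - f x) / (i y - i x)) l.

Section Dquot.
Context {T : Type} {F : (T -> Prop) -> Prop} {i : T -> C} {x : T}.
Hypothesis HF : approach F i x.
Local Instance dquot_filter : Filter F := app_filter _ _ _ HF.

Lemma dquot_ext (f g : T -> C) l :
  F (fun y => f y = g y) -> f x = g x -> dquot F i x f l -> dquot F i x g l.
Proof.
  intros E Ex. apply tends_ext_loc; [apply dquot_filter |]. generalize E. apply filter_imp.
  intros y Hy. now rewrite Hy, Ex.
Qed.

Lemma dquot_cont (f : T -> C) l : dquot F i x f l -> tends F f (f x).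
Proof.
  intros H. apply tends_0_iff; [apply dquot_filter |].
  apply tends_ext_loc with (fun y => (f y - f x) / (i y - i x) * (i y - i x)); [apply dquot_filter | |].
  - generalize (app_neq _ _ _ HF). apply filter_imp. intros y Hy. field. now apply Cminus_eq_contra.
  - replace (RtoC 0) with (l * (i x - i x)) by ring. apply tends_mult; [apply dquot_filter | exact H |].
    apply tends_minus; [apply dquot_filter | apply HF |]. apply tends_const, dquot_filter.
Qed.

Lemma dquot_const c : dquot F i x (fun _ => c) 0.
Proof.
  apply tends_ext with (fun _ => RtoC 0); [apply dquot_filter | | apply tends_const, dquot_filter].
  intros y. unfold Cdiv. ring.
Qed.

Lemma dquot_id : dquot F i x i 1.
Proof.
  apply tends_ext_loc with (fun _ => RtoC 1); [apply dquot_filter | | apply tends_const, dquot_filter].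
  generalize (app_neq _ _ _ HF). apply filter_imp. intros y Hy. field. now apply Cminus_eq_contra.
Qed.

Lemma dquot_plus f g l m :
  dquot F i x f l -> dquot F i x g m -> dquot F i x (fun y => f y + g y) (l + m).
Proof.
  intros Hf Hg. eapply tends_ext; [apply dquot_filter | | exact (tends_plus _ _ _ _ _ Hf Hg)].
  intros y. simpl. unfold Cdiv. ring.
Qed.

Lemma dquot_mult f g l m :
  dquot F i x f l -> dquot F i x g m -> dquot F i x (fun y => f y * g y) (l * g x + f x * m).
Proof.
  intros Hf Hg.
  apply tends_ext with (fun y => (f y - f x) / (i y - i x) * g y + f x * ((g y - g x) / (i y - i x)));
    [apply dquot_filter | intros y; unfold Cdiv; ring |].
  apply tends_plus; [apply dquot_filter | |]; apply tends_mult; auto; try apply dquot_filter.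
  - now apply dquot_cont with m.
  - apply tends_const, dquot_filter.
Qed.

Lemma dquot_scal c f l : dquot F i x f l -> dquot F i x (fun y => c * f y) (c * l).
Proof.
  intros H. replace (c * l) with (0 * f x + c * l) by ring.
  apply dquot_mult; auto. apply dquot_const.
Qed.

Lemma dquot_opp f l : dquot F i x f l -> dquot F i x (fun y => - f y) (- l).
Proof.
  intros H. eapply tends_ext; [apply dquot_filter | | exact (tends_opp _ _ _ H)].
  intros y. simpl. unfold Cdiv. ring.
Qed.

Lemma dquot_inv (f : T -> C) (l : C) : f x <> 0 -> dquot F i x f l -> dquot F i x (fun y => / f y) (- l / (f x * f x)).
Proof.
  intros H0 H.
  assert (Hc := dquot_cont _ _ H).
  assert (Hnz : F (fun y => f y <> 0)).
  { assert (Hp : (0 < Cmod (f x))%R) by (apply Cmod_gt_0; exact H0). generalize (Hc _ Hp). apply filter_imp. intros y Hy E.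
    rewrite E in Hy. replace (0 - f x) with (- f x) in Hy by ring. rewrite Cmod_opp in Hy. lra. }
  apply tends_ext_loc with (fun y => - ((f y - f x) / (i y - i x)) * (/ (f y) * / f x)); [apply dquot_filter | |].
  - generalize (filter_and _ _ Hnz (app_neq _ _ _ HF)). apply filter_imp. intros y [H1 H2].
    field. repeat split; auto. now apply Cminus_eq_contra.
  - replace (- l / (f x * f x)) with (- l * (/ f x * / f x)) by (field; auto).
    apply tends_mult; [apply dquot_filter | apply tends_opp; [apply dquot_filter | exact H] |].
    apply tends_mult; [apply dquot_filter | apply tends_inv; auto; apply dquot_filter |].
    apply tends_const, dquot_filter.
Qed.

End Dquot.

Definition is_cderive (f : C -> C) (z l : C) : Prop := dquot (locally' z) (fun w => w) z f l.

Lemma approach_C (z : C) : approach (locally' z) (fun w : C => w) z.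
Proof.
  split.
  - apply locally'_filter.
  - unfold locally', within. now apply filter_forall.
  - intros eps He. unfold locally', within. generalize (locally_Cball z eps He). apply filter_imp. auto.
Qed.

Global Instance locally'_C_proper (z : C) : ProperFilter (locally' z).
Proof.
  constructor; [| apply locally'_filter].
  intros P HP. apply locally_Cmod in HP. destruct HP as [d [Hd HP]].
  exists (z + RtoC (d / 2)). apply HP.
  - replace (z + RtoC (d / 2) - z) with (RtoC (d / 2)) by ring.
    rewrite Cmod_R, Rabs_pos_eq; lra.
  - intros E. assert (E2 : RtoC (d / 2) = 0).
    { replace (RtoC (d / 2)) with (z + RtoC (d / 2) - z) by ring. rewrite E. ring. }
    apply RtoC_inj in E2. lra.
Qed.

Lemma is_cderive_unique f z l m : is_cderive f z l -> is_cderive f z m -> l = m.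
Proof. apply (tends_unique (locally' z)). Qed.

Lemma is_cderive_ext_loc f g z l :
  locally z (fun w => f w = g w) -> is_cderive f z l -> is_cderive g z l.
Proof.
  intros E. apply dquot_ext; [apply approach_C | | exact (locally_singleton _ _ E)].
  unfold locally', within. generalize E. apply filter_imp. auto.
Qed.

(* Caratheodory's form of the chain rule. *)
Lemma dquot_chain {T : Type} {F : (T -> Prop) -> Prop} {i : T -> C} {x : T}
  (HF : approach F i x) (g : T -> C) (f : C -> C) (l m : C) :
  dquot F i x g m -> is_cderive f (g x) l -> dquot F i x (fun y => f (g y)) (l * m).
Proof.
  intros Hg Hf.
  assert (FF := app_filter _ _ _ HF).
  pose (Q := fun w : C => if excluded_middle_informative (w = g x) then l else (f w - f (g x)) / (w - g x)).
  assert (HQ0 : Q (g x) = l) by (unfold Q; now destruct (excluded_middle_informative (g x = g x))).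
  assert (HQ1 : forall w, w <> g x -> Q w = (f w - f (g x)) / (w - g x)).
  { intros w Hw. unfold Q. now destruct (excluded_middle_informative (w = g x)). }
  assert (HQ : tends (locally (g x)) Q l).
  { intros eps He. generalize (Hf eps He). unfold locally', within. apply filter_imp. intros w Hw.
    destruct (classic (w = g x)) as [E | E]; [rewrite E, HQ0 | rewrite HQ1; auto].
    replace (l - l) with (RtoC 0) by ring. now rewrite Cmod_0. }
  apply tends_ext with (fun y => Q (g y) * ((g y - g x) / (i y - i x))); [auto | |].
  - intros y. destruct (classic (g y = g x)) as [E | E].
    + rewrite E, HQ0. unfold Cdiv. ring.
    + rewrite HQ1 by auto. unfold Cdiv. transitivity ((f (g y) - f (g x)) * (/ (g y - g x) * (g y - g x)) * / (i y - i x)); [ring |].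
      rewrite Cinv_l by now apply Cminus_eq_contra. ring.
  - apply tends_mult; auto. apply tends_comp_cont with (g x); auto. now apply (dquot_cont HF) with m.
Qed.

Lemma is_cderive_cont f z l : is_cderive f z l -> tends (locally z) f (f z).
Proof.
  intros H. assert (H1 := dquot_cont (approach_C z) _ _ H). intros eps He.
  generalize (H1 eps He). unfold locally', within. apply filter_imp. intros w Hw.
  destruct (classic (w = z)) as [-> | E]; [| auto].
  replace (f z - f z) with (RtoC 0) by ring. now rewrite Cmod_0.
Qed.

(** * Functions with a continuous complex derivative *)

(** Continuity of the derivative is built in because circle means are differentiated under the
    integral sign. The derivative is taken in the full plane, even at points where [U] is not a
    neighbourhood. *)
Definition holo (U : C -> Prop) (f : C -> C) : Prop :=
  exists f' : C -> C, forall z, U z -> is_cderive f z (f' z) /\ tends (locally z) f' (f' z).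

Lemma holo_sub (U V : C -> Prop) f : (forall z, V z -> U z) -> holo U f -> holo V f.
Proof. intros H [f' Hf]. exists f'. auto. Qed.

Lemma holo_cont U f z : holo U f -> U z -> tends (locally z) f (f z).
Proof. intros [f' Hf] Hz. now apply is_cderive_cont with (f' z), Hf. Qed.

Lemma holo_const U c : holo U (fun _ => c).
Proof.
  exists (fun _ => 0). intros z _. split; [apply dquot_const, approach_C | now apply tends_const, locally_filter].
Qed.

Lemma tends_id (z : C) : tends (locally z) (fun w => w) z.
Proof. intros eps He. now apply locally_Cball. Qed.

Lemma holo_id U : holo U (fun z => z).
Proof.
  exists (fun _ => 1). intros z _. split; [apply dquot_id, approach_C | now apply tends_const, locally_filter].
Qed.

Lemma holo_plus U f g : holo U f -> holo U g -> holo U (fun z => f z + g z).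
Proof.
  intros [f' Hf] [g' Hg]. exists (fun z => f' z + g' z). intros z Hz. split.
  - apply dquot_plus; [apply approach_C | now apply Hf | now apply Hg].
  - apply tends_plus; [apply locally_filter | now apply Hf | now apply Hg].
Qed.

Lemma holo_mult U f g : holo U f -> holo U g -> holo U (fun z => f z * g z).
Proof.
  intros Hf0 Hg0. assert (Hf := Hf0). assert (Hg := Hg0).
  destruct Hf as [f' Hf]. destruct Hg as [g' Hg].
  exists (fun z => f' z * g z + f z * g' z). intros z Hz. split.
  - apply dquot_mult; [apply approach_C | now apply Hf | now apply Hg].
  - apply tends_plus; [apply locally_filter | |]; apply tends_mult; try apply locally_filter;
    try (now apply Hf); try (now apply Hg); now apply holo_cont with U.
Qed.

Lemma holo_opp U f : holo U f -> holo U (fun z => - f z).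
Proof.
  intros [f' Hf]. exists (fun z => - f' z). intros z Hz. split.
  - apply dquot_opp; [apply approach_C | now apply Hf].
  - apply tends_opp; [apply locally_filter | now apply Hf].
Qed.

Lemma holo_minus U f g : holo U f -> holo U g -> holo U (fun z => f z - g z).
Proof. intros Hf Hg. apply holo_plus; auto. now apply holo_opp. Qed.

Lemma holo_inv (U : C -> Prop) (f : C -> C) : (forall z, U z -> f z <> RtoC 0) -> holo U f -> holo U (fun z => / f z).
Proof.
  intros H0 Hf0. assert (Hf := Hf0). destruct Hf as [f' Hf].
  exists (fun z => - f' z * / (f z * f z)). intros z Hz. split.
  - apply dquot_inv; [apply approach_C | auto | now apply Hf].
  - assert (Hc := holo_cont _ _ _ Hf0 Hz).
    apply tends_mult; [apply locally_filter | apply tends_opp; [apply locally_filter | now apply Hf] |].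
    apply tends_inv; [apply locally_filter | apply Cmult_neq_0; auto | now apply tends_mult; try apply locally_filter].
Qed.

Lemma holo_comp (U V : C -> Prop) f g :
  (forall z, U z -> V (g z)) -> holo U g -> holo V f -> holo U (fun z => f (g z)).
Proof.
  intros H Hg0 [f' Hf]. assert (Hg := Hg0). destruct Hg as [g' Hg].
  exists (fun z => f' (g z) * g' z). intros z Hz. split.
  - apply dquot_chain; [apply approach_C | now apply Hg | now apply Hf, H].
  - apply tends_mult; [apply locally_filter | | now apply Hg].
    apply tends_comp_cont with (g z); [apply locally_filter | now apply holo_cont with U | now apply Hf, H].
Qed.

Lemma holo_ext (U : C -> Prop) f g :
  (forall z, U z -> locally z U) -> (forall z, U z -> f z = g z) -> holo U f -> holo U g.
Proof.
  intros HU E [f' Hf]. exists f'. intros z Hz. split; [| now apply Hf].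
  apply is_cderive_ext_loc with f; [| now apply Hf].
  generalize (HU z Hz). apply filter_imp. auto.
Qed.

Lemma locally_dist_lt (c : C) (r : R) (z : C) :
  (Cmod (z - c) < r)%R -> locally z (fun w => (Cmod (w - c) < r)%R).
Proof.
  intros H. apply locally_Cmod. exists (r - Cmod (z - c))%R. split; [lra |].
  intros w Hw. replace (w - c) with ((w - z) + (z - c)) by ring.
  eapply Rle_lt_trans; [apply Cmod_triangle | lra].
Qed.

Lemma locally_dist_gt (c : C) (r : R) (z : C) :
  (r < Cmod (z - c))%R -> locally z (fun w => (r < Cmod (w - c))%R).
Proof.
  intros H. apply locally_Cmod. exists (Cmod (z - c) - r)%R. split; [lra |].
  intros w Hw. assert (Cmod (z - c) <= Cmod (w - c) + Cmod (w - z))%R; [| lra].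
  replace (z - c) with ((w - c) + - (w - z)) by ring.
  eapply Rle_trans; [apply Cmod_triangle |]. rewrite Cmod_opp. lra.
Qed.

Lemma Cmod_minus_0 z : Cmod (z - 0) = Cmod z.
Proof. f_equal. ring. Qed.

Lemma locally_Cmod_lt (r : R) (z : C) : (Cmod z < r)%R -> locally z (fun w => (Cmod w < r)%R).
Proof.
  intros H. rewrite <- (Cmod_minus_0 z) in H. generalize (locally_dist_lt _ _ _ H).
  apply filter_imp. intros w. now rewrite Cmod_minus_0.
Qed.

Lemma locally_Cmod_gt (r : R) (z : C) : (r < Cmod z)%R -> locally z (fun w => (r < Cmod w)%R).
Proof.
  intros H. rewrite <- (Cmod_minus_0 z) in H. generalize (locally_dist_gt _ _ _ H).
  apply filter_imp. intros w. now rewrite Cmod_minus_0.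
Qed.

(** * Means over circles *)

Lemma im_le_Cmod (c : C) : (Rabs (Im c) <= Cmod c)%R.
Proof.
  replace (Im c) with (Re (- Ci * c)) by (destruct c; simpl; ring).
  eapply Rle_trans; [apply re_le_Cmod |]. rewrite Cmod_mult, Cmod_opp, Cmod_Ci. lra.
Qed.

Lemma Cmod_le_re_im (z : C) : (Cmod z <= Rabs (Re z) + Rabs (Im z))%R.
Proof.
  replace z with (RtoC (Re z) + Ci * RtoC (Im z)) at 1 by (destruct z; unfold Ci; apply injective_projections; simpl; ring).
  eapply Rle_trans; [apply Cmod_triangle |].
  rewrite Cmod_mult, Cmod_Ci, !Cmod_R. lra.
Qed.

Lemma re_minus (x y : C) : Re (x - y) = (Re x - Re y)%R.
Proof. unfold Cminus. rewrite re_plus, re_opp. reflexivity. Qed.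

Lemma im_minus (x y : C) : Im (x - y) = (Im x - Im y)%R.
Proof. unfold Cminus. rewrite im_plus, im_opp. reflexivity. Qed.

Definition pol (r t : R) : C := (r * cos t, r * sin t)%R.

Lemma Cmod_pol (r t : R) : (0 <= r)%R -> Cmod (pol r t) = r.
Proof.
  intros Hr. unfold Cmod, pol. simpl.
  replace (r * cos t * (r * cos t * 1) + r * sin t * (r * sin t * 1))%R with (r * r * (Rsqr (sin t) + Rsqr (cos t)))%R by (unfold Rsqr; ring).
  rewrite sin2_cos2, Rmult_1_r. now apply sqrt_square.
Qed.

Lemma pol_scal (r t : R) : pol r t = RtoC r * pol 1 t.
Proof. unfold pol, RtoC. apply injective_projections; simpl; ring. Qed.

Lemma tends_pair {T : Type} (F : (T -> Prop) -> Prop) {FF : Filter F} (a b : T -> R) (x y : R) :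
  filterlim a F (locally x) -> filterlim b F (locally y) -> tends F (fun p => (a p, b p) : C) (x, y).
Proof.
  intros Ha Hb eps He. assert (He2 : (0 < eps / 2)%R) by lra.
  assert (HA : F (fun p => (Rabs (a p - x) < eps / 2)%R)).
  { apply (Ha (fun u => (Rabs (u - x) < eps / 2)%R)). exists (mkposreal _ He2). intros u Hu. exact Hu. }
  assert (HB : F (fun p => (Rabs (b p - y) < eps / 2)%R)).
  { apply (Hb (fun u => (Rabs (u - y) < eps / 2)%R)). exists (mkposreal _ He2). intros u Hu. exact Hu. }
  generalize (filter_and _ _ HA HB). apply filter_imp. intros p [H1 H2].
  eapply Rle_lt_trans; [apply Cmod_le_re_im |].
  simpl. unfold Rminus in *. lra.
Qed.

Lemma tends_Re {T : Type} (F : (T -> Prop) -> Prop) {FF : Filter F} (f : T -> C) (l : C) :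
  tends F f l -> filterlim (fun x => Re (f x)) F (locally (Re l)).
Proof.
  intros H. apply filterlim_locally. intros eps. generalize (H eps (cond_pos eps)).
  apply filter_imp. intros x Hx. change (Rabs (Re (f x) - Re l) < eps)%R.
  replace (Re (f x) - Re l)%R with (Re (f x - l)) by apply re_minus.
  eapply Rle_lt_trans; [apply re_le_Cmod | exact Hx].
Qed.

Lemma tends_pol (r t : R) :
  tends (locally (r, t)) (fun p : R * R => pol (fst p) (snd p)) (pol r t).
Proof.
  apply tends_pair; [apply locally_filter | |].
  - apply (continuity_2d_pt_filterlim (fun u v => u * cos v)%R).
    apply continuity_2d_pt_mult; [apply continuity_2d_pt_id1 |].
    apply continuity_1d_2d_pt_comp; [| apply continuity_2d_pt_id2]. apply continuity_cos.
  - apply (continuity_2d_pt_filterlim (fun u v => u * sin v)%R).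
    apply continuity_2d_pt_mult; [apply continuity_2d_pt_id1 |].
    apply continuity_1d_2d_pt_comp; [| apply continuity_2d_pt_id2]. apply continuity_sin.
Qed.

Lemma approach_R (t : R) : approach (locally' t) RtoC t.
Proof.
  split.
  - apply locally'_filter.
  - unfold locally', within. apply filter_forall. intros y Hy E. now apply RtoC_inj in E.
  - intros eps He. exists (mkposreal _ He). intros y Hy _.
    rewrite <- RtoC_minus, Cmod_R. exact Hy.
Qed.

(** Bridge to real calculus: mean value theorem, parametric integrals and the fundamental theorem
    are applied to the two components. *)
Lemma dquot_is_derive (g : R -> C) (t : R) (l : C) :
  dquot (locally' t) RtoC t g l ->
  is_derive (fun s => Re (g s)) t (Re l) /\ is_derive (fun s => Im (g s)) t (Im l).
Proof.
  intros H.
  assert (K : forall eps, (0 < eps)%R -> exists d : posreal, forall h, h <> 0%R -> (Rabs h < d)%R ->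
     (Cmod (RtoC (/ h) * (g (t + h)%R - g t) - l) < eps)%R).
  { intros eps He. destruct (H eps He) as [d Hd]. exists d. intros h h0 Hh.
    specialize (Hd (t + h)%R). replace (RtoC (/ h) * (g (t + h)%R - g t) - l) with ((g (t + h)%R - g t) / (RtoC (t + h) - RtoC t) - l).
    - apply Hd.
      + change (Rabs (t + h - t) < d)%R. now replace (t + h - t)%R with h by ring.
      + intros E. apply h0. lra.
    - rewrite <- RtoC_minus. replace (t + h - t)%R with h by ring. rewrite RtoC_inv by auto. unfold Cdiv. ring. }
  split; apply is_derive_Reals; intros eps He; destruct (K eps He) as [d Hd]; exists d; intros h h0 Hh;
  specialize (Hd h h0 Hh).
  - replace ((Re (g (t + h)%R) - Re (g t)) / h - Re l)%R with (Re (RtoC (/ h) * (g (t + h)%R - g t) - l)) by (rewrite re_minus, re_scal_l, re_minus; unfold Rdiv; ring).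
    eapply Rle_lt_trans; [apply re_le_Cmod | exact Hd].
  - replace ((Im (g (t + h)%R) - Im (g t)) / h - Im l)%R with (Im (RtoC (/ h) * (g (t + h)%R - g t) - l)) by (rewrite im_minus, im_scal_l, im_minus; unfold Rdiv; ring).
    eapply Rle_lt_trans; [apply im_le_Cmod | exact Hd].
Qed.

Lemma is_derive_dquot (g : R -> C) (t : R) (l : C) :
  is_derive (fun s => Re (g s)) t (Re l) -> is_derive (fun s => Im (g s)) t (Im l) ->
  dquot (locally' t) RtoC t g l.
Proof.
  intros H1 H2 eps He. apply is_derive_Reals in H1, H2.
  destruct (H1 (eps / 2)%R ltac:(lra)) as [d1 Hd1]. destruct (H2 (eps / 2)%R ltac:(lra)) as [d2 Hd2].
  assert (Hd : (0 < Rmin d1 d2)%R) by (apply Rmin_pos; apply cond_pos).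
  exists (mkposreal _ Hd). intros y Hy Hne. simpl in y. change (Rabs (y - t) < Rmin d1 d2)%R in Hy.
  assert (h0 : (y - t)%R <> 0%R) by (intros E; apply Hne; lra).
  specialize (Hd1 (y - t)%R h0 (Rlt_le_trans _ _ _ Hy (Rmin_l _ _))).
  specialize (Hd2 (y - t)%R h0 (Rlt_le_trans _ _ _ Hy (Rmin_r _ _))).
  rewrite (Rplus_minus t y) in Hd1, Hd2.
  replace ((g y - g t) / (RtoC y - RtoC t) - l) with
    ((((Re (g y) - Re (g t)) / (y - t) - Re l)%R, ((Im (g y) - Im (g t)) / (y - t) - Im l)%R) : C).
  - eapply Rle_lt_trans; [apply Cmod_le_re_im |]. simpl. lra.
  - rewrite <- RtoC_minus. unfold Cdiv. rewrite <- RtoC_inv by auto.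
    destruct (g y), (g t), l. apply injective_projections; simpl; unfold Rdiv; ring.
Qed.

Lemma dquot_pol_t (r t : R) : dquot (locally' t) RtoC t (fun s => pol r s) (Ci * pol r t).
Proof.
  apply is_derive_dquot; simpl; auto_derive; auto; ring.
Qed.

Lemma dquot_pol_r (r t : R) : dquot (locally' r) RtoC r (fun s => pol s t) (pol 1 t).
Proof.
  apply is_derive_dquot; simpl; auto_derive; auto; ring.
Qed.

(** Integrating only the real part keeps every integral real. The imaginary part is recovered from a
    constant multiple of [f], which is why later statements carry a free multiplier [c]. *)
Definition circ (f : C -> C) (r : R) : R := RInt (fun t => Re (f (pol r t))) 0 (2 * PI).

Lemma locally_R_2d_slice (P : R * R -> Prop) (r t : R) :
  locally (r, t) P -> locally t (fun s => P (r, s)).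
Proof.
  intros [d Hd]. exists d. intros s Hs. apply Hd. split; [apply ball_center | exact Hs].
Qed.

Lemma slice_filterlim (r t : R) : filterlim (fun s : R => (r, s)) (locally t) (locally (r, t)).
Proof. intros P. apply locally_R_2d_slice. Qed.

Lemma continuous_Re_pol (f : C -> C) (r t : R) :
  tends (locally (pol r t)) f (f (pol r t)) -> continuous (fun s => Re (f (pol r s))) t.
Proof.
  intros H. apply tends_Re; [apply locally_filter |].
  apply tends_comp_cont with (pol r t); [apply locally_filter | | exact H].
  apply (tends_comp _ (locally (r, t)) (fun s => (r, s)) (fun p : R * R => pol (fst p) (snd p))).
  - apply slice_filterlim.
  - apply tends_pol.
Qed.

(** Cauchy-Riemann in polar form: the radial derivative of Re f equals 1/r times the angular
    derivative of Im f, whose integral over a full period is zero. *)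
Lemma circ_derive (f : C -> C) (r1 r2 r : R) :
  (0 <= r1)%R -> (r1 < r < r2)%R -> holo (fun z => r1 < Cmod z < r2)%R f -> is_derive (circ f) r 0%R.
Proof.
  intros H1 Hr Hf. assert (Hf' := Hf). destruct Hf' as [f' Hd].
  assert (HU : forall s t, (r1 < s < r2)%R -> (r1 < Cmod (pol s t) < r2)%R).
  { intros s t Hs. rewrite Cmod_pol; lra. }
  assert (Hder : forall s t, (r1 < s < r2)%R -> is_derive (fun u => Re (f (pol u t))) s (Re (f' (pol s t) * pol 1 t))).
  { intros s t Hs. apply (dquot_is_derive (fun u => f (pol u t))).
    apply (dquot_chain (approach_R s) (fun u => pol u t)); [apply dquot_pol_r | now apply Hd, HU]. }
  assert (Hloc : locally r (fun s => (r1 < s < r2)%R)).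
  { apply (open_and _ _ (open_gt r1) (open_lt r2)). exact Hr. }
  assert (E : RInt (fun t => Derive (fun u => Re (f (pol u t))) r) 0 (2 * PI) = 0%R).
  { rewrite (RInt_ext _ (fun t => Re (f' (pol r t) * pol 1 t))).
    2: { intros t _. apply is_derive_unique. now apply Hder. }
    apply is_RInt_unique.
    replace 0%R with (minus (/ r * Im (f (pol r (2 * PI)))) (/ r * Im (f (pol r 0))))%R at 2.
    2: { unfold pol. rewrite cos_2PI, sin_2PI, cos_0, sin_0. unfold minus, plus, opp; simpl. ring. }
    apply (is_RInt_derive (fun t => / r * Im (f (pol r t)))%R).
    (* The angular derivative of f is f' times i r e^(it), and Im (i w) = Re w. *)
    - intros t _. replace (Re (f' (pol r t) * pol 1 t)) with (/ r * Im (f' (pol r t) * (Ci * pol r t)))%R.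
      2: { rewrite (pol_scal r t). destruct (f' (RtoC r * pol 1 t)). simpl. field. lra. }
      apply is_derive_scal. apply (dquot_is_derive (fun u => f (pol r u))).
      apply (dquot_chain (approach_R t) (fun u => pol r u)); [apply dquot_pol_t | now apply Hd, HU].
    - intros t _. apply continuous_ext with (fun t => / r * Re (f' (pol r t) * pol r t))%R.
      { intros s. rewrite (pol_scal r s). simpl. field. lra. }
      apply (continuous_scal_r (V := R_NormedModule) (/ r)%R (fun t => Re (f' (pol r t) * pol r t))).
      apply (continuous_Re_pol (fun z => f' z * z)). apply tends_mult; [apply locally_filter | | apply tends_id].
      now apply Hd, HU. }
  rewrite <- E. apply (is_derive_RInt_param (fun u t => Re (f (pol u t)))).
  - generalize Hloc. apply filter_imp. intros s Hs t _. eexists. now apply Hder.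
  - intros t _. apply continuity_2d_pt_ext_loc with (fun u v => Re (f' (pol u v) * pol 1 v)).
    + destruct Hloc as [d Hdl]. exists d. intros u v Hu _. symmetry. apply is_derive_unique, Hder.
      apply Hdl. exact Hu.
    + apply continuity_2d_pt_filterlim. apply (tends_Re _ (fun p : R * R => f' (pol (fst p) (snd p)) * pol 1 (snd p))).
      apply tends_mult; [apply locally_filter | |].
      * apply tends_comp_cont with (pol r t); [apply locally_filter | apply tends_pol | now apply Hd, HU].
      * apply (tends_comp _ (locally (1%R, t)) (fun p : R * R => (1%R, snd p)) (fun p : R * R => pol (fst p) (snd p))); [| apply tends_pol].
        intros P [d Hdl]. exists d. intros p Hp. apply Hdl. split; [apply ball_center | apply Hp].
  - generalize Hloc. apply filter_imp. intros s Hs. apply (ex_RInt_continuous (V := R_CompleteNormedModule)).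
    intros t _. apply continuous_Re_pol. apply holo_cont with (fun z => r1 < Cmod z < r2)%R; auto.
Qed.

(** * Independence of the radius up to the boundary circles *)

Lemma RInt_param_continuous (F : R -> R -> R) (x b : R) :
  (0 <= b)%R -> (forall x y, continuity_2d_pt F x y) -> continuous (fun r => RInt (F r) 0 b) x.
Proof.
  intros Hb HF. apply filterlim_locally. intros eps.
  (* Uniform continuity is used on the compact rectangle [x-1, x+1] x [0, b]. Dividing by [b + 1]
     covers [b = 0] and keeps the final inequality strict. *)
  assert (He : (0 < eps / (b + 1))%R) by (apply Rdiv_lt_0_compat; [apply cond_pos | lra]).
  destruct (uniform_continuity_2d F (x - 1) (x + 1) 0 b (fun _ _ _ _ => HF _ _) (mkposreal _ He)) as [d Hd].
  assert (Hm : (0 < Rmin d 1)%R) by (apply Rmin_pos; [apply cond_pos | lra]).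
  exists (mkposreal _ Hm). intros y Hy. change (Rabs (y - x) < Rmin d 1)%R in Hy.
  assert (Hy1 := Rlt_le_trans _ _ _ Hy (Rmin_l _ _)). assert (Hy2 := Rlt_le_trans _ _ _ Hy (Rmin_r _ _)).
  apply Rabs_def2 in Hy2.
  assert (Hint : forall r, ex_RInt (F r) 0 b).
  { intros r. apply (ex_RInt_continuous (V := R_CompleteNormedModule)). intros t _.
    apply (filterlim_comp _ _ _ (fun s => (r, s)) (fun p : R * R => F (fst p) (snd p)) _ (locally (r, t))).
    - apply slice_filterlim.
    - apply continuity_2d_pt_filterlim. apply HF. }
  change (Rabs (RInt (F y) 0 b - RInt (F x) 0 b) < eps)%R.
  rewrite <- (RInt_minus (V := R_CompleteNormedModule)) by apply Hint.
  apply Rle_lt_trans with ((b - 0) * (eps / (b + 1)))%R.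
  - apply abs_RInt_le_const; auto.
    + apply (ex_RInt_minus (V := R_CompleteNormedModule)); apply Hint.
    + intros t Ht. apply Rlt_le. apply (Hd x t y t); try lra.
      replace (t - t)%R with 0%R by ring. rewrite Rabs_R0. apply cond_pos.
  - replace ((b - 0) * (eps / (b + 1)))%R with (eps - eps / (b + 1))%R by (field; lra). lra.
Qed.

Definition cont_within (D : C -> Prop) (f : C -> C) : Prop :=
  forall z, D z -> tends (within D (locally z)) f (f z).

Lemma cont_within_continuous_on D f : cont_within D f <-> continuous_on D f.
Proof.
  split; intros H z Hz; apply tends_filterlim; auto; apply within_filter, locally_filter.
Qed.

Lemma cont_within_of_cont (D : C -> Prop) f : (forall z, D z -> tends (locally z) f (f z)) -> cont_within D f.
Proof.
  intros H z Hz. apply tends_le with (locally z); [| auto].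
  intros P. unfold within. apply filter_imp. auto.
Qed.

Lemma cont_within_holo (D : C -> Prop) f : holo D f -> cont_within D f.
Proof. intros H. apply cont_within_of_cont. intros z Hz. now apply holo_cont with D. Qed.

Lemma cont_within_sub (D E : C -> Prop) f : (forall z, E z -> D z) -> cont_within D f -> cont_within E f.
Proof.
  intros HDE H z Hz. apply tends_le with (within D (locally z)); [| auto].
  intros P. unfold within. apply filter_imp. auto.
Qed.

Lemma cont_within_mult D f g : cont_within D f -> cont_within D g -> cont_within D (fun z => f z * g z).
Proof. intros Hf Hg z Hz. apply tends_mult; auto. apply within_filter, locally_filter. Qed.

Lemma cont_within_plus D f g : cont_within D f -> cont_within D g -> cont_within D (fun z => f z + g z).
Proof. intros Hf Hg z Hz. apply tends_plus; auto. apply within_filter, locally_filter. Qed.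

Lemma cont_within_ext (D : C -> Prop) f g : (forall z, D z -> f z = g z) -> cont_within D f -> cont_within D g.
Proof.
  intros E H z Hz. rewrite <- (E z Hz). apply tends_ext_loc with f; auto.
  - apply within_filter, locally_filter.
  - unfold within. apply filter_forall. auto.
Qed.

Definition clamp (a b r : R) : R := Rmax a (Rmin b r).

Lemma clamp_in a b r : (a <= b)%R -> (a <= clamp a b r <= b)%R.
Proof. intros H. unfold clamp. split; [apply Rmax_l | apply Rmax_lub; [auto | apply Rmin_l]]. Qed.

Lemma clamp_id a b r : (a <= r <= b)%R -> clamp a b r = r.
Proof. intros H. unfold clamp. rewrite Rmin_right, Rmax_right; lra. Qed.

Lemma clamp_lip a b r s : (Rabs (clamp a b r - clamp a b s) <= Rabs (r - s))%R.
Proof.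
  unfold clamp. apply Rabs_le.
  pose proof (Rle_abs (r - s)). pose proof (Rle_abs (- (r - s))). rewrite Rabs_Ropp in *.
  unfold Rmin. destruct (Rle_dec b r), (Rle_dec b s); unfold Rmax;
  repeat match goal with |- context [Rle_dec ?x ?y] => destruct (Rle_dec x y) end; lra.
Qed.

(* A continuous function on a closed annulus becomes continuous in polar coordinates on the
   whole plane by clamping the radius. *)
Lemma circ_clamp_cont (f : C -> C) (a b : R) :
  (0 <= a <= b)%R -> cont_within (fun z => a <= Cmod z <= b)%R f ->
  forall r, continuous (fun s => circ f (clamp a b s)) r.
Proof.
  intros Hab Hf r. apply (RInt_param_continuous (fun s t => Re (f (pol (clamp a b s) t)))).
  { pose proof PI_RGT_0. lra. }
  intros x y. apply continuity_2d_pt_filterlim.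
  apply (tends_Re _ (fun p : R * R => f (pol (clamp a b (fst p)) (snd p)))).
  assert (Hin : forall s t, (a <= Cmod (pol (clamp a b s) t) <= b)%R).
  { intros s t. destruct (clamp_in a b s ltac:(lra)). rewrite Cmod_pol; [split; assumption | lra]. }
  apply (tends_comp _ (within (fun z => a <= Cmod z <= b)%R (locally (pol (clamp a b x) y))) (fun p : R * R => pol (clamp a b (fst p)) (snd p))); [| now apply Hf].
  intros P HP. unfold within in HP.
  assert (L : tends (locally (x, y)) (fun p : R * R => pol (clamp a b (fst p)) (snd p)) (pol (clamp a b x) y)).
  { apply (tends_comp _ (locally (clamp a b x, y)) (fun p : R * R => (clamp a b (fst p), snd p)) (fun p : R * R => pol (fst p) (snd p))); [| apply tends_pol].
    intros Q [d Hd]. exists d. intros p [Hp1 Hp2]. apply Hd. split; [| exact Hp2].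
    eapply Rle_lt_trans; [apply clamp_lip | exact Hp1]. }
  apply tends_filterlim in L; [| apply locally_filter].
  generalize (L _ HP). unfold filtermap. apply filter_imp. intros p H. apply H, Hin.
Qed.

(** Mean value theorem in the radius: zero derivative on the open annulus, continuity up to its
    edges by clamping. Holomorphy is not asked on the two boundary circles, so boundary values on
    the unit circle are admissible; [a = 0] reduces the inner circle to a point. *)
Lemma circ_eq (f : C -> C) (a b : R) :
  (0 <= a <= b)%R -> cont_within (fun z => a <= Cmod z <= b)%R f ->
  holo (fun z => a < Cmod z < b)%R f -> circ f a = circ f b.
Proof.
  intros Hab Hc Hf. destruct (Req_dec a b) as [-> | Hne]; auto.
  destruct (MVT_gen (fun s => circ f (clamp a b s)) a b (fun _ => 0%R)) as [c [_ Hmvt]].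
  - intros x Hx. rewrite Rmin_left, Rmax_right in Hx by lra.
    apply is_derive_ext_loc with (circ f); [| now apply circ_derive with a b].
    assert (L : locally x (fun s => (a < s < b)%R)) by (apply (open_and _ _ (open_gt a) (open_lt b)); lra).
    generalize L. apply filter_imp. intros s Hs. now rewrite clamp_id by lra.
  - intros x _. apply continuity_pt_filterlim. exact (circ_clamp_cont f a b Hab Hc x).
  - rewrite !clamp_id in Hmvt by lra. lra.
Qed.

Lemma ex_RInt_circ (f : C -> C) (r : R) :
  (0 <= r)%R -> cont_within (fun z => Cmod z = r) f -> ex_RInt (fun t => Re (f (pol r t))) 0 (2 * PI).
Proof.
  intros Hr Hf. apply (ex_RInt_continuous (V := R_CompleteNormedModule)). intros t _.
  apply tends_Re; [apply locally_filter |].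
  apply (tends_comp _ (within (fun z => Cmod z = r) (locally (pol r t))) (fun s => pol r s)).
  - intros P HP. unfold within in HP.
    assert (L : tends (locally t) (fun s => pol r s) (pol r t)).
    { apply (tends_comp _ (locally (r, t)) (fun s => (r, s)) (fun p : R * R => pol (fst p) (snd p))).
      - apply slice_filterlim.
      - apply tends_pol. }
    apply tends_filterlim in L; [| apply locally_filter].
    generalize (L _ HP). unfold filtermap. apply filter_imp. intros s H. apply H. now apply Cmod_pol.
  - apply Hf. now apply Cmod_pol.
Qed.

Lemma circ_ext (f g : C -> C) r :
  (0 <= r)%R -> (forall z, Cmod z = r -> f z = g z) -> circ f r = circ g r.
Proof. intros Hr E. apply RInt_ext. intros t _. rewrite E; auto. now apply Cmod_pol. Qed.

Lemma circ_plus f g r :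
  (0 <= r)%R -> cont_within (fun z => Cmod z = r) f -> cont_within (fun z => Cmod z = r) g ->
  circ (fun z => f z + g z) r = (circ f r + circ g r)%R.
Proof.
  intros Hr Hf Hg. unfold circ.
  rewrite <- (RInt_plus (V := R_CompleteNormedModule)) by (now apply ex_RInt_circ).
  apply RInt_ext. intros t _. reflexivity.
Qed.

Lemma circ_const c r : circ (fun _ => c) r = (2 * PI * Re c)%R.
Proof. unfold circ. rewrite RInt_const. change (((2 * PI - 0) * Re c)%R = (2 * PI * Re c)%R). ring. Qed.

Lemma circ_bound f r K :
  (0 <= r)%R -> cont_within (fun z => Cmod z = r) f -> (forall z, Cmod z = r -> (Cmod (f z) <= K)%R) ->
  (Rabs (circ f r) <= 2 * PI * K)%R.
Proof.
  intros Hr Hf HK. unfold circ. replace (2 * PI * K)%R with ((2 * PI - 0) * K)%R by ring.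
  apply abs_RInt_le_const.
  - pose proof PI_RGT_0. lra.
  - now apply ex_RInt_circ.
  - intros t _. eapply Rle_trans; [apply re_le_Cmod |]. apply HK. now apply Cmod_pol.
Qed.

Lemma circ_0 f : circ f 0 = (2 * PI * Re (f 0))%R.
Proof.
  rewrite <- circ_const with (r := 0%R). apply circ_ext; [lra |].
  intros z Hz. f_equal. now apply Cmod_eq_0.
Qed.

(** * Series of complex numbers *)

Fixpoint psum (a : nat -> C) (n : nat) : C :=
  match n with O => 0 | S m => psum a m + a m end.

Definition csum (a : nat -> C) (l : C) : Prop := tends eventually (psum a) l.

Lemma csum_is_series a l : csum a l <-> @is_series C_AbsRing C_NormedModule a l.
Proof.
  assert (E : forall n, @sum_n C_NormedModule a n = psum a (S n)).
  { induction n; [rewrite sum_O; simpl; ring | rewrite sum_Sn, IHn; reflexivity]. }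
  split; intros H.
  - unfold is_series. apply (tends_filterlim eventually (sum_n (G := C_NormedModule) a) l).
    intros eps He. destruct (H eps He) as [N HN]. exists N. intros n Hn. rewrite E. apply HN. lia.
  - unfold is_series in H. apply (tends_filterlim eventually (sum_n (G := C_NormedModule) a) l) in H.
    intros eps He. destruct (H eps He) as [N HN]. exists (S N). intros [| n] Hn; [lia |]. rewrite <- E. apply HN. lia.
Qed.

Lemma csum_is_pseries c z l :
  csum (fun n => z ^ n * c n) l <-> @is_pseries C_AbsRing C_NormedModule c z l.
Proof.
  unfold is_pseries. rewrite csum_is_series.
  assert (E : (fun k => z ^ k * c k) = (fun k => scal (pow_n (K := C_AbsRing) z k) (c k) : C)).
  { apply functional_extensionality. intros k. reflexivity. }
  rewrite E. reflexivity.
Qed.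

Lemma csum_unique a l m : csum a l -> csum a m -> l = m.
Proof. apply (tends_unique eventually). Qed.

Lemma psum_ext a b n : (forall k, a k = b k) -> psum a n = psum b n.
Proof. intros E. induction n; simpl; congruence. Qed.

Lemma csum_ext a b l : (forall k, a k = b k) -> csum a l -> csum b l.
Proof. intros E. apply tends_ext; [apply eventually_filter |]. intros n. now apply psum_ext. Qed.

Lemma csum_plus a b l m : csum a l -> csum b m -> csum (fun k => a k + b k) (l + m).
Proof.
  intros Ha Hb. eapply tends_ext; [apply eventually_filter | | exact (tends_plus eventually _ _ _ _ Ha Hb)].
  induction x; simpl; [ring | rewrite <- IHx; ring].
Qed.

Lemma csum_scal c a l : csum a l -> csum (fun k => c * a k) (c * l).
Proof.
  intros Ha. eapply tends_ext; [apply eventually_filter | | exact (tends_mult eventually _ _ _ _ (tends_const eventually c) Ha)].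
  induction x; simpl; [ring | rewrite <- IHx; ring].
Qed.

Lemma csum_opp a l : csum a l -> csum (fun k => - a k) (- l).
Proof.
  intros H. replace (- l) with ((-(1)) * l) by ring. apply csum_ext with (fun k => (-(1)) * a k); [intros; ring |].
  now apply csum_scal.
Qed.

Lemma csum_minus a b l m : csum a l -> csum b m -> csum (fun k => a k - b k) (l - m).
Proof. intros Ha Hb. apply csum_plus; auto. now apply csum_opp. Qed.

Lemma psum_shift a n : psum a (S n) = a O + psum (fun k => a (S k)) n.
Proof. induction n; simpl in *; [ring | rewrite IHn; ring]. Qed.

Lemma tends_eventually_S (u : nat -> C) l : tends eventually u l <-> tends eventually (fun n => u (S n)) l.
Proof.
  split; intros H eps He; destruct (H eps He) as [N HN].
  - exists N. intros n Hn. apply HN. lia.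
  - exists (S N). intros [| n] Hn; [lia |]. apply HN. lia.
Qed.

Lemma csum_shift a l : csum (fun k => a (S k)) l <-> csum a (a O + l).
Proof.
  unfold csum. rewrite (tends_eventually_S (psum a)). split; intros H.
  - apply tends_ext with (fun n => a O + psum (fun k => a (S k)) n).
    + apply eventually_filter.
    + intros n. now rewrite psum_shift.
    + apply tends_plus; auto; [apply eventually_filter | apply (tends_const eventually)].
  - apply tends_ext with (fun n => psum a (S n) - a O).
    + apply eventually_filter.
    + intros n. rewrite psum_shift. ring.
    + replace l with (a O + l - a O) by ring. apply tends_minus; auto; [apply eventually_filter | apply (tends_const eventually)].
Qed.

Lemma Cmod_lim_le {T : Type} (F : (T -> Prop) -> Prop) {FF : ProperFilter F} (f : T -> C) (l m : C) (K : R) :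
  tends F f l -> F (fun x => (Cmod (f x - m) <= K)%R) -> (Cmod (l - m) <= K)%R.
Proof.
  intros Hf HK. apply Rle_plus_epsilon. intros eps He.
  destruct (filter_ex (F := F) _ (filter_and (F := F) _ _ (Hf eps He) HK)) as [x [H1 H2]].
  replace (l - m) with ((f x - m) + - (f x - l)) by ring.
  eapply Rle_trans; [apply Cmod_triangle |]. rewrite Cmod_opp. lra.
Qed.

Lemma psum_geom_tail a K q n p :
  (0 <= q < 1)%R -> (forall k, (Cmod (a k) <= K * q ^ k)%R) ->
  (Cmod (psum a (n + p) - psum a n) <= K / (1 - q) * (q ^ n - q ^ (n + p)))%R.
Proof.
  intros Hq Ha. induction p.
  - rewrite Nat.add_0_r. replace (psum a n - psum a n) with (RtoC 0) by ring. rewrite Cmod_0.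
    replace (q ^ n - q ^ n)%R with 0%R by ring. lra.
  - rewrite Nat.add_succ_r. simpl psum.
    replace (psum a (n + p) + a (n + p)%nat - psum a n) with ((psum a (n + p) - psum a n) + a (n + p)%nat) by ring.
    eapply Rle_trans; [apply Cmod_triangle |].
    apply Rle_trans with (K / (1 - q) * (q ^ n - q ^ (n + p)) + K * q ^ (n + p))%R.
    + apply Rplus_le_compat; auto.
    + simpl. right. field. lra.
Qed.

Lemma geom_K_pos a K q : (forall k, (Cmod (a k) <= K * q ^ k)%R) -> (0 <= K)%R.
Proof. intros Ha. specialize (Ha O). pose proof (Cmod_ge_0 (a O)). simpl in Ha. lra. Qed.

Lemma csum_tail a K q l n :
  (0 <= q < 1)%R -> (forall k, (Cmod (a k) <= K * q ^ k)%R) -> csum a l ->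
  (Cmod (l - psum a n) <= K / (1 - q) * q ^ n)%R.
Proof.
  intros Hq Ha Hl. apply (Cmod_lim_le eventually (psum a)); auto.
  exists n. intros m Hm. replace m with (n + (m - n))%nat by lia.
  eapply Rle_trans; [now apply psum_geom_tail with (q := q) (K := K) |].
  apply Rmult_le_compat_l.
  - apply Rdiv_le_0_compat; [now apply geom_K_pos with a q | lra].
  - pose proof (pow_le q (n + (m - n)) ltac:(lra)). lra.
Qed.

Lemma csum_bound a K q l :
  (0 <= q < 1)%R -> (forall k, (Cmod (a k) <= K * q ^ k)%R) -> csum a l -> (Cmod l <= K / (1 - q))%R.
Proof.
  intros Hq Ha Hl. pose proof (csum_tail a K q l O Hq Ha Hl) as H. simpl in H.
  replace (l - 0) with l in H by ring. lra.
Qed.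

Lemma csum_geom_ex a K q :
  (0 <= q < 1)%R -> (forall k, (Cmod (a k) <= K * q ^ k)%R) -> exists l, csum a l.
Proof.
  intros Hq Ha. destruct (ex_series_le (K := C_AbsRing) (V := C_CompleteNormedModule) a (fun k => K * q ^ k)%R) as [l Hl].
  - exact Ha.
  - apply (ex_series_scal_l K (fun k => q ^ k)%R). exists (/ (1 - q))%R. apply is_series_geom. rewrite Rabs_pos_eq; lra.
  - exists l. now apply csum_is_series.
Qed.

Lemma Clim_eq (F : (C -> Prop) -> Prop) {FF : ProperFilter F} f l : tends F f l -> Clim F f = l.
Proof.
  intros H. unfold Clim.
  match goal with |- context [excluded_middle_informative ?P] => destruct (excluded_middle_informative P) as [E | E] end.
  - destruct (constructive_indefinite_description _ E) as [l' Hl']. simpl.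
    apply (tends_unique F f); auto. apply tends_filterlim; auto. apply filter_filter.
  - exfalso. apply E. exists l. apply tends_filterlim; auto. apply filter_filter.
Qed.

(** Chosen sums make the value of a series a function of its parameters; [Csum_correct] gives it
    meaning. *)
Definition Csum (a : nat -> C) : C := epsilon (inhabits (RtoC 0)) (csum a).

Lemma Csum_correct a : (exists l, csum a l) -> csum a (Csum a).
Proof. apply epsilon_spec. Qed.

Lemma Csum_eq a l : csum a l -> Csum a = l.
Proof. intros H. apply (csum_unique a); auto. apply Csum_correct. eauto. Qed.

(** * Difference quotients with the removable singularity filled in *)

Definition slope (f : C -> C) (w l z : C) : C := if Ceq_dec z w then l else (f z - f w) / (z - w).

Lemma slope_eq f w l : slope f w l w = l.
Proof. unfold slope. now destruct (Ceq_dec w w). Qed.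

Lemma slope_neq f w l z : z <> w -> slope f w l z = (f z - f w) / (z - w).
Proof. unfold slope. now destruct (Ceq_dec z w). Qed.

Lemma slope_cont f w l : is_cderive f w l -> tends (locally w) (slope f w l) l.
Proof.
  intros H eps He. generalize (H eps He). unfold locally', within. apply filter_imp. intros z Hz.
  destruct (classic (z = w)) as [-> | E]; [rewrite slope_eq | rewrite slope_neq; auto].
  replace (l - l) with (RtoC 0) by ring. now rewrite Cmod_0.
Qed.

Lemma open_neq (w z : C) : z <> w -> locally z (fun x => x <> w).
Proof.
  intros H. apply locally_Cmod. exists (Cmod (z - w)). split.
  - apply Cmod_gt_0. now apply Cminus_eq_contra.
  - intros x Hx ->. rewrite <- Cmod_opp in Hx. replace (- (w - z)) with (z - w) in Hx by ring. lra.
Qed.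

Lemma holo_inv_sub (U : C -> Prop) (w : C) :
  (forall z, U z -> z - w <> 0) -> holo U (fun z => / (z - w)).
Proof. intros H. apply holo_inv; auto. apply holo_minus; [apply holo_id | apply holo_const]. Qed.

Lemma holo_slope (U : C -> Prop) f w l :
  (forall z, U z -> locally z U) -> holo U f -> holo (fun z => U z /\ z <> w) (slope f w l).
Proof.
  intros HU Hf. apply holo_ext with (fun z => (f z - f w) * / (z - w)).
  - intros z [H1 H2]. apply filter_and; [now apply HU | now apply open_neq].
  - intros z [_ Hz]. now rewrite slope_neq.
  - apply holo_mult.
    + apply holo_minus; [| apply holo_const]. now apply holo_sub with U; [intros z [] |].
    + apply holo_inv_sub. intros z [_ Hz]. now apply Cminus_eq_contra.
Qed.

Lemma open_ann (a b : R) (z : C) : (a < Cmod z < b)%R -> locally z (fun w => a < Cmod w < b)%R.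
Proof. intros [H1 H2]. apply filter_and; [now apply locally_Cmod_gt | now apply locally_Cmod_lt]. Qed.

(* The circle through [w] may be crossed because only continuity is needed there. *)
Lemma circ_slope f w a b :
  (0 <= a <= Cmod w)%R -> (Cmod w <= b)%R ->
  cont_within (fun z => a <= Cmod z <= b)%R f -> holo (fun z => a < Cmod z < b)%R f ->
  (exists l, is_cderive f w l) ->
  exists l, cont_within (fun z => a <= Cmod z <= b)%R (slope f w l) /\
    forall c, circ (fun z => c * (z * slope f w l z)) a = circ (fun z => c * (z * slope f w l z)) b.
Proof.
  intros Ha Hb Hc Hf [l Hl].
  exists l.
  assert (Hs : cont_within (fun z => a <= Cmod z <= b)%R (slope f w l)).
  { intros z Hz. destruct (classic (z = w)) as [-> | E].
    - rewrite slope_eq. apply tends_le with (locally w); [| now apply slope_cont].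
      intros P. unfold within. apply filter_imp. auto.
    - rewrite slope_neq by auto.
      assert (FF : Filter (within (fun z => a <= Cmod z <= b)%R (locally z))) by apply within_filter, locally_filter.
      apply tends_ext_loc with (fun x => (f x - f w) * / (x - w)); [auto | |].
      + unfold within. generalize (open_neq _ _ E). apply filter_imp. intros x Hx _. now rewrite slope_neq.
      + apply tends_mult; auto.
        * apply tends_minus; [auto | now apply Hc | now apply tends_const].
        * apply tends_inv; [auto | now apply Cminus_eq_contra |].
          apply tends_minus; [auto | | now apply tends_const].
          apply tends_le with (locally z); [| apply tends_id]. intros P. unfold within. apply filter_imp. auto. }
  split; auto. intros c.
  assert (Hg : cont_within (fun z => a <= Cmod z <= b)%R (fun z => c * (z * slope f w l z))).
  { apply cont_within_mult; [apply cont_within_holo, holo_const |].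
    apply cont_within_mult; [apply cont_within_holo, holo_id | auto]. }
  assert (Hh : holo (fun z => (a < Cmod z < b)%R /\ z <> w) (fun z => c * (z * slope f w l z))).
  { apply holo_mult; [apply holo_const |]. apply holo_mult; [apply holo_id |].
    apply holo_slope; auto. intros z Hz. now apply open_ann. }
  transitivity (circ (fun z => c * (z * slope f w l z)) (Cmod w)).
  - apply circ_eq; [lra | |].
    + apply cont_within_sub with (2 := Hg). intros z Hz. lra.
    + apply holo_sub with (2 := Hh). intros z Hz. split; [lra |]. intros ->. lra.
  - apply circ_eq; [lra | |].
    + apply cont_within_sub with (2 := Hg). intros z Hz. lra.
    + apply holo_sub with (2 := Hh). intros z Hz. split; [lra |]. intros ->. lra.
Qed.

(** * Cauchy's formula on a disc *)

Lemma Rabs_le_all_0 (x : R) (g : R -> R) (r : R) :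
  (forall R', (r < R')%R -> (Rabs x <= g R')%R) -> (forall eps, (0 < eps)%R -> exists R', (r < R')%R /\ (g R' <= eps)%R) -> x = 0%R.
Proof.
  intros H1 H2. destruct (Req_dec x 0) as [| Hne]; auto. exfalso.
  assert (Hp := Rabs_pos_lt _ Hne). destruct (H2 (Rabs x / 2)%R ltac:(lra)) as [R' [HR Hg]].
  specialize (H1 R' HR). lra.
Qed.

Lemma Cmod_minus_ge (z w : C) : (Cmod z - Cmod w <= Cmod (z - w))%R.
Proof.
  assert (Cmod z <= Cmod (z - w) + Cmod w)%R; [| lra].
  replace z with ((z - w) + w) at 1 by ring. apply Cmod_triangle.
Qed.

Lemma neq_of_Cmod (z w : C) : Cmod z <> Cmod w -> z - w <> 0.
Proof. intros H. apply Cminus_eq_contra. intros ->. now apply H. Qed.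

(** Write z/(z-w) = 1 + w/(z-w). The first term gives the value; the mean of the second does not
    depend on the radius and is O(1/R) on the circle of radius R, hence zero. *)
Lemma circ_pole_inside w c r :
  (Cmod w < r)%R -> circ (fun z => c * (z / (z - w))) r = (2 * PI * Re c)%R.
Proof.
  intros Hr. pose proof (Cmod_ge_0 w) as H0. pose proof PI_RGT_0 as Hpi.
  assert (Hh : holo (fun z => Cmod w < Cmod z)%R (fun z => c * w * / (z - w))).
  { apply holo_mult; [apply holo_const |]. apply holo_inv_sub.
    intros z Hz. apply neq_of_Cmod. lra. }
  rewrite (circ_ext _ (fun z => c + c * w * / (z - w))); [| lra |].
  2: { intros z Hz. field. apply neq_of_Cmod. lra. }
  rewrite circ_plus, circ_const.
  4: { apply cont_within_holo, holo_sub with (2 := Hh). intros z Hz. lra. }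
  3: { apply cont_within_holo, holo_const. }
  2: lra.
  rewrite (Rabs_le_all_0 (circ (fun z => c * w * / (z - w)) r) (fun R' => 2 * PI * (Cmod (c * w) * / (R' - Cmod w)))%R r); [ring | |].
  - intros R' HR'. rewrite (circ_eq _ r R'); [| lra | |].
    + apply circ_bound; [lra | |].
      * apply cont_within_holo, holo_sub with (2 := Hh). intros z Hz. lra.
      * intros z Hz. rewrite Cmod_mult, Cmod_inv by (apply neq_of_Cmod; lra).
        apply Rmult_le_compat_l; [apply Cmod_ge_0 |]. apply Rinv_le_contravar; [lra |].
        pose proof (Cmod_minus_ge z w). lra.
    + apply cont_within_holo, holo_sub with (2 := Hh). intros z Hz. lra.
    + apply holo_sub with (2 := Hh). intros z Hz. lra.
  - intros eps He. pose (A := (2 * PI * Cmod (c * w))%R).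
    assert (HA : (0 <= A)%R) by (unfold A; pose proof (Cmod_ge_0 (c * w)); apply Rmult_le_pos; lra).
    (* At this radius R' - |w| exceeds (A+1)/eps, so the bound is at most A eps/(A+1); the added 1
       covers A = 0. *)
    exists (r + (A + 1) / eps)%R.
    assert (Hp : (0 < (A + 1) / eps)%R) by (apply Rdiv_lt_0_compat; lra).
    split; [lra |].
    replace (2 * PI * (Cmod (c * w) * / (r + (A + 1) / eps - Cmod w)))%R with (A * / (r + (A + 1) / eps - Cmod w))%R by (unfold A; ring).
    apply Rle_trans with (A * / ((A + 1) / eps))%R.
    + apply Rmult_le_compat_l; auto. apply Rinv_le_contravar; lra.
    + replace (A * / ((A + 1) / eps))%R with (eps - eps / (A + 1))%R by (field; lra).
      assert (0 < eps / (A + 1))%R by (apply Rdiv_lt_0_compat; lra). lra.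
Qed.

(** The filled-in difference quotient times z vanishes at 0, so its mean is zero on every circle.
    What remains is f(w) times the mean of z/(z-w). *)
Lemma cauchy_disc f w r R0 c :
  (Cmod w < r)%R -> (r < R0)%R -> holo (fun z => Cmod z < R0)%R f ->
  circ (fun z => c * (z * f z / (z - w))) r = (2 * PI * Re (c * f w))%R.
Proof.
  intros Hw Hr Hf. pose proof (Cmod_ge_0 w) as H0.
  destruct (circ_slope f w 0 r) as [l [Hs Hl]]; try lra.
  - apply cont_within_holo, holo_sub with (2 := Hf). intros z Hz. lra.
  - apply holo_sub with (2 := Hf). intros z Hz. lra.
  - destruct Hf as [f' Hf]. exists (f' w). apply Hf. lra.
  - specialize (Hl c). rewrite circ_0 in Hl. replace (c * (0 * slope f w l 0)) with (RtoC 0) in Hl by ring.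
    rewrite re_RtoC, Rmult_0_r in Hl.
    assert (Hcc : cont_within (fun z => Cmod z = r) (fun z => c * (z * slope f w l z))).
    { apply cont_within_mult; [apply cont_within_holo, holo_const |].
      apply cont_within_mult; [apply cont_within_holo, holo_id |].
      apply cont_within_sub with (2 := Hs). intros z Hz. lra. }
    rewrite (circ_ext _ (fun z => c * (z * slope f w l z) + (c * f w) * (z / (z - w)))); [| lra |].
    2: { intros z Hz. rewrite slope_neq; [field |]. { apply neq_of_Cmod. lra. } intros ->. lra. }
    rewrite circ_plus; [rewrite <- Hl, circ_pole_inside by lra; ring | lra | auto |].
    apply cont_within_mult; [apply cont_within_holo, holo_const |].
    apply (cont_within_mult _ (fun z => z) (fun z => / (z - w))); [apply cont_within_holo, holo_id |].
    apply cont_within_holo, holo_inv_sub. intros z Hz. apply neq_of_Cmod. lra.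
Qed.

(** * From Cauchy's formula to power series *)

(** The complex mean of [g] over the circle; since Re (i g) = - Im g, the second component carries a
    minus sign. *)
Definition cmean (g : C -> C) (r : R) : C :=
  ((/ (2 * PI) * circ g r)%R, (- (/ (2 * PI) * circ (fun z => (Ci * g z)%C) r))%R).

Lemma circ_scal (k : R) g r :
  (0 <= r)%R -> cont_within (fun z => Cmod z = r) g ->
  circ (fun z => RtoC k * g z) r = (k * circ g r)%R.
Proof.
  intros Hr Hg. unfold circ.
  transitivity (scal k (RInt (fun t => Re (g (pol r t))) 0 (2 * PI))); [| reflexivity].
  rewrite <- (RInt_scal (V := R_CompleteNormedModule)) by now apply ex_RInt_circ.
  apply RInt_ext. intros t _. now rewrite re_scal_l.
Qed.

Lemma cont_within_const D c : cont_within D (fun _ => c).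
Proof. apply cont_within_holo, holo_const. Qed.

Lemma cont_within_id D : cont_within D (fun z => z).
Proof. apply cont_within_holo, holo_id. Qed.

Lemma holo_pow U n : holo U (fun z => z ^ n).
Proof.
  induction n; [exact (holo_const U 1) |].
  apply (holo_mult U (fun z => z) (fun z => z ^ n)); [apply holo_id | auto].
Qed.

Lemma circ_cmean c g r :
  (0 <= r)%R -> cont_within (fun z => Cmod z = r) g ->
  circ (fun z => c * g z) r = (2 * PI * Re (c * cmean g r))%R.
Proof.
  intros Hr Hg.
  assert (Hi : cont_within (fun z => Cmod z = r) (fun z => Ci * g z)) by (apply cont_within_mult; auto using cont_within_const).
  rewrite (circ_ext _ (fun z => RtoC (Re c) * g z + RtoC (Im c) * (Ci * g z))); [| auto |].
  2: { intros z _. transitivity ((RtoC (Re c) + RtoC (Im c) * Ci) * g z); [| ring]. f_equal.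
       destruct c. apply injective_projections; simpl; ring. }
  rewrite circ_plus, !circ_scal; auto; try (apply cont_within_mult; auto using cont_within_const).
  unfold cmean. destruct c. simpl. field. apply PI_neq0.
Qed.

(** Finite geometric expansion z/(z-w) = sum of (w/z)^n for n < N, plus (w/z)^N z/(z-w). Keeping the
    remainder exact avoids exchanging an integral with an infinite sum. *)
Lemma cauchy_rep_expand f r w c N :
  (Cmod w < r)%R -> cont_within (fun z => Cmod z = r) f ->
  circ (fun z => c * (z * f z / (z - w))) r =
  (2 * PI * Re (c * psum (fun n => w ^ n * cmean (fun z => f z * / z ^ n) r) N)%C
   + circ (fun z => c * (w ^ N * (f z * (z * / (z - w) * / z ^ N))))%C r)%R.
Proof.
  intros Hw Hf. pose proof (Cmod_ge_0 w) as H0.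
  assert (Hz : forall n, cont_within (fun z => Cmod z = r) (fun z => / z ^ n)).
  { intros n. apply cont_within_holo, holo_inv.
    - intros z Hz. apply Cpow_nz. apply Cmod_gt_0. lra.
    - apply holo_pow. }
  assert (Hzw : cont_within (fun z => Cmod z = r) (fun z => / (z - w))).
  { apply cont_within_holo, holo_inv_sub. intros z Hz'. apply neq_of_Cmod. lra. }
  assert (Hg : forall n, cont_within (fun z => Cmod z = r) (fun z => c * (w ^ n * (f z * (z * / (z - w) * / z ^ n))))).
  { intros n. repeat apply cont_within_mult; auto using cont_within_const, cont_within_id. }
  induction N.
  - simpl psum. rewrite Cmult_0_r, re_RtoC, Rmult_0_r, Rplus_0_l. apply circ_ext; [lra |].
    intros z Hz'. simpl. field. apply neq_of_Cmod. lra.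
  - rewrite IHN. simpl psum. rewrite (Cmult_plus_distr_l c), re_plus, Rmult_plus_distr_l, Rplus_assoc. f_equal.
    rewrite Cmult_assoc, <- circ_cmean; [| lra | now apply cont_within_mult].
    rewrite <- circ_plus; [| lra | apply cont_within_mult; [apply cont_within_const | now apply cont_within_mult] | auto].
    apply circ_ext; [lra |]. intros z Hz'. simpl. field. repeat split.
    + apply Cpow_nz. apply Cmod_gt_0. lra.
    + apply Cmod_gt_0. lra.
    + apply neq_of_Cmod. lra.
Qed.

Lemma Rpow_div (x y : R) n : ((x / y) ^ n = x ^ n / y ^ n)%R.
Proof. unfold Rdiv. now rewrite Rpow_mult_distr, pow_inv. Qed.

(** Separated from holomorphy because it survives uniform limits: one passage to power series then
    serves holomorphic functions and their limits. *)
Definition cauchy_rep (f : C -> C) (r : R) : Prop :=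
  forall w c, (Cmod w < r)%R -> circ (fun z => c * (z * f z / (z - w))) r = (2 * PI * Re (c * f w))%R.

Lemma Re_Cmult_Ci (z : C) : Re (- Ci * z) = Im z.
Proof. destruct z. simpl. ring. Qed.

Lemma pow_to_0 (q K eps : R) :
  (0 <= q < 1)%R -> (0 < eps)%R -> exists N, forall n, (N <= n)%nat -> (K * q ^ n < eps)%R.
Proof.
  intros Hq He. assert (HK : (0 < Rabs K + 1)%R) by (pose proof (Rabs_pos K); lra).
  destruct (pow_lt_1_zero q ltac:(rewrite Rabs_pos_eq; lra) (eps / (Rabs K + 1)) ltac:(now apply Rdiv_lt_0_compat)) as [N HN].
  exists N. intros n Hn. specialize (HN n Hn). pose proof (pow_le q n ltac:(lra)).
  rewrite Rabs_pos_eq in HN by auto.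
  apply Rle_lt_trans with ((Rabs K + 1) * q ^ n)%R.
  - apply Rmult_le_compat_r; auto. pose proof (Rle_abs K). lra.
  - replace eps with ((Rabs K + 1) * (eps / (Rabs K + 1)))%R by (field; lra). now apply Rmult_lt_compat_l.
Qed.

Lemma cauchy_rep_pseries f r B :
  (0 < r)%R -> cont_within (fun z => Cmod z = r) f -> (forall z, Cmod z = r -> (Cmod (f z) <= B)%R) ->
  cauchy_rep f r ->
  forall w, (Cmod w < r)%R -> csum (fun n => w ^ n * cmean (fun z => f z * / z ^ n) r) (f w).
Proof.
  intros Hr Hf HB HC w Hw eps He. pose proof (Cmod_ge_0 w) as H0.
  pose (a := fun n => w ^ n * cmean (fun z => f z * / z ^ n) r).
  pose (q := (Cmod w / r)%R).
  assert (Hq : (0 <= q < 1)%R).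
  { unfold q. split; [apply Rdiv_le_0_compat; lra |]. apply Rmult_lt_reg_r with r; auto. unfold Rdiv. rewrite Rmult_assoc, Rinv_l, Rmult_1_r; lra. }
  pose (K := (B * (r / (r - Cmod w)))%R).
  assert (Hc : forall N c, Cmod c = 1%R -> (Rabs (Re (c * (psum a N - f w))) <= K * q ^ N)%R).
  { intros N c Hc1.
    assert (E := HC w c Hw). rewrite (cauchy_rep_expand f r w c N Hw Hf) in E. fold a in E.
    set (I := circ _ r) in E.
    assert (HI : (Rabs I <= 2 * PI * (K * q ^ N))%R).
    { apply circ_bound; [lra | |].
      - repeat apply cont_within_mult; auto using cont_within_const, cont_within_id.
        + apply cont_within_holo, holo_inv_sub. intros z Hz'. apply neq_of_Cmod. lra.
        + apply cont_within_holo, holo_inv.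
          * intros z Hz. apply Cpow_nz. apply Cmod_gt_0. lra.
          * apply holo_pow.
      - intros z Hz. assert (z <> 0) by (apply Cmod_gt_0; lra).
        rewrite !Cmod_mult, !Cmod_inv, Hc1, Hz, Cmod_pow, Cmod_pow, Hz by (auto; try apply neq_of_Cmod; try apply Cpow_nz; auto; lra).
        unfold K, q. rewrite Rpow_div.
        replace (B * (r / (r - Cmod w)) * (Cmod w ^ N / r ^ N))%R with (1 * (Cmod w ^ N * (B * (r * / (r - Cmod w) * / r ^ N))))%R.
        2: { field. split; [apply pow_nonzero |]; lra. }
        apply Rmult_le_compat_l; [lra |]. apply Rmult_le_compat_l; [apply pow_le; lra |].
        assert (0 < / r ^ N)%R by (apply Rinv_0_lt_compat, pow_lt; lra).
        assert (Hinv : (/ Cmod (z - w) <= / (r - Cmod w))%R).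
        { apply Rinv_le_contravar; [lra |]. pose proof (Cmod_minus_ge z w). lra. }
        assert (0 < / Cmod (z - w))%R.
        { apply Rinv_0_lt_compat. pose proof (Cmod_minus_ge z w). lra. }
        apply Rmult_le_compat; auto using Cmod_ge_0.
        + apply Rmult_le_pos; [apply Rmult_le_pos |]; lra.
        + apply Rmult_le_compat_r; [lra |]. apply Rmult_le_compat_l; lra. }
    replace (c * (psum a N - f w)) with (c * psum a N - c * f w) by ring. rewrite re_minus.
    pose proof PI_RGT_0.
    replace (Re (c * psum a N) - Re (c * f w))%R with (- I * / (2 * PI))%R.
    2: { apply Rmult_eq_reg_l with (2 * PI)%R; [| lra]. field_simplify; lra. }
    rewrite Rabs_mult, Rabs_Ropp, (Rabs_pos_eq (/ (2 * PI))) by (left; apply Rinv_0_lt_compat; lra).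
    apply Rmult_le_reg_r with (2 * PI)%R; [lra |]. rewrite Rmult_assoc, Rinv_l by lra. lra. }
  destruct (pow_to_0 q K (eps / 2) Hq ltac:(lra)) as [N HN].
  exists N. intros n Hn. specialize (HN n Hn).
  eapply Rle_lt_trans; [apply Cmod_le_re_im |].
  (* The multipliers 1 and -i extract the real and the imaginary part of the error, each below
     eps/2. *)
  pose proof (Hc n 1 Cmod_1) as H1. rewrite Cmult_1_l in H1.
  pose proof (Hc n (- Ci) ltac:(now rewrite Cmod_opp, Cmod_Ci)) as H2. rewrite Re_Cmult_Ci in H2.
  fold a. lra.
Qed.

Lemma holo_translate (f : C -> C) (z0 : C) (R0 : R) :
  holo (fun z => Cmod (z - z0) < R0)%R f -> holo (fun z => Cmod z < R0)%R (fun z => f (z0 + z)).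
Proof.
  apply holo_comp.
  - intros z Hz. now replace (z0 + z - z0) with z by ring.
  - apply holo_plus; [apply holo_const | apply holo_id].
Qed.

Lemma analytic_at_translate f z0 r c :
  (0 < r)%R -> (forall w, (Cmod w < r)%R -> csum (fun n => w ^ n * c n) (f (z0 + w))) -> analytic_at f z0.
Proof.
  intros Hr H. exists c, r. split; auto. intros z _ Hz. apply csum_is_pseries.
  replace (f z) with (f (z0 + (z - z0))) by (f_equal; ring). now apply H.
Qed.

Lemma holo_analytic f z0 R0 :
  (0 < R0)%R -> holo (fun z => Cmod (z - z0) < R0)%R f -> analytic_at f z0.
Proof.
  intros HR Hf.
  assert (Hb : locally z0 (fun z => (Cmod (f z) < Cmod (f z0) + 1)%R)).
  { apply tends_bounded; [apply locally_filter |]. apply holo_cont with (1 := Hf).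
    replace (z0 - z0) with (RtoC 0) by ring. rewrite Cmod_0. auto. }
  apply locally_Cmod in Hb. destruct Hb as [d [Hd Hb]].
  apply holo_translate in Hf.
  pose (r := (Rmin R0 d / 2)%R).
  assert (Hr : (0 < r /\ r < R0 /\ r < d)%R).
  { unfold r. pose proof (Rmin_l R0 d). pose proof (Rmin_r R0 d). assert (0 < Rmin R0 d)%R by now apply Rmin_pos. lra. }
  apply (analytic_at_translate f z0 r (fun n => cmean (fun z => f (z0 + z) * / z ^ n) r)); [lra |].
  apply (cauchy_rep_pseries (fun z => f (z0 + z)) r (Cmod (f z0) + 1)); [lra | | |].
  - apply cont_within_holo, holo_sub with (2 := Hf). intros z Hz. lra.
  - intros z Hz. apply Rlt_le, Hb. replace (z0 + z - z0) with z by ring. lra.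
  - intros w c Hw. apply (cauchy_disc (fun z => f (z0 + z)) w r R0 c); auto. lra.
Qed.

Lemma holo_psum U (h : nat -> C -> C) N :
  (forall k, holo U (h k)) -> holo U (fun z => psum (fun k => h k z) N).
Proof. intros H. induction N; simpl; [apply holo_const | now apply holo_plus]. Qed.

Lemma uniform_limit_cont (D : C -> Prop) (h : nat -> C -> C) (f : C -> C) K q z :
  (0 <= q < 1)%R -> D z -> locally z D -> (forall k, tends (locally z) (h k) (h k z)) ->
  (forall k z, D z -> (Cmod (h k z) <= K * q ^ k)%R) ->
  (forall z, D z -> csum (fun k => h k z) (f z)) -> tends (locally z) f (f z).
Proof.
  intros Hq HDz HD Hh HK Hf eps He.
  destruct (pow_to_0 q (K / (1 - q)) (eps / 3) Hq ltac:(lra)) as [N HN]. specialize (HN N (le_n N)).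
  assert (HT : forall y, D y -> (Cmod (f y - psum (fun k => h k y) N) < eps / 3)%R).
  { intros y Hy. eapply Rle_lt_trans; [| exact HN]. apply csum_tail; auto. }
  assert (HP : tends (locally z) (fun y => psum (fun k => h k y) N) (psum (fun k => h k z) N)).
  { clear - Hh. induction N; simpl; [apply tends_const, locally_filter | now apply tends_plus; [apply locally_filter | |]]. }
  generalize (filter_and _ _ HD (HP (eps / 3)%R ltac:(lra))). apply filter_imp. intros y [Hy1 Hy2].
  specialize (HT y Hy1) as HT1. specialize (HT z HDz) as HT2.
  replace (f y - f z) with ((f y - psum (fun k => h k y) N) + ((psum (fun k => h k y) N - psum (fun k => h k z) N) + - (f z - psum (fun k => h k z) N))) by ring.
  eapply Rle_lt_trans; [apply Cmod_triangle |].
  pose proof (Cmod_triangle (psum (fun k => h k y) N - psum (fun k => h k z) N) (- (f z - psum (fun k => h k z) N))) as H.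
  rewrite Cmod_opp in H. lra.
Qed.

(* Weierstrass: Cauchy's formula passes to uniform limits. *)
Lemma weierstrass (h : nat -> C -> C) (f : C -> C) z0 R0 K q :
  (0 < R0)%R -> (0 <= q < 1)%R -> (forall k, holo (fun z => Cmod (z - z0) < R0)%R (h k)) ->
  (forall k z, (Cmod (z - z0) < R0)%R -> (Cmod (h k z) <= K * q ^ k)%R) ->
  (forall z, (Cmod (z - z0) < R0)%R -> csum (fun k => h k z) (f z)) -> analytic_at f z0.
Proof.
  intros HR Hq Hh HK Hf.
  pose (r := (R0 / 2)%R).
  pose (g := fun z => f (z0 + z)). pose (hh := fun k z => h k (z0 + z)).
  assert (Hhh : forall k, holo (fun z => Cmod z < R0)%R (hh k)) by (intros k; now apply holo_translate).
  assert (HKK : forall k z, (Cmod z < R0)%R -> (Cmod (hh k z) <= K * q ^ k)%R).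
  { intros k z Hz. apply HK. now replace (z0 + z - z0) with z by ring. }
  assert (Hg : forall z, (Cmod z < R0)%R -> csum (fun k => hh k z) (g z)).
  { intros z Hz. apply Hf. now replace (z0 + z - z0) with z by ring. }
  assert (Hgc : forall z, (Cmod z < R0)%R -> tends (locally z) g (g z)).
  { intros z Hz. apply uniform_limit_cont with (fun z => Cmod z < R0)%R hh K q; auto.
    - now apply locally_Cmod_lt.
    - intros k. apply holo_cont with (1 := Hhh k). auto. }
  assert (Hcirc : cont_within (fun z => Cmod z = r) g).
  { apply cont_within_of_cont. intros z Hz. apply Hgc. unfold r in Hz. lra. }
  apply (analytic_at_translate f z0 r (fun n => cmean (fun z => g z * / z ^ n) r)); [unfold r; lra |].
  apply (cauchy_rep_pseries g r (K / (1 - q))); [unfold r; lra | auto | |].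
  - intros z Hz. apply (csum_bound (fun k => hh k z)); auto.
    + intros k. apply HKK. unfold r in Hz. lra.
    + apply Hg. unfold r in Hz. lra.
  - intros w c Hw. apply Rminus_diag_uniq. pose proof PI_RGT_0.
    pose proof (Cmod_ge_0 w). pose proof (Cmod_ge_0 c).
    assert (Hzw : cont_within (fun z => Cmod z = r) (fun z => / (z - w))).
    { apply cont_within_holo, holo_inv_sub. intros z Hz'. apply neq_of_Cmod. lra. }
    assert (HP : forall N, cont_within (fun z => Cmod z = r) (fun z => psum (fun k => hh k z) N)).
    { intros N. apply cont_within_holo, holo_sub with (fun z => Cmod z < R0)%R; [intros z Hz; unfold r in Hz; lra |].
      now apply holo_psum. }
    pose (A := (2 * PI * (Cmod c * (r * / (r - Cmod w))) + 2 * PI * Cmod c)%R).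
    assert (Hmain : forall N, (Rabs (circ (fun z => c * (z * g z / (z - w)))%C r - 2 * PI * Re (c * g w)%C) <= A * (K / (1 - q)) * q ^ N)%R).
    { intros N. pose (T := (K / (1 - q) * q ^ N)%R).
      assert (HT : forall y, (Cmod y <= r)%R -> (Cmod (g y - psum (fun k => hh k y) N) <= T)%R).
      { intros y Hy. unfold T. apply csum_tail; auto.
        - intros k. apply HKK. unfold r in Hy. lra.
        - apply Hg. unfold r in Hy. lra. }
      replace (A * (K / (1 - q)) * q ^ N)%R with (2 * PI * (Cmod c * (r * (T * / (r - Cmod w)))) + 2 * PI * (Cmod c * T))%R by (unfold A, T; ring).
      rewrite (circ_ext _ (fun z => c * (z * psum (fun k => hh k z) N / (z - w)) + c * (z * ((g z - psum (fun k => hh k z) N) * / (z - w))))); [| lra |].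
      2: { intros z Hz. field. apply neq_of_Cmod. lra. }
      assert (C1 : cont_within (fun z => Cmod z = r) (fun z => c * (z * ((g z - psum (fun k => hh k z) N) * / (z - w))))).
      { repeat apply cont_within_mult; auto using cont_within_const, cont_within_id.
        apply cont_within_plus; auto. apply cont_within_ext with (fun z => -(1) * psum (fun k => hh k z) N); [intros; ring |].
        apply cont_within_mult; auto using cont_within_const. }
      rewrite circ_plus; [| lra | | auto].
      2: { apply cont_within_mult; [apply cont_within_const |].
           apply (cont_within_mult _ (fun z => z * psum (fun k => hh k z) N) (fun z => / (z - w))); auto.
           apply cont_within_mult; auto using cont_within_id. }
      rewrite (cauchy_disc (fun z => psum (fun k => hh k z) N) w r R0 c); [| lra | unfold r; lra | now apply holo_psum].
      match goal with |- (Rabs (?x + ?I - ?y) <= _)%R => replace (x + I - y)%R with (I + 2 * PI * Re (c * (psum (fun k => hh k w) N - g w))%C)%R end.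
      2: { replace (c * (psum (fun k => hh k w) N - g w)) with (c * psum (fun k => hh k w) N - c * g w) by ring. rewrite re_minus. ring. }
      eapply Rle_trans; [apply Rabs_triang |]. apply Rplus_le_compat.
      - apply circ_bound; [lra | auto |]. intros z Hz.
        rewrite !Cmod_mult, Cmod_inv, Hz by (apply neq_of_Cmod; lra).
        assert (Hd : (r - Cmod w <= Cmod (z - w))%R) by (pose proof (Cmod_minus_ge z w); lra).
        repeat apply Rmult_le_compat_l; auto; [lra |].
        apply Rmult_le_compat; auto using Cmod_ge_0.
        + left. apply Rinv_0_lt_compat. lra.
        + apply HT. lra.
        + apply Rinv_le_contravar; lra.
      - rewrite Rabs_mult, Rabs_pos_eq by lra. apply Rmult_le_compat_l; [lra |].
        eapply Rle_trans; [apply re_le_Cmod |]. rewrite Cmod_mult. apply Rmult_le_compat_l; auto.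
        rewrite <- Cmod_opp. replace (- (psum (fun k => hh k w) N - g w)) with (g w - psum (fun k => hh k w) N) by ring.
        apply HT. lra. }
    match type of Hmain with forall N, (Rabs ?x <= _)%R => set (X := x) in * end.
    destruct (Req_dec X 0) as [| Hne]; auto. exfalso. assert (Hp := Rabs_pos_lt _ Hne).
    destruct (pow_to_0 q (A * (K / (1 - q))) (Rabs X) Hq Hp) as [N HN].
    specialize (HN N (le_n N)). specialize (Hmain N). lra.
Qed.

(** * Power series are holomorphic *)

Definition dpow (z : C) (n : nat) : C := match n with O => 0 | S m => INR n * z ^ m end.

Lemma pow_diff1 (z w : C) (p : R) n :
  (Cmod z <= p)%R -> (Cmod w <= p)%R ->
  (p * Cmod (dpow z n) <= INR n * p ^ n)%R.
Proof.
  intros Hz Hw. pose proof (Cmod_ge_0 z). destruct n as [| n].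
  - unfold dpow. rewrite Cmod_0. simpl. lra.
  - unfold dpow. rewrite Cmod_mult, Cmod_R, Rabs_pos_eq, Cmod_pow by apply pos_INR.
    replace (p * (INR (S n) * Cmod z ^ n))%R with (INR (S n) * (p * Cmod z ^ n))%R by ring.
    apply Rmult_le_compat_l; [apply pos_INR |]. simpl. apply Rmult_le_compat_l; [lra |].
    apply pow_incr. lra.
Qed.

(** Second-order Taylor remainder of a monomial, multiplied by p^2 to avoid the exponent n - 2. The
    induction uses that the remainder for n+1 is w times the one for n, plus n z^(n-1) (w-z)^2. *)
Lemma pow_diff2 (z w : C) (p : R) n :
  (Cmod z <= p)%R -> (Cmod w <= p)%R ->
  (p ^ 2 * Cmod (w ^ n - z ^ n - dpow z n * (w - z)) <= (INR n) ^ 2 * p ^ n * Cmod (w - z) ^ 2)%R.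
Proof.
  intros Hz Hw. pose proof (Cmod_ge_0 z). pose proof (Cmod_ge_0 (w - z)) as Hd.
  induction n.
  - unfold dpow. simpl. replace (1 - 1 - 0 * (w - z)) with (RtoC 0) by ring. rewrite Cmod_0. lra.
  - replace (w ^ S n - z ^ S n - dpow z (S n) * (w - z)) with
      (w * (w ^ n - z ^ n - dpow z n * (w - z)) + dpow z n * (w - z) * (w - z)).
    2: { unfold dpow. destruct n; [simpl; ring |]. rewrite (S_INR (S n)), RtoC_plus. simpl. ring. }
    apply Rle_trans with (p * (p ^ 2 * Cmod (w ^ n - z ^ n - dpow z n * (w - z))) + p * (p * Cmod (dpow z n)) * Cmod (w - z) ^ 2)%R.
    + replace (p * (p ^ 2 * Cmod (w ^ n - z ^ n - dpow z n * (w - z))) + p * (p * Cmod (dpow z n)) * Cmod (w - z) ^ 2)%R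
        with (p ^ 2 * (p * Cmod (w ^ n - z ^ n - dpow z n * (w - z)) + Cmod (dpow z n) * Cmod (w - z) * Cmod (w - z)))%R by ring.
      apply Rmult_le_compat_l; [apply pow2_ge_0 |].
      eapply Rle_trans; [apply Cmod_triangle |]. rewrite !Cmod_mult.
      apply Rplus_le_compat_r, Rmult_le_compat_r; [apply Cmod_ge_0 | auto].
    + pose proof (pow_diff1 z w p n Hz Hw) as H1.
      apply Rle_trans with (p * (INR n ^ 2 * p ^ n * Cmod (w - z) ^ 2) + p * (INR n * p ^ n) * Cmod (w - z) ^ 2)%R.
      * apply Rplus_le_compat; [apply Rmult_le_compat_l; lra |].
        apply Rmult_le_compat_r; [apply pow2_ge_0 |]. apply Rmult_le_compat_l; lra.
      * replace (p * (INR n ^ 2 * p ^ n * Cmod (w - z) ^ 2) + p * (INR n * p ^ n) * Cmod (w - z) ^ 2)%R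
          with ((INR n ^ 2 + INR n) * (p * p ^ n * Cmod (w - z) ^ 2))%R by ring.
        replace (INR (S n) ^ 2 * p ^ S n * Cmod (w - z) ^ 2)%R with ((INR n ^ 2 + 2 * INR n + 1) * (p * p ^ n * Cmod (w - z) ^ 2))%R.
        2: { rewrite S_INR. simpl. ring. }
        apply Rmult_le_compat_r.
        -- apply Rmult_le_pos; [apply Rmult_le_pos; [lra | apply pow_le; lra] | apply pow2_ge_0].
        -- pose proof (pos_INR n). lra.
Qed.

Lemma INR_pow_bound (x : R) n : (0 <= x < 1)%R -> (INR n * x ^ n <= / (1 - x))%R.
Proof.
  intros Hx. apply Rmult_le_reg_r with (1 - x)%R; [lra |]. rewrite Rinv_l by lra.
  assert (H : (INR n * x ^ n * (1 - x) <= 1 - x ^ n)%R).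
  { induction n; [simpl; lra |]. rewrite S_INR. simpl.
    pose proof (pow_le x n ltac:(lra)). assert (x ^ n <= 1)%R.
    { clear - Hx. induction n; simpl; [lra |]. pose proof (pow_le x n ltac:(lra)). nra. }
    assert (x * (INR n * x ^ n * (1 - x)) <= x * (1 - x ^ n))%R by (apply Rmult_le_compat_l; lra).
    assert (0 <= (1 - x) * (1 - x * x ^ n))%R by (apply Rmult_le_pos; nra). nra. }
  pose proof (pow_le x n ltac:(lra)). lra.
Qed.

(** If q <= x^3 with x < 1, then n^2 q^n <= (n x^n)(n x^n) x^n, and each factor n x^n is at most
    1/(1-x). *)
Lemma INR2_pow_geom (q : R) : (0 <= q < 1)%R ->
  exists K p, (0 <= p < 1)%R /\ (0 <= K)%R /\ forall n, (INR n ^ 2 * q ^ n <= K * p ^ n)%R.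
Proof.
  intros Hq.
  (* With y = (1-q)/3, x = 1 - y satisfies x^3 >= 1 - 3y = q by Bernoulli's inequality. *)
  assert (Hex : exists x, (0 <= x < 1 /\ q <= x * x * x)%R).
  { exists ((2 + q) / 3)%R. split; [lra |]. pose (y := ((1 - q) / 3)%R).
    replace ((2 + q) / 3)%R with (1 - y)%R by (unfold y; lra). replace q with (1 - 3 * y)%R by (unfold y; lra).
    assert (0 <= y <= 1)%R by (unfold y; lra). assert (0 <= y * y * (3 - y))%R by (apply Rmult_le_pos; nra). nra. }
  destruct Hex as [x [Hx Hxq]].
  exists (/ (1 - x) * / (1 - x))%R, x. split; [auto |].
  assert (0 < / (1 - x))%R by (apply Rinv_0_lt_compat; lra).
  split; [nra |]. intros n.
  apply Rle_trans with (INR n ^ 2 * (x * x * x) ^ n)%R.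
  - apply Rmult_le_compat_l; [apply pow2_ge_0 |]. apply pow_incr. lra.
  - rewrite !Rpow_mult_distr.
    replace (INR n ^ 2 * (x ^ n * x ^ n * x ^ n))%R with ((INR n * x ^ n) * (INR n * x ^ n) * x ^ n)%R by ring.
    apply Rmult_le_compat_r; [apply pow_le; lra |].
    pose proof (INR_pow_bound x n Hx). pose proof (pos_INR n). pose proof (pow_le x n ltac:(lra)).
    apply Rmult_le_compat; auto; apply Rmult_le_pos; auto.
Qed.

Lemma pseries_coeff_bound c r s :
  (0 < s < r)%R -> (forall z, (Cmod z < r)%R -> exists l, csum (fun n => z ^ n * c n) l) ->
  exists B, (0 <= B)%R /\ forall n, (Cmod (c n) * s ^ n <= B)%R.
Proof.
  intros Hs H. destruct (H (RtoC s)) as [l Hl]; [rewrite Cmod_R, Rabs_pos_eq; lra |].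
  destruct (Hl 1%R ltac:(lra)) as [N HN].
  (* A term is the difference of two consecutive partial sums, both within 1 of the limit. *)
  assert (Hb : forall n, (N <= n)%nat -> (Cmod (c n) * s ^ n <= 2)%R).
  { intros n Hn. pose proof (HN n Hn) as H1. pose proof (HN (S n) ltac:(lia)) as H2. simpl in H2.
    replace (Cmod (c n) * s ^ n)%R with (Cmod (RtoC s ^ n * c n)).
    2: { rewrite Cmod_mult, Cmod_pow, Cmod_R, Rabs_pos_eq by lra. ring. }
    replace (RtoC s ^ n * c n) with ((psum (fun n => RtoC s ^ n * c n) n + RtoC s ^ n * c n - l) + - (psum (fun n => RtoC s ^ n * c n) n - l)) by ring.
    eapply Rle_trans; [apply Cmod_triangle |]. rewrite Cmod_opp. lra. }
  assert (Hfin : forall M, exists B, (0 <= B)%R /\ forall n, (n < M)%nat -> (Cmod (c n) * s ^ n <= B)%R).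
  { induction M.
    - exists 0%R. split; [lra | intros; lia].
    - destruct IHM as [B [HB0 HB]]. exists (Rmax B (Cmod (c M) * s ^ M)). split; [eapply Rle_trans; [exact HB0 | apply Rmax_l] |].
      intros n Hn. destruct (Nat.eq_dec n M) as [-> | E]; [apply Rmax_r |].
      eapply Rle_trans; [apply HB; lia | apply Rmax_l]. }
  destruct (Hfin N) as [B [HB0 HB]]. exists (B + 2)%R. split; [lra |]. intros n.
  destruct (Nat.lt_ge_cases n N) as [L | L]; [specialize (HB n L) | specialize (Hb n L)]; lra.
Qed.

Lemma pseries_derive c r f :
  (forall z, (Cmod z < r)%R -> csum (fun n => z ^ n * c n) (f z)) ->
  forall z, (Cmod z < r)%R -> exists l, is_cderive f z l /\ csum (fun n => z ^ n * (INR (S n) * c (S n))) l.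
Proof.
  intros Hf z Hz. pose proof (Cmod_ge_0 z) as H0.
  (* With |z| < p < s < r, points near z stay within p, coefficients are bounded at radius s, and
     the ratio p/s < 1 absorbs the factor n^2 of the Taylor remainder. *)
  pose (p := ((2 * Cmod z + r) / 3)%R). pose (s := ((Cmod z + 2 * r) / 3)%R).
  assert (Hp : (Cmod z < p /\ 0 < p /\ p < s /\ s < r)%R) by (unfold p, s; lra).
  destruct (pseries_coeff_bound c r s ltac:(lra)) as [B [HB0 HB]]; [eauto |].
  assert (Hq : (0 <= p / s < 1)%R).
  { split; [apply Rdiv_le_0_compat; lra |]. apply Rmult_lt_reg_r with s; [lra |]. unfold Rdiv. rewrite Rmult_assoc, Rinv_l; lra. }
  destruct (INR2_pow_geom (p / s) Hq) as [K [x [Hx [HK0 HK]]]].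
  assert (Hcp : forall n, (Cmod (c n) * (INR n ^ 2 * p ^ n) <= B * K * x ^ n)%R).
  { intros n. replace (Cmod (c n) * (INR n ^ 2 * p ^ n))%R with ((Cmod (c n) * s ^ n) * (INR n ^ 2 * (p / s) ^ n))%R.
    2: { rewrite Rpow_div. field. apply pow_nonzero. lra. }
    rewrite (Rmult_assoc B). apply Rmult_le_compat; auto.
    - apply Rmult_le_pos; [apply Cmod_ge_0 | apply pow_le; lra].
    - apply Rmult_le_pos; [apply pow2_ge_0 | apply pow_le; lra]. }
  assert (Hd : exists l, csum (fun n => dpow z n * c n) l).
  { apply csum_geom_ex with (B * K * / p)%R x; auto. intros n.
    rewrite Cmod_mult. apply Rmult_le_reg_l with p; [lra |].
    replace (p * (B * K * / p * x ^ n))%R with (B * K * x ^ n)%R by (field; lra).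
    eapply Rle_trans; [| apply Hcp].
    rewrite <- Rmult_assoc, Rmult_comm. apply Rmult_le_compat_l; [apply Cmod_ge_0 |].
    eapply Rle_trans; [apply (pow_diff1 z z p n); lra |].
    apply Rmult_le_compat_r; [apply pow_le; lra |].
    destruct n; [simpl; lra |]. assert (1 <= INR (S n))%R by (rewrite S_INR; pose proof (pos_INR n); lra). nra. }
  destruct Hd as [l Hl]. exists l. split.
  2: { apply csum_ext with (fun n => dpow z (S n) * c (S n)); [intros n; unfold dpow; ring |].
       apply (csum_shift (fun n => dpow z n * c n)). simpl. now replace (0 * c O + l) with l by ring. }
  pose (A := (B * K * / p ^ 2 / (1 - x))%R).
  assert (HA : (0 <= A)%R).
  { unfold A. apply Rdiv_le_0_compat; [| lra]. apply Rmult_le_pos; [now apply Rmult_le_pos |]. left. apply Rinv_0_lt_compat, pow_lt. lra. }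
  assert (Hest : forall w, (Cmod (w - z) < p - Cmod z)%R -> (Cmod (f w - f z - l * (w - z)) <= A * Cmod (w - z) ^ 2)%R).
  { intros w Hw. assert (Hwp : (Cmod w <= p)%R).
    { replace w with ((w - z) + z) by ring. eapply Rle_trans; [apply Cmod_triangle | lra]. }
    replace (A * Cmod (w - z) ^ 2)%R with (B * K * / p ^ 2 * Cmod (w - z) ^ 2 / (1 - x))%R by (unfold A, Rdiv; ring).
    apply csum_bound with (a := fun n => (w ^ n * c n - z ^ n * c n) - (w - z) * (dpow z n * c n)); auto.
    - intros n. replace (w ^ n * c n - z ^ n * c n - (w - z) * (dpow z n * c n)) with (c n * (w ^ n - z ^ n - dpow z n * (w - z))) by ring.
      rewrite Cmod_mult. apply Rmult_le_reg_l with (p ^ 2)%R; [apply pow_lt; lra |].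
      replace (p ^ 2 * (B * K * / p ^ 2 * Cmod (w - z) ^ 2 * x ^ n))%R with (B * K * x ^ n * Cmod (w - z) ^ 2)%R by (field; lra).
      apply Rle_trans with (Cmod (c n) * (INR n ^ 2 * p ^ n) * Cmod (w - z) ^ 2)%R.
      + pose proof (pow_diff2 z w p n ltac:(lra) Hwp) as H2.
        replace (p ^ 2 * (Cmod (c n) * Cmod (w ^ n - z ^ n - dpow z n * (w - z))))%R
          with (Cmod (c n) * (p ^ 2 * Cmod (w ^ n - z ^ n - dpow z n * (w - z))))%R by ring.
        rewrite Rmult_assoc. apply Rmult_le_compat_l; [apply Cmod_ge_0 | exact H2].
      + apply Rmult_le_compat_r; [apply pow2_ge_0 | apply Hcp].
    - replace (f w - f z - l * (w - z)) with ((f w - f z) - (w - z) * l) by ring.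
      apply csum_minus; [apply csum_minus; apply Hf; lra | now apply csum_scal]. }
  intros eps He. unfold locally', within. apply locally_Cmod.
  exists (Rmin (p - Cmod z) (eps / (A + 1))). split.
  { apply Rmin_pos; [lra | apply Rdiv_lt_0_compat; lra]. }
  intros w Hw Hne. pose proof (Rlt_le_trans _ _ _ Hw (Rmin_l _ _)) as Hw1.
  pose proof (Rlt_le_trans _ _ _ Hw (Rmin_r _ _)) as Hw2.
  assert (Hn0 : w - z <> 0) by now apply Cminus_eq_contra.
  assert (Hpos : (0 < Cmod (w - z))%R) by now apply Cmod_gt_0.
  replace ((f w - f z) / (w - z) - l) with ((f w - f z - l * (w - z)) / (w - z)) by (field; auto).
  rewrite Cmod_div by auto. apply Rle_lt_trans with (A * Cmod (w - z))%R.
  - apply Rmult_le_reg_r with (Cmod (w - z)); auto. unfold Rdiv. rewrite Rmult_assoc, Rinv_l, Rmult_1_r by lra.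
    replace (A * Cmod (w - z) * Cmod (w - z))%R with (A * Cmod (w - z) ^ 2)%R by ring. auto.
  - apply Rle_lt_trans with ((A + 1) * Cmod (w - z))%R; [apply Rmult_le_compat_r; lra |].
    replace eps with ((A + 1) * (eps / (A + 1)))%R by (field; lra). apply Rmult_lt_compat_l; lra.
Qed.

(** Continuity of the derivative follows by differentiating once more, now the derived series. *)
Lemma pseries_holo c r f :
  (forall z, (Cmod z < r)%R -> csum (fun n => z ^ n * c n) (f z)) ->
  exists f', (forall z, (Cmod z < r)%R -> is_cderive f z (f' z) /\ tends (locally z) f' (f' z)
    /\ csum (fun n => z ^ n * (INR (S n) * c (S n))) (f' z)).
Proof.
  intros Hf. exists (fun z => Csum (fun n => z ^ n * (INR (S n) * c (S n)))).
  assert (H1 := pseries_derive c r f Hf).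
  assert (H2 : forall z, (Cmod z < r)%R -> csum (fun n => z ^ n * (INR (S n) * c (S n))) (Csum (fun n => z ^ n * (INR (S n) * c (S n))))).
  { intros z Hz. apply Csum_correct. destruct (H1 z Hz) as [l [_ Hl]]. eauto. }
  intros z Hz. split; [| split; [| auto]].
  - destruct (H1 z Hz) as [l [Hl1 Hl2]]. now rewrite (Csum_eq _ _ Hl2).
  - destruct (pseries_derive _ r _ H2 z Hz) as [l [Hl _]]. now apply is_cderive_cont in Hl.
Qed.

Lemma analytic_holo (U : C -> Prop) f : (forall z, U z -> analytic_at f z) -> holo U f.
Proof.
  intros H.
  assert (Hloc : forall z0, U z0 -> exists f' r, (0 < r)%R /\ forall z, (Cmod (z - z0) < r)%R -> is_cderive f z (f' z) /\ tends (locally z) f' (f' z)).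
  { intros z0 Hz0. destruct (H z0 Hz0) as [c [r [Hr Hc]]].
    destruct (pseries_holo c r (fun w => f (z0 + w))) as [f' Hf'].
    { intros w Hw. apply csum_is_pseries. replace w with (z0 + w - z0) at 1 by ring. apply Hc; auto. now replace (z0 + w - z0) with w by ring. }
    assert (Hh : holo (fun z => Cmod (z - z0) < r)%R (fun z => f (z0 + (- z0 + z)))).
    { apply (holo_comp _ (fun z => Cmod z < r)%R (fun w => f (z0 + w)) (fun z => - z0 + z)).
      - intros z Hz. now replace (- z0 + z) with (z - z0) by ring.
      - apply holo_plus; [apply holo_const | apply holo_id].
      - exists f'. intros z Hz. split; now apply Hf'. }
    destruct Hh as [g Hg]. exists g, r. split; auto. intros z Hz. destruct (Hg z Hz) as [G1 G2]. split; auto.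
    apply is_cderive_ext_loc with (2 := G1). apply filter_forall. intros w. f_equal. ring. }
  (* Expansions exist only locally, so the global derivative is chosen pointwise; uniqueness of
     derivatives identifies it with each local one, which transfers continuity. *)
  exists (fun z => epsilon (inhabits (RtoC 0)) (is_cderive f z)).
  intros z0 Hz0. destruct (Hloc z0 Hz0) as [f' [r [Hr Hf']]].
  assert (E : forall z, (Cmod (z - z0) < r)%R -> f' z = epsilon (inhabits (RtoC 0)) (is_cderive f z)).
  { intros z Hz. destruct (Hf' z Hz) as [G _]. apply (is_cderive_unique f z); auto. apply epsilon_spec. eauto. }
  assert (Hz00 : (Cmod (z0 - z0) < r)%R) by (replace (z0 - z0) with (RtoC 0) by ring; now rewrite Cmod_0).
  rewrite <- E by auto. split; [now apply Hf' |].
  apply tends_ext_loc with f'; [apply locally_filter | | now apply Hf'].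
  apply locally_Cmod. exists r. auto.
Qed.

(** * Gluing along the unit circle *)

(** Morera and Liouville in one argument. For an exterior point w, the mean of z (f(z) - f(w))/(z-w)
    is independent of the radius: on the unit circle it is zero by continuing inwards with [fm], and
    on large circles it tends to L - f(w). *)
Lemma glue (fm fp : C -> C) (L : C) :
  holo (fun z => Cmod z < 1)%R fm -> cont_within (fun z => Cmod z <= 1)%R fm ->
  holo (fun z => 1 < Cmod z)%R fp -> cont_within (fun z => 1 <= Cmod z)%R fp ->
  (forall z, Cmod z = 1%R -> fp z = fm z) -> tends C_infty fp L ->
  forall w, (1 < Cmod w)%R -> fp w = L.
Proof.
  intros Hm Cm Hp Cp E HL w Hw. symmetry. pose proof PI_RGT_0 as Hpi.
  assert (Hd : exists l, is_cderive fp w l) by (destruct Hp as [f' Hf']; exists (f' w); now apply Hf').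
  assert (Hzero : forall l c, circ (fun z => c * (z * slope fp w l z)) 1 = 0%R).
  { intros l c.
    (* The pole w lies outside the closed disc, so [g] is holomorphic inside and vanishes at 0. *)
    pose (g := fun z => c * (z * ((fm z - fp w) * / (z - w)))).
    rewrite (circ_ext _ g); [| lra |].
    2: { intros z Hz. unfold g. rewrite slope_neq, E by (auto; intros ->; lra). unfold Cdiv. reflexivity. }
    rewrite <- (circ_eq g 0 1); [| lra | |].
    - rewrite circ_0. unfold g. replace (c * (0 * ((fm 0 - fp w) * / (0 - w)))) with (RtoC 0) by ring.
      rewrite re_RtoC. ring.
    - unfold g. repeat apply cont_within_mult; auto using cont_within_const, cont_within_id.
      + apply cont_within_plus; [| apply cont_within_const]. apply cont_within_sub with (2 := Cm). intros z Hz. lra.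
      + apply cont_within_holo, holo_inv_sub. intros z Hz'. apply neq_of_Cmod. lra.
    - unfold g. apply holo_mult; [apply holo_const |]. apply holo_mult; [apply holo_id |]. apply holo_mult.
      + apply holo_minus; [| apply holo_const]. apply holo_sub with (2 := Hm). intros z Hz. lra.
      + apply holo_inv_sub. intros z Hz'. apply neq_of_Cmod. lra. }
  assert (Hre : forall c, Re (c * (L - fp w)) = 0%R).
  { intros c. apply (Rabs_le_all_0 _ (fun _ => 0%R) 0); [| intros eps He; exists 1%R; lra].
    intros _ _. apply Rle_plus_epsilon. intros eps He. rewrite Rplus_0_l.
    assert (T : tends C_infty (fun z => c * (z * ((fp z - fp w) * / (z - w)))) (c * (L - fp w))).
    { apply tends_ext_loc with (fun z => c * ((fp z - fp w) * / (1 - w * / z))).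
      - apply filter_filter.
      - exists (Rmax (Cmod w) 0). intros z Hz. pose proof (Rle_lt_trans _ _ _ (Rmax_l _ _) Hz). pose proof (Rle_lt_trans _ _ _ (Rmax_r _ _) Hz).
        assert (z <> 0) by (apply Cmod_gt_0; lra). assert (z - w <> 0) by (apply neq_of_Cmod; lra).
        field. auto.
      - assert (FF : Filter C_infty) by apply filter_filter.
        apply tends_mult; [auto | now apply tends_const |].
        replace (L - fp w) with ((L - fp w) * / (1 - w * 0)) by (field; intros HH; apply C1_nz; rewrite <- HH; ring).
        apply tends_mult; auto.
        + apply tends_minus; auto. now apply tends_const.
        + apply tends_inv; [auto | |].
          { intros HH. apply C1_nz. rewrite <- HH. ring. }
          apply tends_minus; [auto | now apply tends_const |]. apply tends_mult; [auto | now apply tends_const |].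
          intros e Hee. exists (/ e)%R. intros z Hz. assert (0 < / e)%R by now apply Rinv_0_lt_compat.
          rewrite Cmod_minus_0, Cmod_inv by (apply Cmod_gt_0; lra).
          rewrite <- (Rinv_inv e). apply Rinv_lt_contravar; auto. apply Rmult_lt_0_compat; lra. }
    destruct (T eps He) as [M HM].
    pose (b := (Rmax M (Cmod w) + 1)%R).
    assert (Hb : (M < b /\ Cmod w < b)%R).
    { unfold b. pose proof (Rmax_l M (Cmod w)). pose proof (Rmax_r M (Cmod w)). lra. }
    destruct (circ_slope fp w 1 b) as [l [Hs Hl]]; try lra; auto.
    { apply cont_within_sub with (2 := Cp). intros z Hz. lra. }
    { apply holo_sub with (2 := Hp). intros z Hz. lra. }
    specialize (Hl c). rewrite Hzero in Hl.
    rewrite (circ_ext _ (fun z => (c * (z * slope fp w l z) - c * (L - fp w)) + c * (L - fp w))) in Hl; [| lra | intros; ring].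
    assert (Hcs : cont_within (fun z => Cmod z = b) (fun z => c * (z * slope fp w l z) - c * (L - fp w))).
    { apply cont_within_plus; [| apply cont_within_const]. apply cont_within_mult; [apply cont_within_const |].
      apply cont_within_mult; [apply cont_within_id |]. apply cont_within_sub with (2 := Hs). intros z Hz. lra. }
    rewrite circ_plus, circ_const in Hl; [| lra | auto | apply cont_within_const].
    assert (Hbd : (Rabs (circ (fun z => c * (z * slope fp w l z) - c * (L - fp w))%C b) <= 2 * PI * eps)%R).
    { apply circ_bound; [lra | auto |]. intros z Hz. rewrite slope_neq by (intros ->; lra). apply Rlt_le, HM. lra. }
    assert (HE : Rabs (circ (fun z => c * (z * slope fp w l z) - c * (L - fp w)) b) = (2 * PI * Rabs (Re (c * (L - fp w))%C))%R).
    { replace (circ (fun z => c * (z * slope fp w l z) - c * (L - fp w)) b) with (- (2 * PI * Re (c * (L - fp w))%C))%R by lra.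
      rewrite Rabs_Ropp, Rabs_mult, Rabs_pos_eq; lra. }
    rewrite HE in Hbd. apply Rmult_le_reg_l in Hbd; lra. }
  apply Ceq_minus. pose proof (Hre 1) as H1. pose proof (Hre (- Ci)) as H2. rewrite Cmult_1_l in H1.
  rewrite Re_Cmult_Ci in H2. destruct (L - fp w) as [x y]. simpl in H1, H2. now rewrite H1, H2.
Qed.

(** * Formal power series *)

Definition fps : Type := nat -> C.

(** Cauchy product by recursion on the shift of the first factor: the ring laws and the majorants
    then follow by induction with [a] generalised. *)
Fixpoint conv (a b : fps) (n : nat) : C :=
  match n with
  | O => a O * b O
  | S m => a O * b (S m) + conv (fun k => a (S k)) b m
  end.

Lemma conv_S a b n : conv a b (S n) = a O * b (S n) + conv (fun k => a (S k)) b n.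
Proof. reflexivity. Qed.

Definition fadd (a b : fps) : fps := fun n => a n + b n.
Definition fopp (a : fps) : fps := fun n => - a n.
Definition fsub (a b : fps) : fps := fun n => a n - b n.
Definition cst (c : C) : fps := fun n => match n with O => c | S _ => 0 end.
Definition fmul : fps -> fps -> fps := conv.
(* [theta] is x d/dx and [fD] is d/dx. *)
Definition theta (a : fps) : fps := fun n => INR n * a n.
Definition fD (a : fps) : fps := fun n => INR (S n) * a (S n).

Lemma conv_ext (a a' b b' : fps) n :
  (forall k, (k <= n)%nat -> a k = a' k) -> (forall k, (k <= n)%nat -> b k = b' k) -> conv a b n = conv a' b' n.
Proof.
  revert a a'. induction n; intros a a' Ha Hb; simpl.
  - rewrite Ha, Hb; auto.
  - rewrite (Ha O), (Hb (S n)) by lia. f_equal. apply IHn; intros k Hk; [apply Ha | apply Hb]; lia.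
Qed.

Lemma conv_add_l a a' b n : conv (fun k => a k + a' k) b n = conv a b n + conv a' b n.
Proof.
  revert a a'. induction n; intros a a'; simpl; [ring |].
  rewrite (IHn (fun k => a (S k)) (fun k => a' (S k))). ring.
Qed.

Lemma conv_scal_l c a b n : conv (fun k => c * a k) b n = c * conv a b n.
Proof.
  revert a. induction n; intros a; simpl; [ring |].
  rewrite (IHn (fun k => a (S k))). ring.
Qed.

Lemma conv_0_l b n : conv (fun _ => 0) b n = 0.
Proof. induction n; simpl; [ring | rewrite IHn; ring]. Qed.

Lemma conv_shift_r a b n : conv a b (S n) = conv a (fun k => b (S k)) n + a (S n) * b O.
Proof.
  revert a. induction n; intros a; [simpl; ring |].
  change (conv a b (S (S n))) with (a O * b (S (S n)) + conv (fun k => a (S k)) b (S n)).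
  rewrite (IHn (fun k => a (S k))). simpl. ring.
Qed.

Lemma conv_comm a b n : conv a b n = conv b a n.
Proof.
  revert a b. induction n; intros a b; [simpl; ring |].
  rewrite conv_shift_r. simpl. rewrite IHn. ring.
Qed.

Lemma conv_assoc a b c n : conv a (conv b c) n = conv (conv a b) c n.
Proof.
  revert a. induction n; intros a; [simpl; ring |]. simpl. rewrite IHn.
  rewrite conv_add_l, (conv_scal_l (a O) (fun k => b (S k))). ring.
Qed.

Lemma cst_mul c a n : fmul (cst c) a n = c * a n.
Proof. unfold fmul. destruct n; simpl; [auto | rewrite conv_0_l; ring]. Qed.

Lemma fps_ring_theory : ring_theory (cst 0) (cst 1) fadd fmul fsub fopp eq.
Proof.
  split; intros; apply functional_extensionality; intros n.
  - unfold fadd. destruct n; simpl; ring.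
  - unfold fadd. ring.
  - unfold fadd. ring.
  - rewrite cst_mul. ring.
  - apply conv_comm.
  - apply conv_assoc.
  - apply conv_add_l.
  - reflexivity.
  - unfold fadd, fopp. destruct n; simpl; ring.
Qed.

Add Ring fps_ring : fps_ring_theory.

Declare Scope fps_scope.
Delimit Scope fps_scope with fps.
Bind Scope fps_scope with fps.
Infix "+" := fadd : fps_scope.
Infix "-" := fsub : fps_scope.
Infix "*" := fmul : fps_scope.
Notation "- a" := (fopp a) : fps_scope.

Lemma theta_add a b : theta (a + b)%fps = (theta a + theta b)%fps.
Proof. apply functional_extensionality. intros n. unfold theta, fadd. ring. Qed.

Lemma theta_mul a b : theta (a * b)%fps = (theta a * b + a * theta b)%fps.
Proof.
  apply functional_extensionality. intros n. unfold theta, fadd, fmul.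
  revert a. induction n; intros a; [simpl; ring |].
  rewrite !conv_S. specialize (IHn (fun k => a (S k))).
  rewrite (conv_ext (fun k => INR (S k) * a (S k)) (fun k => INR k * a (S k) + a (S k)) b b); auto.
  2: { intros k _. rewrite S_INR, RtoC_plus. ring. }
  rewrite (conv_add_l (fun k => INR k * a (S k)) (fun k => a (S k))).
  assert (HS : RtoC (INR (S n)) = INR n + 1) by now rewrite S_INR, RtoC_plus.
  rewrite HS.
  replace ((INR n + 1) * (a O * b (S n) + conv (fun k => a (S k)) b n)) with
    (INR n * conv (fun k => a (S k)) b n + ((INR n + 1) * (a O * b (S n)) + conv (fun k => a (S k)) b n)) by ring.
  rewrite IHn. change (RtoC (INR 0)) with (RtoC 0). ring.
Qed.

Lemma theta_cst c : theta (cst c) = cst 0.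
Proof. apply functional_extensionality. intros [| n]; unfold theta; simpl; ring. Qed.

Lemma fD_shift a : fD a = fun n => theta a (S n).
Proof. reflexivity. Qed.

Lemma fD_add a b : fD (a + b)%fps = (fD a + fD b)%fps.
Proof. apply functional_extensionality. intros n. unfold fD, fadd. ring. Qed.

Lemma fD_sub a b : fD (a - b)%fps = (fD a - fD b)%fps.
Proof. apply functional_extensionality. intros n. unfold fD, fsub. ring. Qed.

Lemma fD_mul a b : fD (a * b)%fps = (fD a * b + a * fD b)%fps.
Proof.
  apply functional_extensionality. intros n. rewrite fD_shift, theta_mul. unfold fadd.
  f_equal.
  - unfold fmul. simpl. unfold theta at 1. simpl. rewrite fD_shift. ring.
  - unfold fmul. rewrite conv_shift_r, fD_shift. unfold theta at 2. simpl. ring.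
Qed.

Lemma fD_cst c : fD (cst c) = cst 0.
Proof. apply functional_extensionality. intros [| n]; unfold fD; simpl; ring. Qed.

Lemma theta_fD a : (theta (fD a) + fD a)%fps = fD (theta a).
Proof.
  apply functional_extensionality. intros n. unfold fadd, theta, fD.
  rewrite S_INR, RtoC_plus. ring.
Qed.

Lemma INR_S_neq_0 n : RtoC (INR (S n)) <> 0.
Proof. intros H. apply RtoC_inj in H. rewrite S_INR in H. pose proof (pos_INR n). lra. Qed.

(** The operator multiplies the n-th coefficient by n + m + 1, which is never zero. Every identity
    between solutions of the combined equation is reduced to this. *)
Lemma theta_plus_inj m a : (theta a + cst (INR (S m)) * a)%fps = cst 0 -> a = cst 0.
Proof.
  intros H. apply functional_extensionality. intros n.
  assert (E := f_equal (fun s : fps => s n) H). cbv beta in E. unfold fadd in E. rewrite cst_mul in E. unfold theta in E.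
  assert (Hn : INR n * a n + INR (S m) * a n = RtoC (INR (S (n + m))) * a n).
  { rewrite !S_INR, plus_INR, !RtoC_plus. ring. }
  replace (cst 0 n) with (RtoC 0) in * by (destruct n; reflexivity).
  rewrite Hn in E. destruct (Ceq_dec (a n) 0) as [| Hne]; auto.
  exfalso. apply (Cmult_neq_0 _ _ (INR_S_neq_0 (n + m)) Hne). exact E.
Qed.

(** * The isomonodromic system *)

(* Zero-curvature system of the Lax pair
   [W_X = (-i L sigma3 + Q) W], [L W_L = (-i X L sigma3 + X Q + (2i/L) N) W]
   with [Q = [[0,psi],[phi,0]]], [N = [[nn,al],[be,-nn]]]. *)
Record lax (psi phi nn al be : fps) : Prop := {
  lax_psi : (theta psi + psi)%fps = (cst 4 * al)%fps;
  lax_phi : (theta phi + phi)%fps = (- (cst 4 * be))%fps;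
  lax_nn : fD nn = (psi * be - al * phi)%fps;
  lax_al : fD al = (- (cst 2 * (nn * psi)))%fps;
  lax_be : fD be = (cst 2 * (nn * phi))%fps }.

(* The symmetry exchanging the two columns of P, together with [L -> -L]. *)
Lemma lax_swap psi phi nn al be : lax psi phi nn al be -> lax phi psi nn (- be)%fps (- al)%fps.
Proof.
  intros [H1 H2 H3 H4 H5]. split.
  - rewrite H2. ring.
  - rewrite H1. ring.
  - rewrite H3. ring.
  - replace (fD (- be)%fps) with (- fD be)%fps; [rewrite H5; ring |].
    apply functional_extensionality. intros n. unfold fopp, fD. ring.
  - replace (fD (- al)%fps) with (- fD al)%fps; [rewrite H4; ring |].
    apply functional_extensionality. intros n. unfold fopp, fD. ring.
Qed.

(* Solves [theta y + (m+1) y = c a]. *)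
Definition theta_div (m : nat) (c : C) (a : fps) : fps := fun k => c / INR (S (k + m)) * a k.

(* Coefficients of the powers of [1/L] in the first column of the exterior factor. *)
Fixpoint fg (nn al be : fps) (m : nat) : fps * fps :=
  match m with
  | O => (cst 1, cst 0)
  | S m => let f := fst (fg nn al be m) in let g := snd (fg nn al be m) in
     (theta_div m (- (2 * Ci)) ((nn - cst 1) * f + al * g)%fps,
      theta_div m (- (2 * Ci)) (be * f - (nn + cst 1) * g)%fps)
  end.

Lemma theta_plus_div m (a : fps) c :
  (theta (theta_div m c a) + cst (INR (S m)) * theta_div m c a)%fps = (cst c * a)%fps.
Proof.
  apply functional_extensionality. intros k. unfold fadd. rewrite !cst_mul. unfold theta, theta_div.
  rewrite !S_INR, plus_INR, !RtoC_plus. field.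
  rewrite <- !RtoC_plus. rewrite <- plus_INR, <- S_INR. apply INR_S_neq_0.
Qed.

Lemma fD_scal c a : fD (cst c * a)%fps = (cst c * fD a)%fps.
Proof. rewrite fD_mul, fD_cst. ring. Qed.

Lemma cst_Ci_sq : (cst Ci * cst Ci)%fps = (- cst 1)%fps.
Proof.
  apply functional_extensionality. intros n. rewrite cst_mul. unfold fopp.
  destruct n; simpl; [| ring]. unfold Ci. apply injective_projections; simpl; ring.
Qed.

Lemma cst_2 : cst 2 = (cst 1 + cst 1)%fps.
Proof.
  apply functional_extensionality. intros [| n]; unfold fadd; simpl; [| ring].
  rewrite <- RtoC_plus. apply f_equal. lra.
Qed.

Lemma cst_4 : cst 4 = (cst 2 * cst 2)%fps.
Proof.
  apply functional_extensionality. intros n. rewrite cst_mul. destruct n; simpl; [| ring].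
  rewrite <- RtoC_mult. apply f_equal. lra.
Qed.

Lemma cst_m2i : cst (- (2 * Ci)) = (- (cst 2 * cst Ci))%fps.
Proof. apply functional_extensionality. intros n. unfold fopp. rewrite cst_mul. destruct n; simpl; ring. Qed.

Lemma fsub_eq_0 a b : (a - b)%fps = cst 0 -> a = b.
Proof. intros H. replace a with ((a - b) + b)%fps by ring. rewrite H. ring. Qed.

Section Xode.
Variables psi phi nn al be : fps.
Hypothesis HL : lax psi phi nn al be.
Let F m := fst (fg nn al be m).
Let G m := snd (fg nn al be m).

Lemma fg_theta_fst m : (theta (F (S m)) + cst (INR (S m)) * F (S m) = - (cst 2 * cst Ci) * ((nn - cst 1) * F m + al * G m))%fps.
Proof. unfold F, G. simpl fst. rewrite theta_plus_div, cst_m2i. reflexivity. Qed.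

Lemma fg_theta_snd m : (theta (G (S m)) + cst (INR (S m)) * G (S m) = - (cst 2 * cst Ci) * (be * F m - (nn + cst 1) * G m))%fps.
Proof. unfold F, G. simpl snd. rewrite theta_plus_div, cst_m2i. reflexivity. Qed.

Lemma cst_INR_S m : cst (INR (S m)) = (cst (INR m) + cst 1)%fps.
Proof.
  apply functional_extensionality. intros [| n]; unfold fadd.
  - change (RtoC (INR (S m)) = INR m + 1). now rewrite S_INR, RtoC_plus.
  - change (RtoC 0 = 0 + 0). ring.
Qed.

Lemma theta_sub a b : theta (a - b)%fps = (theta a - theta b)%fps.
Proof. apply functional_extensionality. intros n. unfold theta, fsub. ring. Qed.

Lemma theta_scal c a : theta (cst c * a)%fps = (cst c * theta a)%fps.
Proof. rewrite theta_mul, theta_cst. ring. Qed.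

(** Both sides solve theta y + y = -4 [be], which has only one formal solution. This ties the
    potential to the 1/L coefficient of the exterior factor, the quantity that [Psi] measures. *)
Lemma fg_snd_1 : phi = (- (cst 2 * (cst Ci * G 1)))%fps.
Proof.
  destruct HL as [_ H2 _ _ _].
  apply fsub_eq_0, (theta_plus_inj 0). change (INR 1) with 1%R.
  assert (E := fg_theta_snd 0). change (INR 1) with 1%R in E.
  replace (theta (phi - - (cst 2 * (cst Ci * G 1))) + cst 1 * (phi - - (cst 2 * (cst Ci * G 1))))%fps
    with ((theta phi + phi) + cst 2 * (cst Ci * (theta (G 1) + cst 1 * G 1)))%fps.
  - rewrite H2, E. unfold F, G. simpl fst. simpl snd. rewrite cst_4. ring [cst_Ci_sq].
  - rewrite theta_sub. replace (- (cst 2 * (cst Ci * G 1)))%fps with (cst (-(1)) * (cst 2 * (cst Ci * G 1)))%fps.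
    + rewrite !theta_scal. replace (cst (-(1)))%fps with (- cst 1)%fps; [ring |].
      apply functional_extensionality. intros [| n]; unfold fopp; simpl; ring.
    + replace (cst (-(1)))%fps with (- cst 1)%fps; [ring |].
      apply functional_extensionality. intros [| n]; unfold fopp; simpl; ring.
Qed.

(* The defect [Z_m] of the X-equation satisfies the homogeneous recursion
   [(theta + m + 1) Z_m = -2i (N - 1) Z_(m-1)], hence vanishes. *)
Lemma fg_Xode m :
  fD (F m) = (psi * G m)%fps /\ fD (G m) = (phi * F m + cst 2 * (cst Ci * G (S m)))%fps.
Proof.
  induction m as [| m [IHf IHg]].
  - split.
    + unfold F, G. simpl. rewrite fD_cst. ring.
    + unfold F at 1. unfold G at 1. simpl fst. simpl snd. rewrite fD_cst. rewrite fg_snd_1 at 1. ring.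
  - destruct HL as [H1 H2 H3 H4 H5].
    assert (EF := fg_theta_fst m). assert (EG := fg_theta_snd m).
    assert (EF' := f_equal fD EF). assert (EG' := f_equal fD EG).
    rewrite !fD_add, <- theta_fD in EF', EG'.
    replace (- (cst 2 * cst Ci))%fps with (cst (- (2 * Ci))) in EF', EG' by apply cst_m2i.
    rewrite !fD_scal, fD_add, !fD_mul, fD_sub, fD_cst in EF'.
    rewrite !fD_scal, fD_sub, !fD_mul, fD_add, fD_cst in EG'.
    rewrite IHf, IHg, H3, H4 in EF'. rewrite IHf, IHg, H3, H5 in EG'.
    rewrite cst_m2i in EF', EG'.
    assert (Zf : fD (F (S m)) = (psi * G (S m))%fps).
    { apply fsub_eq_0, (theta_plus_inj (S m)).
      rewrite theta_sub, theta_mul, (cst_INR_S (S m)).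
      transitivity ((theta (fD (F (S m))) + fD (F (S m)) + cst (INR (S m)) * fD (F (S m)))
        - ((theta psi + psi) * G (S m) + psi * (theta (G (S m)) + cst (INR (S m)) * G (S m))))%fps; [ring |].
      rewrite EF', EG, H1, cst_4, cst_2. ring [cst_Ci_sq]. }
    split; [exact Zf |].
    apply fsub_eq_0, (theta_plus_inj (S m)).
    assert (EG2 := fg_theta_snd (S m)).
    rewrite theta_sub, theta_add, theta_mul, !theta_scal.
    transitivity ((theta (fD (G (S m))) + fD (G (S m)) + cst (INR (S m)) * fD (G (S m)))
        - ((theta phi + phi) * F (S m) + phi * (theta (F (S m)) + cst (INR (S m)) * F (S m)))
        - cst 2 * (cst Ci * (theta (G (S (S m))) + cst (INR (S (S m))) * G (S (S m)))))%fps.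
    { rewrite (cst_INR_S (S m)). ring. }
    rewrite EG', EG2, EF, H2, cst_4, cst_2. ring [cst_Ci_sq].
Qed.

End Xode.

(** * Recursion on the whole history *)

Section History.
Context {A : Type} (step : (nat -> A) -> nat -> A) (a0 : A).

(** Course-of-values recursion: convolutions call on all earlier coefficients. [hist n] tabulates
    them up to n, and later entries are junk that an admissible [step] does not read. *)
Fixpoint hist (n : nat) : nat -> A :=
  match n with
  | O => fun _ => a0
  | S m => fun j => if (j <=? m)%nat then hist m j else step (hist m) m
  end.

Definition hrec (n : nat) : A := hist n n.

Lemma hist_stable n j : (j <= n)%nat -> hist n j = hrec j.
Proof.
  induction n; intros Hj.
  - now replace j with O by lia.
  - destruct (Nat.eq_dec j (S n)) as [-> | E]; [reflexivity |].
    simpl. replace (j <=? n)%nat with true by (symmetry; apply Nat.leb_le; lia). apply IHn. lia.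
Qed.

Lemma hrec_S :
  (forall s s' k, (forall j, (j <= k)%nat -> s j = s' j) -> step s k = step s' k) ->
  forall n, hrec (S n) = step hrec n.
Proof.
  intros Hs n. change (hrec (S n)) with (if (S n <=? n)%nat then hist n (S n) else step (hist n) n).
  replace (S n <=? n)%nat with false by (symmetry; apply Nat.leb_gt; lia).
  apply Hs. intros j Hj. now apply hist_stable.
Qed.
End History.

(** * The Lax equation in X as a recursion *)

(** Coefficients of F' = psi G, G' = phi F + lam G: the X-equation for the first column of P, where
    removing the factor exp(-iLX) turns the diagonal into 0 and lam = 2iL. *)
Definition sol_step (psi phi : fps) (lam : C) (s : nat -> C * C) (k : nat) : C * C :=
  (/ INR (S k) * conv psi (fun j => snd (s j)) k,
   / INR (S k) * (conv phi (fun j => fst (s j)) k + lam * snd (s k))).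

Definition sol (psi phi : fps) (lam : C) (y : C * C) : nat -> C * C := hrec (sol_step psi phi lam) y.

Definition is_sol (psi phi : fps) (lam : C) (F G : fps) : Prop :=
  fD F = (psi * G)%fps /\ fD G = (phi * F + cst lam * G)%fps.

Lemma sol_S psi phi lam y n : sol psi phi lam y (S n) = sol_step psi phi lam (sol psi phi lam y) n.
Proof.
  unfold sol. apply hrec_S. intros s s' k H. unfold sol_step.
  rewrite (H k) by lia. f_equal; f_equal; [| f_equal]; apply conv_ext; auto; intros j Hj; now rewrite H.
Qed.

Lemma sol_is_sol psi phi lam y :
  is_sol psi phi lam (fun k => fst (sol psi phi lam y k)) (fun k => snd (sol psi phi lam y k)).
Proof.
  split; apply functional_extensionality; intros n; unfold fD; rewrite sol_S; simpl fst; simpl snd; rewrite ?Cmult_assoc, ?Cinv_r, Cmult_1_l by apply INR_S_neq_0.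
  - reflexivity.
  - unfold fadd. rewrite cst_mul. reflexivity.
Qed.

Lemma is_sol_unique psi phi lam F G F' G' :
  is_sol psi phi lam F G -> is_sol psi phi lam F' G' -> F O = F' O -> G O = G' O -> forall n, F n = F' n /\ G n = G' n.
Proof.
  intros [H1 H2] [H1' H2'] E1 E2 n.
  assert (K : forall j, (j <= n)%nat -> F j = F' j /\ G j = G' j); [| now apply K].
  induction n; intros j Hj.
  - replace j with O by lia. auto.
  - destruct (Nat.eq_dec j (S n)) as [-> | E]; [| apply IHn; lia].
    assert (H1n := f_equal (fun s : fps => s n) H1). assert (H1n' := f_equal (fun s : fps => s n) H1').
    assert (H2n := f_equal (fun s : fps => s n) H2). assert (H2n' := f_equal (fun s : fps => s n) H2').
    unfold fD in *. unfold fadd in *. rewrite cst_mul in *. simpl in H1n, H1n'.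
    split; apply (f_equal (Cmult (/ INR (S n)))) in H1n, H1n', H2n, H2n';
    rewrite Cmult_assoc, Cinv_l, Cmult_1_l in * by apply INR_S_neq_0.
    + rewrite H1n, H1n'. f_equal. apply conv_ext; auto. intros k Hk. now apply IHn.
    + rewrite H2n, H2n'. f_equal. f_equal; [| f_equal; now apply IHn].
      apply conv_ext; auto. intros k Hk. now apply IHn.
Qed.

Lemma sol_unique psi phi lam F G :
  is_sol psi phi lam F G -> forall n, sol psi phi lam (F O, G O) n = (F n, G n).
Proof.
  intros H n. destruct (is_sol_unique psi phi lam _ _ F G (sol_is_sol psi phi lam (F O, G O)) H eq_refl eq_refl n) as [E1 E2].
  destruct (sol psi phi lam (F O, G O) n). simpl in *. now rewrite E1, E2.
Qed.

Lemma is_sol_lin psi phi lam F G F' G' a b :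
  is_sol psi phi lam F G -> is_sol psi phi lam F' G' ->
  is_sol psi phi lam (cst a * F + cst b * F')%fps (cst a * G + cst b * G')%fps.
Proof.
  intros [H1 H2] [H1' H2']. split; rewrite fD_add, !fD_scal; [rewrite H1, H1' | rewrite H2, H2']; ring.
Qed.

(* Conjugating by [exp (- lam X)] exchanges the two components. *)
Lemma is_sol_swap psi phi lam F G e :
  is_sol psi phi lam F G -> fD e = (- (cst lam * e))%fps ->
  is_sol phi psi (- lam) (e * G)%fps (e * F)%fps.
Proof.
  intros [H1 H2] He. split.
  - rewrite fD_mul, He, H2. ring.
  - rewrite fD_mul, He, H1. replace (cst (- lam)) with (- cst lam)%fps; [ring |].
    apply functional_extensionality. intros [| n]; unfold fopp; simpl; ring.
Qed.

(** * Majorants *)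

Lemma Cmod_inv_INR_S k : Cmod (/ INR (S k)) = (/ INR (S k))%R.
Proof.
  rewrite Cmod_inv by apply INR_S_neq_0. rewrite Cmod_R, Rabs_pos_eq; auto using pos_INR.
Qed.

Lemma INR_S_pos k : (0 < INR (S k))%R.
Proof. apply lt_0_INR. lia. Qed.

Lemma conv_bound_same a b A B M k :
  (0 <= M)%R -> (forall j, (j <= k)%nat -> (Cmod (a j) <= A * M ^ j)%R) ->
  (forall j, (j <= k)%nat -> (Cmod (b j) <= B * M ^ j)%R) ->
  (Cmod (conv a b k) <= INR (S k) * (A * B * M ^ k))%R.
Proof.
  intros HM. revert a A. induction k; intros a A Ha Hb.
  - simpl. rewrite Cmod_mult. specialize (Ha O (le_n _)). specialize (Hb O (le_n _)). simpl in Ha, Hb.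
    pose proof (Cmod_ge_0 (a O)). pose proof (Cmod_ge_0 (b O)).
    rewrite !Rmult_1_r in *. rewrite Rmult_1_l. now apply Rmult_le_compat.
  - rewrite conv_S. eapply Rle_trans; [apply Cmod_triangle |].
    rewrite S_INR, Rmult_plus_distr_r, Rmult_1_l, Rplus_comm. apply Rplus_le_compat.
    + replace (INR (S k) * (A * B * M ^ S k))%R with (INR (S k) * ((A * M) * B * M ^ k))%R by (simpl; ring).
      apply IHk; auto. intros j Hj. specialize (Ha (S j) ltac:(lia)). simpl in Ha. lra.
    + rewrite Cmod_mult. replace (A * B * M ^ S k)%R with (A * (B * M ^ S k))%R by ring.
      specialize (Ha O ltac:(lia)). simpl in Ha. apply Rmult_le_compat; auto using Cmod_ge_0. lra.
Qed.

(** With unequal ratios, p >= 2M, the sum of (M/p)^j is at most 2, and no factor k+1 appears. *)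
Lemma conv_bound_geom a b A B M p k :
  (0 <= M)%R -> (2 * M <= p)%R -> (forall j, (Cmod (a j) <= A * M ^ j)%R) ->
  (forall j, (j <= k)%nat -> (Cmod (b j) <= B * p ^ j)%R) ->
  (Cmod (conv a b k) <= 2 * A * B * p ^ k)%R.
Proof.
  intros HM Hp. revert a A. induction k; intros a A Ha Hb.
  - simpl. rewrite Cmod_mult. specialize (Ha O). specialize (Hb O (le_n _)). simpl in Ha, Hb.
    pose proof (Cmod_ge_0 (a O)). pose proof (Cmod_ge_0 (b O)).
    rewrite !Rmult_1_r in *. apply Rle_trans with (A * B)%R; [now apply Rmult_le_compat |].
    assert (0 <= A * B)%R by (apply Rmult_le_pos; lra). lra.
  - rewrite conv_S. eapply Rle_trans; [apply Cmod_triangle |].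
    assert (HA : (0 <= A)%R) by (pose proof (Ha O) as H; pose proof (Cmod_ge_0 (a O)); simpl in H; lra).
    assert (HB : (0 <= B)%R) by (pose proof (Hb O ltac:(lia)) as H; pose proof (Cmod_ge_0 (b O)); simpl in H; lra).
    assert (Hpk : (0 <= p ^ k)%R) by (apply pow_le; lra).
    assert (H1 : (Cmod (conv (fun j => a (S j)) b k) <= 2 * (A * M) * B * p ^ k)%R).
    { apply IHk; auto. intros j. specialize (Ha (S j)). simpl in Ha. lra. }
    assert (H2 : (Cmod (a O * b (S k)) <= A * (B * p ^ S k))%R).
    { rewrite Cmod_mult. specialize (Ha O). simpl in Ha. apply Rmult_le_compat; auto using Cmod_ge_0. lra. }
    assert (H3 : (2 * (A * M) * B * p ^ k <= A * B * p ^ S k)%R).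
    { simpl. replace (2 * (A * M) * B * p ^ k)%R with (A * B * (2 * M * p ^ k))%R by ring.
      apply Rmult_le_compat_l; [now apply Rmult_le_pos |]. now apply Rmult_le_compat_r. }
    lra.
Qed.

Definition fbound (a : fps) (N M : R) : Prop := forall k, (Cmod (a k) <= N * M ^ k)%R.

Lemma Cmod_div_INR_le z k : (Cmod (/ INR (S k) * z) <= Cmod z)%R.
Proof.
  rewrite Cmod_mult, Cmod_inv_INR_S. rewrite <- (Rmult_1_l (Cmod z)) at 2.
  apply Rmult_le_compat_r; [apply Cmod_ge_0 |]. rewrite <- Rinv_1. apply Rinv_le_contravar; [lra |].
  rewrite S_INR. pose proof (pos_INR k). lra.
Qed.

Definition lax_step (s : nat -> C * C * C) (k : nat) : C * C * C :=
  let al := fun j => snd (fst (s j)) in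
  let be := fun j => snd (s j) in
  let nn := fun j => fst (fst (s j)) in
  let psi := fun j => / INR (S j) * (4 * al j) in
  let phi := fun j => / INR (S j) * (- (4 * be j)) in
  (/ INR (S k) * (conv psi be k - conv al phi k), / INR (S k) * (- (2 * conv nn psi k)), / INR (S k) * (2 * conv nn phi k)).

(** [psi] and [phi] are given by [al] and [be] coefficient by coefficient, so only N is recursive,
    and the majorant N M^k reproduces itself under the quadratic recursion. *)
Lemma lax_exists (n0 a0 b0 : C) :
  exists psi phi nn al be N M, lax psi phi nn al be /\ nn O = n0 /\ al O = a0 /\ be O = b0 /\
    (1 <= N)%R /\ (1 <= M)%R /\ fbound psi N M /\ fbound phi N M /\ fbound nn N M /\ fbound al N M /\ fbound be N M.
Proof.
  pose (s := hrec lax_step (n0, a0, b0)).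
  assert (Hs : forall n, s (S n) = lax_step s n).
  { intros n. unfold s. apply hrec_S. intros s1 s2 k H. unfold lax_step. cbv zeta.
    rewrite (conv_ext (fun j => / INR (S j) * (4 * snd (fst (s1 j)))) (fun j => / INR (S j) * (4 * snd (fst (s2 j)))) (fun j => snd (s1 j)) (fun j => snd (s2 j)) k) by (intros j Hj; now rewrite H).
    rewrite (conv_ext (fun j => snd (fst (s1 j))) (fun j => snd (fst (s2 j))) (fun j => / INR (S j) * (- (4 * snd (s1 j)))) (fun j => / INR (S j) * (- (4 * snd (s2 j)))) k) by (intros j Hj; now rewrite H).
    rewrite (conv_ext (fun j => fst (fst (s1 j))) (fun j => fst (fst (s2 j))) (fun j => / INR (S j) * (4 * snd (fst (s1 j)))) (fun j => / INR (S j) * (4 * snd (fst (s2 j)))) k) by (intros j Hj; now rewrite H).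
    rewrite (conv_ext (fun j => fst (fst (s1 j))) (fun j => fst (fst (s2 j))) (fun j => / INR (S j) * (- (4 * snd (s1 j)))) (fun j => / INR (S j) * (- (4 * snd (s2 j)))) k) by (intros j Hj; now rewrite H).
    reflexivity. }
  pose (al := (fun j => snd (fst (s j))) : fps).
  pose (be := (fun j => snd (s j)) : fps).
  pose (nn := (fun j => fst (fst (s j))) : fps).
  pose (psi := (fun j => / INR (S j) * (4 * al j)) : fps).
  pose (phi := (fun j => / INR (S j) * (- (4 * be j))) : fps).
  assert (Hnn : forall k, nn (S k) = / INR (S k) * (conv psi be k - conv al phi k)) by (intros k; unfold nn at 1; now rewrite Hs).
  assert (Hal : forall k, al (S k) = / INR (S k) * (- (2 * conv nn psi k))) by (intros k; unfold al at 1; now rewrite Hs).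
  assert (Hbe : forall k, be (S k) = / INR (S k) * (2 * conv nn phi k)) by (intros k; unfold be at 1; now rewrite Hs).
  (* [N] dominates the initial values. Each product is at most (k+1) 4 N^2 M^k, each equation
     contributes two of them or one doubled, and 8 N^2 M^k = N M^(k+1) for M = 8N. *)
  pose (N := (Cmod n0 + Cmod a0 + Cmod b0 + 1)%R). pose (M := (8 * N)%R).
  assert (HN : (1 <= N)%R) by (unfold N; pose proof (Cmod_ge_0 n0); pose proof (Cmod_ge_0 a0); pose proof (Cmod_ge_0 b0); lra).
  assert (HM : (1 <= M)%R) by (unfold M; lra).
  assert (Hpsi : forall k, (Cmod (psi k) <= 4 * Cmod (al k))%R).
  { intros k. unfold psi. eapply Rle_trans; [apply Cmod_div_INR_le |]. rewrite Cmod_mult, Cmod_R, Rabs_pos_eq; lra. }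
  assert (Hphi : forall k, (Cmod (phi k) <= 4 * Cmod (be k))%R).
  { intros k. unfold phi. eapply Rle_trans; [apply Cmod_div_INR_le |]. rewrite Cmod_opp, Cmod_mult, Cmod_R, Rabs_pos_eq; lra. }
  assert (Hdiv : forall k z X, (Cmod z <= INR (S k) * X)%R -> (Cmod (/ INR (S k) * z) <= X)%R).
  { intros k z X H. rewrite Cmod_mult, Cmod_inv_INR_S. pose proof (INR_S_pos k).
    apply Rmult_le_reg_l with (INR (S k)); auto. rewrite <- Rmult_assoc, Rinv_r, Rmult_1_l; lra. }
  assert (HB : forall n k, (k <= n)%nat -> (Cmod (nn k) <= N * M ^ k /\ Cmod (al k) <= N * M ^ k /\ Cmod (be k) <= N * M ^ k)%R).
  { induction n; intros k Hk.
    - replace k with O by lia. unfold nn, al, be, s, hrec. simpl. unfold N.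
      pose proof (Cmod_ge_0 n0); pose proof (Cmod_ge_0 a0); pose proof (Cmod_ge_0 b0). lra.
    - destruct (Nat.eq_dec k (S n)) as [-> | E]; [| apply IHn; lia].
      assert (Bpsi : forall j, (j <= n)%nat -> (Cmod (psi j) <= 4 * N * M ^ j)%R).
      { intros j Hj. destruct (IHn j Hj) as [_ [H _]]. specialize (Hpsi j). lra. }
      assert (Bphi : forall j, (j <= n)%nat -> (Cmod (phi j) <= 4 * N * M ^ j)%R).
      { intros j Hj. destruct (IHn j Hj) as [_ [_ H]]. specialize (Hphi j). lra. }
      assert (E8 : forall x, (N * (M * x) = 8 * (N * N * x))%R) by (intros x; unfold M; ring).
      change (M ^ S n)%R with (M * M ^ n)%R. rewrite E8.
      pose proof (fun a b Ha Hb => conv_bound_same a b N (4 * N) M n ltac:(lra) Ha Hb) as CB.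
      pose proof (fun a b Ha Hb => conv_bound_same a b (4 * N) N M n ltac:(lra) Ha Hb) as CB'.
      assert (E4 : (N * (4 * N) * M ^ n = 4 * (N * N * M ^ n))%R) by ring. rewrite E4 in CB.
      assert (E4' : (4 * N * N * M ^ n = 4 * (N * N * M ^ n))%R) by ring. rewrite E4' in CB'.
      set (X := (N * N * M ^ n)%R) in *.
      repeat split; [rewrite Hnn | rewrite Hal | rewrite Hbe]; apply Hdiv.
      + eapply Rle_trans; [apply Cmod_triangle |]. rewrite Cmod_opp.
        pose proof (CB' psi be Bpsi (fun j Hj => proj2 (proj2 (IHn j Hj)))) as Q1.
        pose proof (CB al phi (fun j Hj => proj1 (proj2 (IHn j Hj))) Bphi) as Q2. lra.
      + rewrite Cmod_opp, Cmod_mult, Cmod_R, Rabs_pos_eq by lra.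
        pose proof (CB nn psi (fun j Hj => proj1 (IHn j Hj)) Bpsi) as Q1. lra.
      + rewrite Cmod_mult, Cmod_R, Rabs_pos_eq by lra.
        pose proof (CB nn phi (fun j Hj => proj1 (IHn j Hj)) Bphi) as Q1. lra. }
  (* [psi] and [phi] can be four times as large as [al] and [be], so the common majorant returned is
     4N. *)
  assert (H4 : forall k, (N * M ^ k <= 4 * N * M ^ k)%R).
  { intros k. pose proof (pow_le M k ltac:(lra)). assert (0 <= N * M ^ k)%R by (apply Rmult_le_pos; lra). lra. }
  exists psi, phi, nn, al, be, (4 * N)%R, M. split; [| split; [reflexivity | split; [reflexivity | split; [reflexivity |]]]].
  - assert (Hc : forall n z, INR (S n) * (/ INR (S n) * z) = z).
    { intros n z. rewrite Cmult_assoc, Cinv_r by apply INR_S_neq_0. ring. }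
    split; apply functional_extensionality; intros n; unfold fadd, fsub, fopp; rewrite ?cst_mul.
    + unfold theta, psi. rewrite <- (Hc n (4 * al n)) at 3. rewrite S_INR, RtoC_plus. ring.
    + unfold theta, phi. rewrite <- (Hc n (- (4 * be n))) at 3. rewrite S_INR, RtoC_plus. ring.
    + unfold fD. now rewrite Hnn, Hc.
    + unfold fD. now rewrite Hal, Hc.
    + unfold fD. now rewrite Hbe, Hc.
  - repeat split; try lra; intros k; destruct (HB k k (le_n _)) as [B1 [B2 B3]]; specialize (H4 k);
    specialize (Hpsi k); specialize (Hphi k); lra.
Qed.

(** The admissible ratio p grows with |lam|, so this is uniform only on bounded sets of L: enough
    for the interior factor, not for the exterior one at infinity. *)
Lemma sol_bound psi phi N M lam y p b :
  (1 <= N)%R -> (1 <= M)%R -> fbound psi N M -> fbound phi N M ->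
  (2 * M <= p)%R -> (2 * N + Cmod lam <= p)%R -> (Cmod (fst y) <= b)%R -> (Cmod (snd y) <= b)%R ->
  forall k, (Cmod (fst (sol psi phi lam y k)) <= b * p ^ k /\ Cmod (snd (sol psi phi lam y k)) <= b * p ^ k)%R.
Proof.
  intros HN HM Hpsi Hphi Hp1 Hp2 Hy1 Hy2 k.
  assert (K : forall n j, (j <= n)%nat -> (Cmod (fst (sol psi phi lam y j)) <= b * p ^ j /\ Cmod (snd (sol psi phi lam y j)) <= b * p ^ j)%R); [| now apply (K k)].
  assert (Hb : (0 <= b)%R) by (pose proof (Cmod_ge_0 (fst y)); lra).
  pose proof (Cmod_ge_0 lam) as Hl.
  induction n; intros j Hj.
  - replace j with O by lia. unfold sol, hrec. simpl. lra.
  - destruct (Nat.eq_dec j (S n)) as [-> | E]; [| apply IHn; lia].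
    rewrite sol_S. unfold sol_step. simpl fst. simpl snd.
    assert (Hpn : (0 <= p ^ n)%R) by (apply pow_le; lra).
    assert (Hbp : (0 <= b * p ^ n)%R) by now apply Rmult_le_pos.
    assert (Q1 := conv_bound_geom psi (fun j => snd (sol psi phi lam y j)) N b M p n ltac:(lra) Hp1 Hpsi (fun j Hj => proj2 (IHn j Hj))).
    assert (Q2 := conv_bound_geom phi (fun j => fst (sol psi phi lam y j)) N b M p n ltac:(lra) Hp1 Hphi (fun j Hj => proj1 (IHn j Hj))).
    assert (Q3 : (2 * N * (b * p ^ n) + Cmod lam * (b * p ^ n) <= b * p ^ S n)%R).
    { simpl. replace (b * (p * p ^ n))%R with (p * (b * p ^ n))%R by ring. rewrite <- Rmult_plus_distr_r. now apply Rmult_le_compat_r. }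
    assert (Q4 : (0 <= Cmod lam * (b * p ^ n))%R) by now apply Rmult_le_pos.
    split; (eapply Rle_trans; [apply Cmod_div_INR_le |]).
    + lra.
    + eapply Rle_trans; [apply Cmod_triangle |]. rewrite Cmod_mult.
      assert (Q5 : (Cmod lam * Cmod (snd (sol psi phi lam y n)) <= Cmod lam * (b * p ^ n))%R).
      { apply Rmult_le_compat_l; auto. exact (proj2 (IHn n (le_n n))). }
      lra.
Qed.

(** * Holomorphic dependence on L and bounds in powers of 1/L *)

Lemma holo_conv U a (h : nat -> C -> C) n :
  (forall j, (j <= n)%nat -> holo U (h j)) -> holo U (fun z => conv a (fun j => h j z) n).
Proof.
  revert a. induction n; intros a Hh.
  - apply (holo_mult U (fun _ => a O) (h O)); [apply holo_const | auto].
  - apply (holo_plus U (fun z => a O * h (S n) z) (fun z => conv (fun k => a (S k)) (fun j => h j z) n)).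
    + apply holo_mult; [apply holo_const | auto].
    + apply IHn. intros j Hj. apply Hh. lia.
Qed.

(** Each coefficient is a polynomial in lam and the initial data. *)
Lemma holo_sol U psi phi (lam : C -> C) (y : C -> C * C) k :
  holo U lam -> holo U (fun z => fst (y z)) -> holo U (fun z => snd (y z)) ->
  holo U (fun z => fst (sol psi phi (lam z) (y z) k)) /\ holo U (fun z => snd (sol psi phi (lam z) (y z) k)).
Proof.
  intros Hl Hy1 Hy2.
  assert (K : forall n j, (j <= n)%nat -> holo U (fun z => fst (sol psi phi (lam z) (y z) j)) /\ holo U (fun z => snd (sol psi phi (lam z) (y z) j))); [| now apply (K k)].
  induction n; intros j Hj.
  - replace j with O by lia. split; [exact Hy1 | exact Hy2].
  - destruct (Nat.eq_dec j (S n)) as [-> | E]; [| apply IHn; lia].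
    assert (E2 : (fun z => fst (sol psi phi (lam z) (y z) (S n))) = (fun z => / INR (S n) * conv psi (fun j => snd (sol psi phi (lam z) (y z) j)) n)).
    { apply functional_extensionality. intros z. now rewrite sol_S. }
    assert (E3 : (fun z => snd (sol psi phi (lam z) (y z) (S n))) = (fun z => / INR (S n) * (conv phi (fun j => fst (sol psi phi (lam z) (y z) j)) n + lam z * snd (sol psi phi (lam z) (y z) n)))).
    { apply functional_extensionality. intros z. now rewrite sol_S. }
    rewrite E2, E3. split; (apply holo_mult; [apply holo_const |]).
    + apply (holo_conv U psi (fun j z => snd (sol psi phi (lam z) (y z) j))). intros i Hi. exact (proj2 (IHn i Hi)).
    + apply holo_plus; [| apply holo_mult; [auto | exact (proj2 (IHn n (le_n n)))]].
      apply (holo_conv U phi (fun j z => fst (sol psi phi (lam z) (y z) j))). intros i Hi. exact (proj1 (IHn i Hi)).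
Qed.

(** The entries nn - 1 and nn + 1 have size 2N and the off-diagonal ones N; the convolution doubles
    this to 4N + 2N = 6N, and |2i| gives 12N. Dividing by k+m+1 >= m+1 at each step produces m!. *)
Lemma fg_bound nn al be N M m :
  (1 <= N)%R -> (1 <= M)%R -> fbound nn N M -> fbound al N M -> fbound be N M ->
  fbound (fst (fg nn al be m)) ((12 * N) ^ m / INR (fact m)) (2 * M) /\
  fbound (snd (fg nn al be m)) ((12 * N) ^ m / INR (fact m)) (2 * M).
Proof.
  intros HN HM Hn Ha Hb.
  assert (H1 : fbound (cst 1) 1 M).
  { intros [| k]; simpl; [rewrite Cmod_1; lra |]. rewrite Cmod_0. assert (0 <= M * M ^ k)%R by (apply Rmult_le_pos; [lra | apply pow_le; lra]). lra. }
  assert (Hp : forall k, (0 <= M ^ k)%R) by (intros k; apply pow_le; lra).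
  assert (Hnm : fbound (nn - cst 1)%fps (2 * N) M).
  { intros k. unfold fsub, Cminus. eapply Rle_trans; [apply Cmod_triangle |]. rewrite Cmod_opp.
    specialize (H1 k). specialize (Hn k). specialize (Hp k). nra. }
  assert (Hnp : fbound (nn + cst 1)%fps (2 * N) M).
  { intros k. unfold fadd. eapply Rle_trans; [apply Cmod_triangle |].
    specialize (H1 k). specialize (Hn k). specialize (Hp k). nra. }
  induction m as [| m [IHf IHg]].
  - assert (Hq : forall k, (0 <= (2 * M) ^ k)%R) by (intros k; apply pow_le; lra).
    split; intros k; specialize (Hq k); simpl fst; simpl snd; simpl (fact 0); simpl pow at 1.
    + destruct k; simpl in *; [rewrite Cmod_1 | rewrite Cmod_0]; lra.
    + destruct k; simpl in *; rewrite Cmod_0; lra.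
  - set (Rm := ((12 * N) ^ m / INR (fact m))%R) in *.
    assert (HRm : (0 <= Rm)%R).
    { unfold Rm. apply Rdiv_le_0_compat; [apply pow_le; lra | apply INR_fact_lt_0]. }
    assert (Hdiv : forall k (z : C) X, (Cmod z <= 6 * N * Rm * X)%R -> (0 <= X)%R ->
       (Cmod (- (2 * Ci) / INR (S (k + m)) * z) <= (12 * N) ^ S m / INR (fact (S m)) * X)%R).
    { intros k z X Hz HX. unfold Cdiv. rewrite !Cmod_mult, Cmod_opp, Cmod_mult, Cmod_Ci, Cmod_R, Cmod_inv_INR_S, Rabs_pos_eq, Rmult_1_r by lra.
      replace ((12 * N) ^ S m / INR (fact (S m)) * X)%R with (2 * / INR (S m) * (6 * N * Rm * X))%R.
      2: { rewrite fact_simpl, mult_INR. unfold Rm. simpl pow. field. split; [apply INR_fact_neq_0 | apply not_0_INR; lia]. }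
      apply Rmult_le_compat; auto using Cmod_ge_0.
      - apply Rmult_le_pos; [lra |]. left. apply Rinv_0_lt_compat, INR_S_pos.
      - apply Rmult_le_compat_l; [lra |]. apply Rinv_le_contravar; [apply INR_S_pos |]. apply le_INR. lia. }
    assert (Hq : forall k, (0 <= (2 * M) ^ k)%R) by (intros k; apply pow_le; lra).
    pose proof (fun a A b k Ha Hb => conv_bound_geom a b A Rm M (2 * M) k ltac:(lra) ltac:(lra) Ha Hb) as CB.
    split; intros k; simpl fst; simpl snd; unfold theta_div; apply Hdiv; auto.
    + unfold fadd. eapply Rle_trans; [apply Cmod_triangle |].
      pose proof (CB _ _ _ k Hnm (fun j _ => IHf j)) as Q1. pose proof (CB _ _ _ k Ha (fun j _ => IHg j)) as Q2.
      unfold fmul. lra.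
    + unfold fsub, Cminus. eapply Rle_trans; [apply Cmod_triangle |]. rewrite Cmod_opp.
      pose proof (CB _ _ _ k Hb (fun j _ => IHf j)) as Q1. pose proof (CB _ _ _ k Hnp (fun j _ => IHg j)) as Q2.
      unfold fmul. lra.
Qed.

(** (x/y)^m / m! is one term of the exponential series of x/y. A factorial bound thus becomes
    geometric with any chosen ratio y. *)
Lemma pow_fact_geom (x y : R) m : (0 <= x)%R -> (0 < y)%R -> (x ^ m / INR (fact m) <= exp (x / y) * y ^ m)%R.
Proof.
  intros Hx Hy. replace x with (x / y * y)%R at 1 by (field; lra). rewrite Rpow_mult_distr.
  assert (H0 : (0 <= x / y)%R) by now apply Rdiv_le_0_compat.
  replace ((x / y) ^ m * y ^ m / INR (fact m))%R with ((x / y) ^ m / INR (fact m) * y ^ m)%R by (unfold Rdiv; ring).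
  apply Rmult_le_compat_r; [apply pow_le; lra |].
  apply Rle_trans with (sum_f_R0 (fun k => (x / y) ^ k / INR (fact k))%R m); [| now apply exp_ge_taylor].
  assert (Hpos : forall k, (0 <= (x / y) ^ k / INR (fact k))%R).
  { intros k. apply Rdiv_le_0_compat; [now apply pow_le | apply INR_fact_lt_0]. }
  destruct m; simpl; [lra |].
  assert (0 <= sum_f_R0 (fun k => (x / y) ^ k / INR (fact k))%R m)%R by now apply cond_pos_sum.
  specialize (Hpos (S m)). simpl in Hpos. lra.
Qed.

(** * The exponential series *)

Lemma exp_series_ex z : exists l, csum (fun n => z ^ n * / INR (fact n)) l.
Proof.
  apply csum_geom_ex with (exp (Cmod z / (1 / 2))) (1 / 2)%R; [lra |]. intros k.
  rewrite Cmod_mult, Cmod_pow, Cmod_inv, Cmod_R, Rabs_pos_eq by (try apply pos_INR; intros H; apply RtoC_inj in H; now apply INR_fact_neq_0 in H).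
  apply pow_fact_geom; [apply Cmod_ge_0 | lra].
Qed.

Lemma Cexp_plus x y : Cexp (x + y) = Cexp x * Cexp y.
Proof.
  unfold Cexp. rewrite re_plus, im_plus, exp_plus, cos_plus, sin_plus.
  apply injective_projections; simpl; ring.
Qed.

Lemma Cexp_0 : Cexp 0 = 1.
Proof. unfold Cexp. simpl. rewrite exp_0, cos_0, sin_0. apply injective_projections; simpl; ring. Qed.

Lemma dquot_R_const (q : R -> C) :
  (forall t, dquot (locally' t) RtoC t q 0) -> q 1%R = q 0%R.
Proof.
  intros H.
  assert (K : forall t, is_derive (fun s => Re (q s)) t 0%R /\ is_derive (fun s => Im (q s)) t 0%R).
  { intros t. apply (dquot_is_derive q t 0). auto. }
  apply injective_projections; symmetry.
  - apply (eq_is_derive (V := R_NormedModule) (fun s => Re (q s)) 0 1); [intros t _; apply K | lra].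
  - apply (eq_is_derive (V := R_NormedModule) (fun s => Im (q s)) 0 1); [intros t _; apply K | lra].
Qed.

(** [Cexp] is given by real exponential and trigonometric functions. Along t -> tz it and the sum E
    of the series satisfy the same equation y' = z y, so E(-tz) times either of them is constant,
    equal to 1. *)
Lemma csum_Cexp z : csum (fun n => z ^ n * / INR (fact n)) (Cexp z).
Proof.
  pose (E := fun z => Csum (fun n => z ^ n * / INR (fact n))).
  assert (HE : forall z, csum (fun n => z ^ n * / INR (fact n)) (E z)) by (intros; apply Csum_correct, exp_series_ex).
  assert (HD : forall z, is_cderive E z (E z)).
  { intros w. destruct (pseries_derive (fun n => / INR (fact n)) (Cmod w + 1) E (fun z _ => HE z) w ltac:(lra)) as [l [Hl Hs]].
    replace (E w) with l; auto. apply (csum_unique _ _ _ Hs).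
    apply csum_ext with (2 := HE w). intros k. rewrite fact_simpl, mult_INR, RtoC_mult. field.
    split; [intros H; apply RtoC_inj in H; now apply INR_fact_neq_0 in H | apply INR_S_neq_0]. }
  assert (E0 : E 0 = 1).
  { apply Csum_eq. intros eps He. exists 1%nat. intros n Hn. replace (psum (fun n => 0 ^ n * / INR (fact n)) n) with (RtoC 1).
    - replace (1 - 1) with (RtoC 0) by ring. now rewrite Cmod_0.
    - induction Hn; [simpl; field; apply C1_nz |]. simpl psum. rewrite <- IHHn. destruct m; [lia | simpl; ring]. }
  assert (Hz : forall t, dquot (locally' t) RtoC t (fun s => RtoC s * z) z).
  { intros t. pose proof (dquot_mult (approach_R t) RtoC (fun _ => z) 1 0 (dquot_id (approach_R t)) (dquot_const (approach_R t) z)) as H.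
    cbv beta in H. assert (Ez : 1 * z + RtoC t * 0 = z) by ring. rewrite Ez in H. exact H. }
  assert (Hmz : forall t, dquot (locally' t) RtoC t (fun s => - (RtoC s * z)) (- z)).
  { intros t. apply dquot_opp; [apply approach_R | apply Hz]. }
  assert (H1 : forall t, dquot (locally' t) RtoC t (fun s => E (RtoC s * z)) (E (RtoC t * z) * z)).
  { intros t. apply (dquot_chain (approach_R t) (fun s => RtoC s * z) E); auto. }
  assert (H2 : forall t, dquot (locally' t) RtoC t (fun s => E (- (RtoC s * z))) (E (- (RtoC t * z)) * - z)).
  { intros t. apply (dquot_chain (approach_R t) (fun s => - (RtoC s * z)) E); auto. }
  assert (H3 : forall t, dquot (locally' t) RtoC t (fun s => Cexp (RtoC s * z)) (Cexp (RtoC t * z) * z)).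
  { intros t. apply is_derive_dquot; destruct z as [x y]; unfold Cexp; simpl; auto_derive; auto; unfold Rminus; ring. }
  assert (P1 : E (- z) * E z = 1).
  { assert (Q := dquot_R_const (fun s => E (- (RtoC s * z)) * E (RtoC s * z))).
    cbv beta in Q. replace (1 * z) with z in Q by ring. rewrite Q.
    - replace (- (0 * z)) with (RtoC 0) by ring. replace (0 * z) with (RtoC 0) by ring. rewrite E0. ring.
    - intros t. replace (RtoC 0) with (E (- (RtoC t * z)) * - z * E (RtoC t * z) + E (- (RtoC t * z)) * (E (RtoC t * z) * z)) by ring.
      apply (dquot_mult (approach_R t)); auto. }
  assert (P2 : E (- z) * Cexp z = 1).
  { assert (Q := dquot_R_const (fun s => E (- (RtoC s * z)) * Cexp (RtoC s * z))).
    cbv beta in Q. replace (1 * z) with z in Q by ring. rewrite Q.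
    - replace (- (0 * z)) with (RtoC 0) by ring. replace (0 * z) with (RtoC 0) by ring. rewrite E0, Cexp_0. ring.
    - intros t. replace (RtoC 0) with (E (- (RtoC t * z)) * - z * Cexp (RtoC t * z) + E (- (RtoC t * z)) * (Cexp (RtoC t * z) * z)) by ring.
      apply (dquot_mult (approach_R t)); auto. }
  replace (Cexp z) with (E z); [apply HE |].
  transitivity (E z * (E (- z) * Cexp z)); [rewrite P2; ring |].
  transitivity (E (- z) * E z * Cexp z); [ring | rewrite P1; ring].
Qed.

Lemma holo_Cexp U : holo U Cexp.
Proof.
  apply analytic_holo. intros z _.
  apply (analytic_at_translate Cexp z 1 (fun n => Cexp z * / INR (fact n))); [lra |].
  intros w _. rewrite Cexp_plus. apply csum_ext with (fun n => Cexp z * (w ^ n * / INR (fact n))); [intros; ring |].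
  apply csum_scal, csum_Cexp.
Qed.

(** * Products of series *)

Lemma psum_conv_S a b n :
  psum (conv a b) (S n) = a O * psum b (S n) + psum (conv (fun k => a (S k)) b) n.
Proof.
  induction n; [simpl; ring |].
  change (psum (conv a b) (S n) + conv a b (S n) = a O * (psum b (S n) + b (S n)) + (psum (conv (fun k => a (S k)) b) n + conv (fun k => a (S k)) b n)).
  rewrite IHn, conv_S. ring.
Qed.

(** The gap between the product of a partial sum with [lb] and the Cauchy product is a sum of n
    terms a_k times a tail of b, each O(q^n); n q^n tends to 0. *)
Lemma csum_conv a b la lb K K' q :
  (0 <= q < 1)%R -> (forall k, (Cmod (a k) <= K * q ^ k)%R) -> (forall k, (Cmod (b k) <= K' * q ^ k)%R) ->
  csum a la -> csum b lb -> csum (conv a b) (la * lb).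
Proof.
  intros Hq Ha Hb Hla Hlb.
  assert (HT := fun n => csum_tail b K' q lb n Hq Hb Hlb).
  (* Generalised over [a] and [K]: the induction passes to the shifted sequence, whose constant is K
     q. *)
  assert (Herr : forall n a K, (forall k, (Cmod (a k) <= K * q ^ k)%R) ->
    (Cmod (psum a n * lb - psum (conv a b) n) <= INR n * (K * (K' / (1 - q)) * q ^ n))%R).
  { clear a la K Ha Hla. induction n; intros a K Ha.
    - simpl. replace (0 * lb - 0) with (RtoC 0) by ring. rewrite Cmod_0. lra.
    - rewrite psum_conv_S, psum_shift.
      replace ((a O + psum (fun k => a (S k)) n) * lb - (a O * psum b (S n) + psum (conv (fun k => a (S k)) b) n))
        with (a O * (lb - psum b (S n)) + (psum (fun k => a (S k)) n * lb - psum (conv (fun k => a (S k)) b) n)) by ring.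
      eapply Rle_trans; [apply Cmod_triangle |]. rewrite Cmod_mult.
      assert (H0 := Ha O). simpl in H0.
      assert (H1 : (Cmod (a O) * Cmod (lb - psum b (S n)) <= K * (K' / (1 - q) * q ^ S n))%R).
      { apply Rmult_le_compat; auto using Cmod_ge_0. lra. }
      assert (H2 := IHn (fun k => a (S k)) (K * q)%R). cbv beta in H2.
      rewrite S_INR.
      replace ((INR n + 1) * (K * (K' / (1 - q)) * q ^ S n))%R with (K * (K' / (1 - q) * q ^ S n) + INR n * (K * q * (K' / (1 - q)) * q ^ n))%R by (simpl; ring).
      apply Rplus_le_compat; [exact H1 |]. apply H2. intros k. specialize (Ha (S k)). simpl in Ha. lra. }
  destruct (INR2_pow_geom q Hq) as [B [p [Hp [HB HBp]]]].
  intros eps He.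
  destruct (tends_mult eventually _ _ _ _ Hla (tends_const eventually lb) (eps / 2)%R ltac:(lra)) as [N1 HN1].
  destruct (pow_to_0 p (K * (K' / (1 - q)) * B) (eps / 2) Hp ltac:(lra)) as [N2 HN2].
  exists (N1 + N2)%nat. intros n Hn. specialize (HN1 n ltac:(lia)). specialize (HN2 n ltac:(lia)).
  replace (psum (conv a b) n - la * lb) with ((psum a n * lb - la * lb) + - (psum a n * lb - psum (conv a b) n)) by ring.
  eapply Rle_lt_trans; [apply Cmod_triangle |]. rewrite Cmod_opp.
  assert (HKK : (0 <= K * (K' / (1 - q)))%R).
  { apply Rmult_le_pos; [exact (geom_K_pos a K q Ha) |]. apply Rdiv_le_0_compat; [exact (geom_K_pos b K' q Hb) | lra]. }
  assert (Hnn : (INR n * q ^ n <= INR n ^ 2 * q ^ n)%R).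
  { apply Rmult_le_compat_r; [apply pow_le; lra |]. destruct n; [simpl; lra |].
    assert (1 <= INR (S n))%R by (rewrite S_INR; pose proof (pos_INR n); lra). nra. }
  assert (Hmain : (K * (K' / (1 - q)) * (INR n * q ^ n) <= K * (K' / (1 - q)) * (B * p ^ n))%R).
  { apply Rmult_le_compat_l; auto. eapply Rle_trans; [exact Hnn | apply HBp]. }
  specialize (Herr n a K Ha). lra.
Qed.

Lemma conv_weight x a b n : x ^ n * conv a b n = conv (fun k => x ^ k * a k) (fun k => x ^ k * b k) n.
Proof.
  revert a. induction n; intros a; [simpl; ring |].
  rewrite !conv_S. rewrite (conv_ext (fun k => x ^ S k * a (S k)) (fun k => x * (x ^ k * a (S k))) (fun k => x ^ k * b k) (fun k => x ^ k * b k)); auto.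
  - rewrite (conv_scal_l x (fun k => x ^ k * a (S k))), <- (IHn (fun k => a (S k))). simpl. ring.
  - intros k _. simpl. ring.
Qed.

(** * The exterior columns *)

Lemma INR_fact_neq_C m : RtoC (INR (fact m)) <> 0.
Proof. intros H. apply RtoC_inj in H. now apply INR_fact_neq_0 in H. Qed.

Lemma csum_conv_finite (a : fps) (h : nat -> nat -> C) (H : nat -> C) n :
  (forall j, (j <= n)%nat -> csum (fun m => h m j) (H j)) -> csum (fun m => conv a (h m) n) (conv a H n).
Proof.
  revert a. induction n; intros a Hh.
  - simpl. now apply csum_scal, Hh.
  - apply csum_ext with (fun m => a O * h m (S n) + conv (fun k => a (S k)) (h m) n); [reflexivity |].
    rewrite conv_S. apply csum_plus; [now apply csum_scal, Hh |]. apply IHn. intros j Hj. apply Hh. lia.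
Qed.

Section Column.
Variables A B C0 D : C.
Hypothesis Hdet : A * D - B * C0 = 1.
Variables psi phi nn al be : fps.
Hypothesis HL : lax psi phi nn al be.
(** With A, B, C0, D the entries of G, these are the entries of G^-1 sigma3 G, simplified by det G =
    1. *)
Hypothesis Hnn : nn O = A * D + B * C0.
Hypothesis Hal : al O = 2 * (B * D).
Hypothesis Hbe : be O = - (2 * (A * C0)).
Variables N M : R.
Hypothesis HN : (1 <= N)%R.
Hypothesis HM : (1 <= M)%R.
Hypothesis Bpsi : fbound psi N M.
Hypothesis Bphi : fbound phi N M.
Hypothesis Bnn : fbound nn N M.
Hypothesis Bal : fbound al N M.
Hypothesis Bbe : fbound be N M.

Let f m := fst (fg nn al be m).
Let g m := snd (fg nn al be m).

(** At X = 0 the matrix N - 1 = G^-1 (sigma3 - 1) G has eigenvalues 0 and -2. The recursion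
    therefore multiplies by (-2i)(-2)/m = 4i/m on one line, giving the coefficients of exp(4i/L),
    and stops after m = 0 on the other. *)
Lemma fg_at_0 m :
  f m O = (match m with O => A * D | S _ => 0 end) - B * C0 * ((4 * Ci) ^ m * / INR (fact m)) /\
  g m O = (match m with O => - (A * C0) | S _ => 0 end) + A * C0 * ((4 * Ci) ^ m * / INR (fact m)).
Proof.
  induction m as [| m [IHf IHg]].
  - unfold f, g. simpl. split.
    + transitivity (A * D - B * C0); [now rewrite Hdet | field; apply C1_nz].
    + field; apply C1_nz.
  - unfold f, g in *. simpl fst. simpl snd. unfold theta_div, fadd, fsub, fmul. simpl conv.
    rewrite IHf, IHg, Hnn, Hal, Hbe. rewrite !fact_simpl, !mult_INR, !RtoC_mult. change (cst 1 O) with (RtoC 1). simpl (0 + m)%nat.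
    replace ((4 * Ci) ^ S m) with (4 * Ci * (4 * Ci) ^ m) by reflexivity.
    assert (E4 : RtoC 4 = 2 * 2) by (rewrite <- RtoC_mult; apply f_equal; lra).
    set (e := (4 * Ci) ^ m * / INR (fact m)).
    replace (4 * Ci * (4 * Ci) ^ m * / (INR (S m) * INR (fact m))) with (4 * Ci * / INR (S m) * e).
    2: { unfold e. field. split; [apply INR_fact_neq_C | apply INR_S_neq_0]. }
    assert (E1 : A * D + B * C0 - 1 = 2 * (B * C0)) by (rewrite <- Hdet; ring).
    assert (E2 : A * D + B * C0 + 1 = 2 * (A * D)) by (rewrite <- Hdet; ring).
    rewrite E1, E2, E4. unfold Cdiv.
    split.
    + transitivity (0 - B * C0 * (2 * 2 * Ci * / INR (S m) * e) * (A * D - B * C0)); [| rewrite Hdet; ring].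
      destruct m; ring.
    + transitivity (0 + A * C0 * (2 * 2 * Ci * / INR (S m) * e) * (A * D - B * C0)); [| rewrite Hdet; ring].
      destruct m; ring.
Qed.

(** [zeta] is 1/L. The disc |zeta| <= 2 contains L = infinity and reaches inside the unit circle,
    down to |L| = 1/2. *)
Definition out_f (zeta : C) : fps := fun k => Csum (fun m => zeta ^ m * f m k).
Definition out_g (zeta : C) : fps := fun k => Csum (fun m => zeta ^ m * g m k).

(** Output of [pow_fact_geom] for 12N times |zeta| <= 2, with ratio 1/2. *)
Definition outK : R := exp (12 * N * 2 / (1 / 2)).

Lemma outK_pos : (0 < outK)%R.
Proof. apply exp_pos. Qed.

Lemma out_term (a : fps) m k zeta :
  fbound a ((12 * N) ^ m / INR (fact m)) (2 * M) -> (Cmod zeta <= 2)%R ->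
  (Cmod (zeta ^ m * a k) <= outK * (2 * M) ^ k * (1 / 2) ^ m)%R.
Proof.
  intros Ha Hz. rewrite Cmod_mult, Cmod_pow. specialize (Ha k).
  assert (H0 : (0 <= (2 * M) ^ k)%R) by (apply pow_le; lra).
  assert (H1 : (Cmod zeta ^ m <= 2 ^ m)%R) by (apply pow_incr; split; [apply Cmod_ge_0 | auto]).
  apply Rle_trans with (2 ^ m * ((12 * N) ^ m / INR (fact m) * (2 * M) ^ k))%R.
  - apply Rmult_le_compat; auto using Cmod_ge_0. apply pow_le, Cmod_ge_0.
  - replace (2 ^ m * ((12 * N) ^ m / INR (fact m) * (2 * M) ^ k))%R with ((12 * N * 2) ^ m / INR (fact m) * (2 * M) ^ k)%R by (rewrite (Rpow_mult_distr (12 * N) 2); unfold Rdiv; ring).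
    replace (outK * (2 * M) ^ k * (1 / 2) ^ m)%R with (outK * (1 / 2) ^ m * (2 * M) ^ k)%R by ring.
    apply Rmult_le_compat_r; auto. apply pow_fact_geom; lra.
Qed.

Lemma f_bound m : fbound (f m) ((12 * N) ^ m / INR (fact m)) (2 * M).
Proof. now apply fg_bound. Qed.

Lemma g_bound m : fbound (g m) ((12 * N) ^ m / INR (fact m)) (2 * M).
Proof. now apply fg_bound. Qed.

Lemma out_f_csum zeta k : (Cmod zeta <= 2)%R -> csum (fun m => zeta ^ m * f m k) (out_f zeta k).
Proof.
  intros Hz. apply Csum_correct. apply csum_geom_ex with (outK * (2 * M) ^ k)%R (1 / 2)%R; [lra |].
  intros m. apply out_term; auto. apply f_bound.
Qed.

Lemma out_g_csum zeta k : (Cmod zeta <= 2)%R -> csum (fun m => zeta ^ m * g m k) (out_g zeta k).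
Proof.
  intros Hz. apply Csum_correct. apply csum_geom_ex with (outK * (2 * M) ^ k)%R (1 / 2)%R; [lra |].
  intros m. apply out_term; auto. apply g_bound.
Qed.

(** Summing [fg_Xode] over m against zeta^m: the index shift from m to m+1 produces the factor
    1/zeta = L in front of the second component. *)
Lemma out_is_sol (zeta : C) :
  zeta <> 0 -> (Cmod zeta <= 2)%R -> is_sol psi phi (2 * Ci / zeta) (out_f zeta) (out_g zeta).
Proof.
  intros H0 Hz. split; apply functional_extensionality; intros k; unfold fadd; rewrite ?cst_mul.
  - apply (csum_unique (fun m => zeta ^ m * fD (f m) k)).
    + apply csum_ext with (fun m => INR (S k) * (zeta ^ m * f m (S k))); [intros m; unfold fD; ring |].
      now apply csum_scal, out_f_csum.
    + apply csum_ext with (fun m => conv psi (fun j => zeta ^ m * g m j) k).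
      * intros m. destruct (fg_Xode psi phi nn al be HL m) as [E _]. unfold f, g. rewrite E.
        rewrite conv_comm, conv_scal_l, conv_comm. reflexivity.
      * apply csum_conv_finite. intros j _. now apply out_g_csum.
  - apply (csum_unique (fun m => zeta ^ m * fD (g m) k)).
    + apply csum_ext with (fun m => INR (S k) * (zeta ^ m * g m (S k))); [intros m; unfold fD; ring |].
      now apply csum_scal, out_g_csum.
    + apply csum_ext with (fun m => conv phi (fun j => zeta ^ m * f m j) k + 2 * Ci / zeta * (zeta ^ S m * g (S m) k)).
      * intros m. destruct (fg_Xode psi phi nn al be HL m) as [_ E]. unfold f, g in *. rewrite E.
        rewrite conv_comm, conv_scal_l, conv_comm. unfold fadd. rewrite !cst_mul. simpl Cpow.
        unfold fmul. field. auto.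
      * apply csum_plus; [apply csum_conv_finite; intros j _; now apply out_f_csum |].
        (* The shift loses the term m = 0, which vanishes because the second component starts at
           1/L. *)
        apply csum_scal. apply (csum_shift (fun m => zeta ^ m * g m k)).
        replace (zeta ^ 0 * g 0 k + out_g zeta k) with (out_g zeta k); [now apply out_g_csum |].
        unfold g. simpl. destruct k; simpl; ring.
Qed.

(** The right-hand sides form the first column of G^-1 e^(-2i sigma3/L) G e^(2i sigma3/L), the
    exterior factor at X = 0 when the interior one is G^-1. *)
Lemma out_0 zeta :
  (Cmod zeta <= 2)%R ->
  out_f zeta O = A * D - B * C0 * Cexp (4 * Ci * zeta) /\ out_g zeta O = - (A * C0) + A * C0 * Cexp (4 * Ci * zeta).
Proof.
  intros Hz.
  assert (Hd : forall c, csum (fun m => match m with O => c | S _ => 0 end) c).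
  { intros c eps He. exists 1%nat. intros n Hn.
    replace (psum (fun m => match m with O => c | S _ => 0 end) n) with c; [replace (c - c) with (RtoC 0) by ring; now rewrite Cmod_0 |].
    induction Hn; [simpl; ring |]. simpl psum. rewrite <- IHHn. destruct m; [lia | ring]. }
  split.
  - apply (csum_unique _ _ _ (out_f_csum zeta O Hz)).
    apply csum_ext with (fun m => (match m with O => A * D | S _ => 0 end) - B * C0 * ((4 * Ci * zeta) ^ m * / INR (fact m))).
    + intros m. rewrite (proj1 (fg_at_0 m)), Cpow_mult_l. destruct m; simpl; ring.
    + apply csum_minus; [apply Hd |]. apply csum_scal, csum_Cexp.
  - apply (csum_unique _ _ _ (out_g_csum zeta O Hz)).
    apply csum_ext with (fun m => (match m with O => - (A * C0) | S _ => 0 end) + A * C0 * ((4 * Ci * zeta) ^ m * / INR (fact m))).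
    + intros m. rewrite (proj2 (fg_at_0 m)), Cpow_mult_l. destruct m; simpl; ring.
    + apply csum_plus; [apply Hd |]. apply csum_scal, csum_Cexp.
Qed.

Lemma out_bound zeta k :
  (Cmod zeta <= 2)%R ->
  (Cmod (out_f zeta k) <= 2 * outK * (2 * M) ^ k /\ Cmod (out_g zeta k) <= 2 * outK * (2 * M) ^ k)%R.
Proof.
  intros Hz. split.
  - replace (2 * outK * (2 * M) ^ k)%R with (outK * (2 * M) ^ k / (1 - 1 / 2))%R by field.
    apply (csum_bound (fun m => zeta ^ m * f m k)); [lra | | now apply out_f_csum].
    intros m. apply out_term; auto. apply f_bound.
  - replace (2 * outK * (2 * M) ^ k)%R with (outK * (2 * M) ^ k / (1 - 1 / 2))%R by field.
    apply (csum_bound (fun m => zeta ^ m * g m k)); [lra | | now apply out_g_csum].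
    intros m. apply out_term; auto. apply g_bound.
Qed.

(* Comparing [zeta] with [2] turns the tail bound at radius 2 into a power of [zeta]. *)
Lemma out_tail (a : nat -> fps) l n zeta k :
  (forall m, fbound (a m) ((12 * N) ^ m / INR (fact m)) (2 * M)) -> (Cmod zeta <= 1)%R ->
  csum (fun m => zeta ^ m * a m k) l ->
  (Cmod (l - psum (fun m => zeta ^ m * a m k) n)%C <= 2 * outK * (2 * M) ^ k * Cmod zeta ^ n)%R.
Proof.
  intros Ha Hz Hl. pose proof (Cmod_ge_0 zeta) as H0. pose proof outK_pos as HK.
  assert (Hp : (0 <= (2 * M) ^ k)%R) by (apply pow_le; lra).
  pose (K := (outK * (2 * M) ^ k)%R).
  assert (HT : forall m, (Cmod (zeta ^ m * a m k) <= K * (Cmod zeta / 2) ^ m * (1 / 2 * 2) ^ m)%R).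
  { intros m. pose proof (out_term (a m) m k 2 (Ha m)) as H. rewrite Cmod_mult, Cmod_pow, Cmod_R, Rabs_pos_eq in H by lra.
    specialize (H ltac:(lra)). fold K in H.
    rewrite Cmod_mult, Cmod_pow. replace (1 / 2 * 2)%R with 1%R by field. rewrite pow1, Rmult_1_r. rewrite Rpow_div.
    apply Rmult_le_reg_r with (2 ^ m)%R; [apply pow_lt; lra |].
    replace (K * (Cmod zeta ^ m / 2 ^ m) * 2 ^ m)%R with (Cmod zeta ^ m * K)%R by (field; apply pow_nonzero; lra).
    replace (Cmod zeta ^ m * Cmod (a m k) * 2 ^ m)%R with (Cmod zeta ^ m * (2 ^ m * Cmod (a m k)))%R by ring.
    apply Rmult_le_compat_l; [now apply pow_le |].
    apply Rle_trans with (1 := H). rewrite <- (Rmult_1_r K) at 2. apply Rmult_le_compat_l; [unfold K; apply Rmult_le_pos; lra |].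
    pose proof (pow_incr (1 / 2) 1 m ltac:(lra)) as Hh. now rewrite pow1 in Hh. }
  apply Rle_trans with (K / (1 - Cmod zeta / 2) * (Cmod zeta / 2) ^ n)%R.
  - apply csum_tail with (a := fun m => zeta ^ m * a m k); auto; [lra |].
    intros m. specialize (HT m). replace (1 / 2 * 2)%R with 1%R in HT by field. rewrite pow1, Rmult_1_r in HT. exact HT.
  - replace (2 * outK * (2 * M) ^ k * Cmod zeta ^ n)%R with (2 * K * Cmod zeta ^ n)%R by (unfold K; ring).
    assert (HK0 : (0 <= K)%R) by (unfold K; apply Rmult_le_pos; lra).
    apply Rmult_le_compat.
    + apply Rdiv_le_0_compat; lra.
    + apply pow_le. lra.
    + unfold Rdiv. rewrite Rmult_comm. apply Rmult_le_compat_r; auto.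
      replace 2%R with (/ (1 / 2))%R at 2 by field. apply Rinv_le_contravar; lra.
    + apply pow_incr. lra.
Qed.

(** ** Sums over the powers of X *)

(** Dominates all ratios in use: 2M for the exterior coefficients, and 2M and 2N + |lam| for the
    X-equation, where |lam| = 2|L| <= 4 on |L| <= 2. The condition on [X] then makes every series in
    X geometric with ratio 1/2. *)
Definition rho : R := (2 * M + 2 * N + 4)%R.

Variable X : C.
Hypothesis HX : (Cmod X * rho <= 1 / 2)%R.

Lemma rho_pos : (0 < rho)%R.
Proof. unfold rho. lra. Qed.

Lemma X_term (a : fps) K p k :
  (0 <= p <= rho)%R -> (0 <= K)%R -> (Cmod (a k) <= K * p ^ k)%R -> (Cmod (X ^ k * a k) <= K * (1 / 2) ^ k)%R.
Proof.
  intros Hp HK Ha. rewrite Cmod_mult, Cmod_pow. pose proof (Cmod_ge_0 X) as H0.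
  apply Rle_trans with (Cmod X ^ k * (K * p ^ k))%R.
  - apply Rmult_le_compat_l; auto. now apply pow_le.
  - replace (Cmod X ^ k * (K * p ^ k))%R with (K * (Cmod X * p) ^ k)%R by (rewrite Rpow_mult_distr; ring).
    apply Rmult_le_compat_l; auto. apply pow_incr. split; [apply Rmult_le_pos; lra |].
    apply Rle_trans with (2 := HX). apply Rmult_le_compat_l; lra.
Qed.

Lemma X_csum (a : fps) K p :
  (0 <= p <= rho)%R -> (0 <= K)%R -> (forall k, (Cmod (a k) <= K * p ^ k)%R) ->
  csum (fun k => X ^ k * a k) (Csum (fun k => X ^ k * a k)).
Proof.
  intros Hp HK Ha. apply Csum_correct. apply csum_geom_ex with K (1 / 2)%R; [lra |].
  intros k. now apply X_term with p.
Qed.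

Definition solb (y : C * C) : R := (Cmod (fst y) + Cmod (snd y))%R.

Lemma solb_pos y : (0 <= solb y)%R.
Proof. unfold solb. pose proof (Cmod_ge_0 (fst y)). pose proof (Cmod_ge_0 (snd y)). lra. Qed.

Lemma sol_bound_rho lam y k :
  (Cmod lam <= 4)%R ->
  (Cmod (fst (sol psi phi lam y k)) <= solb y * rho ^ k /\ Cmod (snd (sol psi phi lam y k)) <= solb y * rho ^ k)%R.
Proof.
  intros Hl. pose proof (Cmod_ge_0 (fst y)). pose proof (Cmod_ge_0 (snd y)).
  apply sol_bound with N M; auto; unfold rho, solb; lra.
Qed.

Definition solX (lam : C) (y : C * C) : C * C :=
  (Csum (fun k => X ^ k * fst (sol psi phi lam y k)), Csum (fun k => X ^ k * snd (sol psi phi lam y k))).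

Lemma solX_csum lam y :
  (Cmod lam <= 4)%R ->
  csum (fun k => X ^ k * fst (sol psi phi lam y k)) (fst (solX lam y)) /\
  csum (fun k => X ^ k * snd (sol psi phi lam y k)) (snd (solX lam y)).
Proof.
  intros Hl. pose proof rho_pos. split.
  - apply (X_csum (fun k => fst (sol psi phi lam y k)) (solb y) rho); [lra | apply solb_pos |]. intros k. now apply sol_bound_rho.
  - apply (X_csum (fun k => snd (sol psi phi lam y k)) (solb y) rho); [lra | apply solb_pos |]. intros k. now apply sol_bound_rho.
Qed.

Lemma Cmod_2Ci z : Cmod (2 * Ci * z) = (2 * Cmod z)%R.
Proof. rewrite !Cmod_mult, Cmod_Ci, Cmod_R, Rabs_pos_eq; lra. Qed.

(* First columns of P: at [X = 0] the interior one is the first column of [G^-1]. *)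
Definition inner (z : C) : C * C := solX (2 * Ci * z) (D, - C0).

Definition outer (z : C) : C * C :=
  (Csum (fun k => X ^ k * out_f (/ z) k), Csum (fun k => X ^ k * out_g (/ z) k)).

Lemma ball_lt (z0 z : C) r s : (Cmod (z - z0) < r)%R -> (Cmod z0 + r <= s)%R -> (Cmod z < s)%R.
Proof.
  intros H1 H2. replace z with ((z - z0) + z0) by ring. eapply Rle_lt_trans; [apply Cmod_triangle | lra].
Qed.

Lemma holo_2Ci U : holo U (fun z => 2 * Ci * z).
Proof. apply holo_mult; [apply holo_const | apply holo_id]. Qed.

Lemma X_series_holo (U : C -> Prop) (h : C -> fps) K p :
  (forall z, U z -> locally z U) -> (0 <= p <= rho)%R -> (0 <= K)%R ->
  (forall k, holo U (fun z => h z k)) -> (forall z k, U z -> (Cmod (h z k) <= K * p ^ k)%R) ->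
  holo U (fun z => Csum (fun k => X ^ k * h z k)).
Proof.
  intros HU Hp HK Hh Hb. apply analytic_holo. intros z0 Hz0.
  destruct (proj1 (locally_Cmod z0 U) (HU z0 Hz0)) as [d [Hd Hball]].
  apply weierstrass with (h := fun k z => X ^ k * h z k) (R0 := d) (K := K) (q := (1 / 2)%R); auto; [lra | | |].
  - intros k. apply holo_mult; [apply holo_const |]. now apply holo_sub with (2 := Hh k).
  - intros k z Hz. apply X_term with p; auto.
  - intros z Hz. apply X_csum with K p; auto.
Qed.

Lemma inner_holo :
  holo (fun z => Cmod z < 2)%R (fun z => fst (inner z)) /\ holo (fun z => Cmod z < 2)%R (fun z => snd (inner z)).
Proof.
  pose proof rho_pos.
  assert (Hb : forall z, (Cmod z < 2)%R -> (Cmod (2 * Ci * z) <= 4)%R) by (intros z Hz; rewrite Cmod_2Ci; lra).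
  assert (Hs := fun k => holo_sol (fun z => Cmod z < 2)%R psi phi (fun z => 2 * Ci * z) (fun _ => (D, - C0)) k (holo_2Ci _) (holo_const _ D) (holo_const _ (- C0))).
  split.
  - apply (X_series_holo _ (fun z k => fst (sol psi phi (2 * Ci * z) (D, - C0) k)) (solb (D, - C0)) rho); [| lra | apply solb_pos | |].
    + intros z. apply locally_Cmod_lt.
    + intros k. exact (proj1 (Hs k)).
    + intros z k Hz. exact (proj1 (sol_bound_rho _ _ k (Hb z Hz))).
  - apply (X_series_holo _ (fun z k => snd (sol psi phi (2 * Ci * z) (D, - C0) k)) (solb (D, - C0)) rho); [| lra | apply solb_pos | |].
    + intros z. apply locally_Cmod_lt.
    + intros k. exact (proj2 (Hs k)).
    + intros z k Hz. exact (proj2 (sol_bound_rho _ _ k (Hb z Hz))).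
Qed.

Lemma Cmod_inv_le_2 (z : C) : (1 / 2 < Cmod z)%R -> z <> 0 /\ / z <> 0 /\ (Cmod (/ z) <= 2)%R.
Proof.
  intros Hz. assert (H0 : z <> 0) by (apply Cmod_gt_0; lra). split; [auto | split].
  - intros E. apply C1_nz. rewrite <- (Cinv_r z H0), E. ring.
  - rewrite Cmod_inv by auto. replace 2%R with (/ (1 / 2))%R by field. apply Rinv_le_contravar; lra.
Qed.

(** Solutions of the X-equation are determined by their value at X = 0. Each X-coefficient of the
    exterior column is thus a polynomial in z and exp(4i/z), which gives its holomorphy and makes it
    comparable with the interior column. *)
Lemma out_eq_sol z k :
  (1 / 2 < Cmod z)%R ->
  sol psi phi (2 * Ci * z) (A * D - B * C0 * Cexp (4 * Ci * / z), - (A * C0) + A * C0 * Cexp (4 * Ci * / z)) k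
  = (out_f (/ z) k, out_g (/ z) k).
Proof.
  intros Hz. destruct (Cmod_inv_le_2 z Hz) as [H0 [H1 H2]].
  destruct (out_0 (/ z) H2) as [E1 E2]. rewrite <- E1, <- E2.
  apply sol_unique. replace (2 * Ci * z) with (2 * Ci / / z) by (field; auto). now apply out_is_sol.
Qed.

Lemma outer_csum z :
  (1 / 2 < Cmod z)%R ->
  csum (fun k => X ^ k * out_f (/ z) k) (fst (outer z)) /\ csum (fun k => X ^ k * out_g (/ z) k) (snd (outer z)).
Proof.
  intros Hz. destruct (Cmod_inv_le_2 z Hz) as [H0 [H1 H2]]. pose proof outK_pos.
  split.
  - apply (X_csum (out_f (/ z)) (2 * outK) (2 * M)); [unfold rho; lra | lra |]. intros k. exact (proj1 (out_bound _ k H2)).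
  - apply (X_csum (out_g (/ z)) (2 * outK) (2 * M)); [unfold rho; lra | lra |]. intros k. exact (proj2 (out_bound _ k H2)).
Qed.

Lemma outer_holo :
  holo (fun z => 1 / 2 < Cmod z)%R (fun z => fst (outer z)) /\ holo (fun z => 1 / 2 < Cmod z)%R (fun z => snd (outer z)).
Proof.
  pose proof outK_pos. set (U := fun z => (1 / 2 < Cmod z)%R).
  assert (HU : forall z, U z -> locally z U) by (intros z; apply locally_Cmod_gt).
  assert (He : holo U (fun z => Cexp (4 * Ci * / z))).
  { apply (holo_comp _ (fun _ => True) Cexp (fun z => 4 * Ci * / z)); [auto | | apply holo_Cexp].
    apply holo_mult; [apply holo_const |]. apply holo_inv; [| apply holo_id]. intros z Hz. now apply Cmod_inv_le_2. }
  assert (Hs : forall k, holo U (fun z => out_f (/ z) k) /\ holo U (fun z => out_g (/ z) k)).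
  { intros k.
    destruct (holo_sol U psi phi (fun z => 2 * Ci * z)
      (fun z => (A * D - B * C0 * Cexp (4 * Ci * / z), - (A * C0) + A * C0 * Cexp (4 * Ci * / z))) k) as [S1 S2].
    - apply holo_2Ci.
    - apply holo_minus; [apply holo_const |]. apply holo_mult; [apply holo_const | auto].
    - apply holo_plus; [apply holo_const |]. apply holo_mult; [apply holo_const | auto].
    - split; [apply holo_ext with (3 := S1) | apply holo_ext with (3 := S2)]; auto; intros z Hz; now rewrite out_eq_sol by auto. }
  split; apply X_series_holo with (2 * outK)%R (2 * M)%R; try (unfold rho; lra); auto.
  - intros k. exact (proj1 (Hs k)).
  - intros z k Hz. exact (proj1 (out_bound _ k (proj2 (proj2 (Cmod_inv_le_2 _ Hz))))).
  - intros k. exact (proj2 (Hs k)).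
  - intros z k Hz. exact (proj2 (out_bound _ k (proj2 (proj2 (Cmod_inv_le_2 _ Hz))))).
Qed.

(** Cutting the expansion at order n costs O(|z|^-n), uniformly enough in k to be summed over the
    powers of X. *)
Lemma outer_tail (a : nat -> fps) (F : C -> fps) n z :
  (forall m, fbound (a m) ((12 * N) ^ m / INR (fact m)) (2 * M)) ->
  (forall k, (1 < Cmod z)%R -> csum (fun m => (/ z) ^ m * a m k) (F (/ z) k)) ->
  (1 < Cmod z)%R ->
  forall l s, csum (fun k => X ^ k * F (/ z) k) l -> csum (fun k => X ^ k * psum (fun m => (/ z) ^ m * a m k) n) s ->
  (Cmod (l - s) <= 4 * outK * (/ Cmod z) ^ n)%R.
Proof.
  intros Ha HF Hz l s Hl Hs. pose proof outK_pos.
  assert (H0 : z <> 0) by (apply Cmod_gt_0; lra).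
  assert (Hi : (Cmod (/ z) <= 1)%R).
  { rewrite Cmod_inv by auto. rewrite <- Rinv_1. apply Rinv_le_contravar; lra. }
  rewrite <- Cmod_inv by auto.
  replace (4 * outK * Cmod (/ z) ^ n)%R with (2 * outK * Cmod (/ z) ^ n / (1 - 1 / 2))%R by field.
  apply (csum_bound (fun k => X ^ k * F (/ z) k - X ^ k * psum (fun m => (/ z) ^ m * a m k) n)); [lra | | now apply csum_minus].
  intros k. replace (X ^ k * F (/ z) k - X ^ k * psum (fun m => (/ z) ^ m * a m k) n) with (X ^ k * (F (/ z) k - psum (fun m => (/ z) ^ m * a m k) n)) by ring.
  assert (0 <= Cmod (/ z) ^ n)%R by apply pow_le, Cmod_ge_0.
  apply (X_term (fun k => F (/ z) k - psum (fun m => (/ z) ^ m * a m k) n) _ (2 * M)); try (unfold rho; lra).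
  - apply Rmult_le_pos; lra.
  - replace (2 * outK * Cmod (/ z) ^ n * (2 * M) ^ k)%R with (2 * outK * (2 * M) ^ k * Cmod (/ z) ^ n)%R by ring.
    apply out_tail; auto.
Qed.

Lemma csum_cst_1 : csum (fun k => X ^ k * cst 1 k) 1.
Proof.
  intros eps He. exists 1%nat. intros n Hn.
  replace (psum (fun k => X ^ k * cst 1 k) n) with (RtoC 1); [replace (1 - 1) with (RtoC 0) by ring; now rewrite Cmod_0 |].
  induction Hn; [simpl; ring |]. simpl psum. rewrite <- IHHn. destruct m; [lia | simpl; ring].
Qed.

Lemma tends_inv_infty : tends C_infty (fun z => / z) 0.
Proof.
  intros e Hee. exists (/ e)%R. intros z Hz. assert (0 < / e)%R by now apply Rinv_0_lt_compat.
  rewrite Cmod_minus_0, Cmod_inv by (apply Cmod_gt_0; lra).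
  rewrite <- (Rinv_inv e). apply Rinv_lt_contravar; auto. apply Rmult_lt_0_compat; lra.
Qed.

Lemma tends_infty_of_bound (F : C -> C) l K :
  (forall z, (1 < Cmod z)%R -> (Cmod (F z - l) <= K * / Cmod z)%R) -> tends C_infty F l.
Proof.
  intros HF eps He. exists (Rmax 1 ((Rabs K + 1) / eps)). intros z Hz.
  pose proof (Rle_lt_trans _ _ _ (Rmax_l _ _) Hz) as H1. pose proof (Rle_lt_trans _ _ _ (Rmax_r _ _) Hz) as H2.
  apply Rle_lt_trans with (1 := HF z H1).
  apply Rmult_lt_reg_r with (Cmod z); [lra |]. rewrite Rmult_assoc, Rinv_l by lra.
  apply Rmult_lt_compat_l with (r := eps) in H2; auto.
  replace (eps * ((Rabs K + 1) / eps))%R with (Rabs K + 1)%R in H2 by (field; lra).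
  pose proof (Rle_abs K). lra.
Qed.

Lemma outer_infty :
  tends C_infty (fun z => fst (outer z)) 1 /\
  tends C_infty (fun z => z * snd (outer z)) (Csum (fun k => X ^ k * g 1 k)).
Proof.
  pose proof outK_pos.
  assert (Hinv : forall z, (1 < Cmod z)%R -> (Cmod (/ z) <= 2)%R) by (intros z Hz; apply Cmod_inv_le_2; lra).
  assert (Hhalf : forall z, (1 < Cmod z)%R -> (1 / 2 < Cmod z)%R) by (intros z Hz; lra).
  split.
  - apply tends_infty_of_bound with (4 * outK)%R. intros z Hz.
    rewrite <- (pow_1 (/ Cmod z)).
    refine (outer_tail f out_f 1 z f_bound (fun k _ => out_f_csum _ k (Hinv z Hz)) Hz _ _ (proj1 (outer_csum z (Hhalf z Hz))) _).
    apply csum_ext with (2 := csum_cst_1). intros k. unfold f. simpl. ring.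
  - apply tends_infty_of_bound with (4 * outK)%R. intros z Hz.
    assert (H0 : z <> 0) by (apply Cmod_gt_0; lra).
    replace (z * snd (outer z) - Csum (fun k => X ^ k * g 1 k)) with (z * (snd (outer z) - / z * Csum (fun k => X ^ k * g 1 k))) by (field; auto).
    rewrite Cmod_mult. replace (4 * outK * / Cmod z)%R with (Cmod z * (4 * outK * (/ Cmod z) ^ 2))%R by (field; lra).
    apply Rmult_le_compat_l; [lra |].
    (* Two orders are kept because the prefactor z consumes one of them. *)
    refine (outer_tail g out_g 2 z g_bound (fun k _ => out_g_csum _ k (Hinv z Hz)) Hz _ _ (proj2 (outer_csum z (Hhalf z Hz))) _).
    apply csum_ext with (fun k => / z * (X ^ k * g 1 k)).
    + intros k. simpl psum. replace (g 0 k) with (RtoC 0) by (unfold g; simpl; destruct k; reflexivity). ring.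
    + apply csum_scal. apply X_csum with ((12 * N) ^ 1 / INR (fact 1))%R (2 * M)%R; [unfold rho; lra | | apply g_bound].
      simpl. lra.
Qed.

Lemma outer_infty_snd : tends C_infty (fun z => snd (outer z)) 0.
Proof.
  assert (FF : Filter C_infty) by apply filter_filter.
  apply tends_ext_loc with (fun z => / z * (z * snd (outer z))); [auto | |].
  - exists 1%R. intros z Hz. assert (H0 : z <> 0) by (apply Cmod_gt_0; lra). field. auto.
  - replace (RtoC 0) with (0 * Csum (fun k => X ^ k * g 1 k)) by ring.
    apply tends_mult; auto; [apply tends_inv_infty | apply outer_infty].
Qed.

Lemma phi_residue L : csum (fun k => X ^ k * phi k) L -> L = - (2 * Ci) * Csum (fun k => X ^ k * g 1 k).
Proof.
  intros H. apply (csum_unique _ _ _ H).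
  apply csum_ext with (fun k => - (2 * Ci) * (X ^ k * g 1 k)).
  - intros k. rewrite (fg_snd_1 psi phi nn al be HL). unfold fopp. rewrite !cst_mul. unfold g. ring.
  - apply csum_scal. apply X_csum with ((12 * N) ^ 1 / INR (fact 1))%R (2 * M)%R; [unfold rho; lra | | apply g_bound].
    simpl. lra.
Qed.

(** Linearity in the initial data: the exterior value at X = 0 is A (D, -C0) + C0 e^(4i/z) (-B, A),
    a combination of the two columns of G^-1, and the X-equation propagates this relation. *)
Lemma outer_jump z :
  (1 / 2 < Cmod z < 2)%R ->
  let w2 := solX (2 * Ci * z) (- B, A) in
  fst (outer z) = A * fst (inner z) + C0 * Cexp (4 * Ci * / z) * fst w2 /\
  snd (outer z) = A * snd (inner z) + C0 * Cexp (4 * Ci * / z) * snd w2.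
Proof.
  intros Hz w2. assert (Hl : (Cmod (2 * Ci * z) <= 4)%R) by (rewrite Cmod_2Ci; lra).
  pose (e := C0 * Cexp (4 * Ci * / z)).
  assert (Hlin : forall k, (out_f (/ z) k, out_g (/ z) k) =
     (A * fst (sol psi phi (2 * Ci * z) (D, - C0) k) + e * fst (sol psi phi (2 * Ci * z) (- B, A) k),
      A * snd (sol psi phi (2 * Ci * z) (D, - C0) k) + e * snd (sol psi phi (2 * Ci * z) (- B, A) k))).
  { intros k. rewrite <- out_eq_sol by lra.
    pose proof (sol_unique _ _ _ _ _ (is_sol_lin _ _ _ _ _ _ _ A e (sol_is_sol psi phi (2 * Ci * z) (D, - C0)) (sol_is_sol psi phi (2 * Ci * z) (- B, A))) k) as E.
    unfold fadd in E. rewrite !cst_mul in E. rewrite <- E. f_equal. unfold sol, hrec. simpl. unfold e.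
    apply injective_projections; simpl fst; simpl snd; ring. }
  destruct (outer_csum z ltac:(lra)) as [O1 O2].
  destruct (solX_csum (2 * Ci * z) (D, - C0) Hl) as [I1 I2].
  destruct (solX_csum (2 * Ci * z) (- B, A) Hl) as [J1 J2].
  split.
  - apply (csum_unique _ _ _ O1). eapply csum_ext; [| exact (csum_plus _ _ _ _ (csum_scal A _ _ I1) (csum_scal e _ _ J1))].
    intros k. simpl. pose proof (f_equal fst (Hlin k)) as E. simpl in E. rewrite E. ring.
  - apply (csum_unique _ _ _ O2). eapply csum_ext; [| exact (csum_plus _ _ _ _ (csum_scal A _ _ I2) (csum_scal e _ _ J2))].
    intros k. simpl. pose proof (f_equal snd (Hlin k)) as E. simpl in E. rewrite E. ring.
Qed.

End Column.

(** Rewrites the solution started at the second column of G^-1 in the normalisation of that column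
    of P. The factor exp(lam X) is the X-dependent part of the jump exponential; on coefficients it
    is a Cauchy product with the exponential series. *)
Lemma solX_swap psi phi N M X lam y :
  (1 <= N)%R -> (1 <= M)%R -> fbound psi N M -> fbound phi N M -> (Cmod X * rho N M <= 1 / 2)%R -> (Cmod lam <= 4)%R ->
  solX psi phi X lam (snd y, fst y) =
  (Cexp (lam * X) * snd (solX phi psi X (- lam) y), Cexp (lam * X) * fst (solX phi psi X (- lam) y)).
Proof.
  intros HN HM Bpsi Bphi HX Hl.
  assert (Hl' : (Cmod (- lam) <= 4)%R) by now rewrite Cmod_opp.
  pose (e := (fun k => lam ^ k * / INR (fact k)) : fps).
  pose (F := (fun k => fst (sol phi psi (- lam) y k)) : fps).
  pose (G := (fun k => snd (sol phi psi (- lam) y k)) : fps).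
  assert (He : fD e = (- (cst (- lam) * e))%fps).
  { apply functional_extensionality. intros k. unfold fopp. rewrite cst_mul. unfold fD, e.
    rewrite fact_simpl, mult_INR, RtoC_mult. simpl Cpow. field. split; [apply INR_fact_neq_C | apply INR_S_neq_0]. }
  assert (Hs : is_sol psi phi lam (e * G)%fps (e * F)%fps).
  { replace lam with (- - lam) by ring. apply is_sol_swap; auto. apply sol_is_sol. }
  assert (Hk : forall k, sol psi phi lam (snd y, fst y) k = (conv e G k, conv e F k)).
  { intros k. refine (eq_trans _ (sol_unique _ _ _ _ _ Hs k)). f_equal. unfold fmul, e, F, G, sol, hrec. simpl.
    apply injective_projections; simpl fst; simpl snd; field; apply C1_nz. }
  assert (Hrho : (0 < rho N M)%R) by (unfold rho; lra).
  destruct (solX_csum phi psi N M HN HM Bphi Bpsi X HX (- lam) y Hl') as [S1 S2].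
  assert (HE : csum (fun k => X ^ k * e k) (Cexp (lam * X))).
  { apply csum_ext with (2 := csum_Cexp (lam * X)). intros k. unfold e. rewrite Cpow_mult_l. ring. }
  assert (BE : forall k, (Cmod (X ^ k * e k) <= exp (Cmod (lam * X) / (1 / 2)) * (1 / 2) ^ k)%R).
  { intros k. replace (X ^ k * e k) with ((lam * X) ^ k * / INR (fact k)) by (unfold e; rewrite Cpow_mult_l; ring).
    rewrite Cmod_mult, Cmod_pow, Cmod_inv, Cmod_R, Rabs_pos_eq by (try apply pos_INR; apply INR_fact_neq_C).
    apply pow_fact_geom; [apply Cmod_ge_0 | lra]. }
  assert (BF : forall k, (Cmod (X ^ k * F k) <= solb y * (1 / 2) ^ k)%R).
  { intros k. apply (X_term N M X HX F _ (rho N M)); [lra | apply solb_pos |].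
    apply (sol_bound_rho phi psi N M HN HM Bphi Bpsi); auto. }
  assert (BG : forall k, (Cmod (X ^ k * G k) <= solb y * (1 / 2) ^ k)%R).
  { intros k. apply (X_term N M X HX G _ (rho N M)); [lra | apply solb_pos |].
    apply (sol_bound_rho phi psi N M HN HM Bphi Bpsi); auto. }
  assert (half : (0 <= 1 / 2 < 1)%R) by lra.
  unfold solX at 1. f_equal; apply Csum_eq.
  - apply csum_ext with (conv (fun k => X ^ k * e k) (fun k => X ^ k * G k)).
    + intros k. rewrite Hk. simpl fst. now rewrite conv_weight.
    + exact (csum_conv _ _ _ _ _ _ _ half BE BG HE S2).
  - apply csum_ext with (conv (fun k => X ^ k * e k) (fun k => X ^ k * F k)).
    + intros k. rewrite Hk. simpl snd. now rewrite conv_weight.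
    + exact (csum_conv _ _ _ _ _ _ _ half BE BF HE S1).
Qed.

(** * Rows of solutions of the Riemann-Hilbert problem *)

(** The jump acts from the right, so each row of P solves the problem by itself and is fixed by its
    limit (a, b) at infinity. *)
Record row_sol (V : C -> mat2) (xm ym xp yp : C -> C) (a b : C) : Prop := {
  rs_xm : holo (fun z => Cmod z < 1)%R xm;
  rs_ym : holo (fun z => Cmod z < 1)%R ym;
  rs_xp : holo (fun z => 1 < Cmod z)%R xp;
  rs_yp : holo (fun z => 1 < Cmod z)%R yp;
  rs_cxm : cont_within (fun z => Cmod z <= 1)%R xm;
  rs_cym : cont_within (fun z => Cmod z <= 1)%R ym;
  rs_cxp : cont_within (fun z => 1 <= Cmod z)%R xp;
  rs_cyp : cont_within (fun z => 1 <= Cmod z)%R yp;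
  rs_x : forall z, Cmod z = 1%R -> xp z = xm z * entry (V z) 0 0 + ym z * entry (V z) 1 0;
  rs_y : forall z, Cmod z = 1%R -> yp z = xm z * entry (V z) 0 1 + ym z * entry (V z) 1 1;
  rs_a : tends C_infty xp a;
  rs_b : tends C_infty yp b }.

Lemma cont_within_minus Dm f g : cont_within Dm f -> cont_within Dm g -> cont_within Dm (fun z => f z - g z).
Proof. intros Hf Hg z Hz. apply tends_minus; auto. apply within_filter, locally_filter. Qed.

(* The jump has determinant 1, so the Wronskian of two rows extends across the circle. *)
Lemma row_wronskian V xm ym xp yp a b xm' ym' xp' yp' a' b' :
  (forall z, Cmod z = 1%R -> entry (V z) 0 0 * entry (V z) 1 1 - entry (V z) 0 1 * entry (V z) 1 0 = 1) ->
  row_sol V xm ym xp yp a b -> row_sol V xm' ym' xp' yp' a' b' ->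
  forall w, (1 < Cmod w)%R -> xp w * yp' w - yp w * xp' w = a * b' - b * a'.
Proof.
  intros HV R1 R2.
  apply (glue (fun z => xm z * ym' z - ym z * xm' z) (fun z => xp z * yp' z - yp z * xp' z)).
  - apply holo_minus; apply holo_mult; (apply R1 || apply R2).
  - apply cont_within_minus; apply cont_within_mult; (apply R1 || apply R2).
  - apply holo_minus; apply holo_mult; (apply R1 || apply R2).
  - apply cont_within_minus; apply cont_within_mult; (apply R1 || apply R2).
  - intros z Hz. rewrite (rs_x _ _ _ _ _ _ _ R1), (rs_x _ _ _ _ _ _ _ R2), (rs_y _ _ _ _ _ _ _ R1), (rs_y _ _ _ _ _ _ _ R2) by auto.
    specialize (HV z Hz).
    transitivity ((xm z * ym' z - ym z * xm' z) * (entry (V z) 0 0 * entry (V z) 1 1 - entry (V z) 0 1 * entry (V z) 1 0)); [ring | rewrite HV; ring].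
  - assert (FF : Filter C_infty) by apply filter_filter.
    apply tends_minus; auto; apply tends_mult; auto; (apply R1 || apply R2).
Qed.

Lemma entry_mul2 P Q i j :
  (i < 2)%nat -> (j < 2)%nat -> entry (mul2 P Q) i j = entry P i 0 * entry Q 0 j + entry P i 1 * entry Q 1 j.
Proof.
  intros Hi Hj. unfold entry, mul2, Mmult. rewrite coeff_mat_bij by auto. simpl pred.
  rewrite sum_Sn, sum_O. reflexivity.
Qed.

Lemma analytic_at_ext_loc f g z : locally z (fun w => f w = g w) -> analytic_at f z -> analytic_at g z.
Proof.
  intros E [c [r [Hr H]]]. apply locally_Cmod in E. destruct E as [d [Hd E]].
  exists c, (Rmin r d). split; [now apply Rmin_pos |]. intros w _ Hw.
  rewrite <- E by (eapply Rlt_le_trans; [exact Hw | apply Rmin_r]).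
  apply H; auto. eapply Rlt_le_trans; [exact Hw | apply Rmin_l].
Qed.

Lemma holo_open_analytic (U : C -> Prop) f z : locally z U -> holo U f -> analytic_at f z.
Proof.
  intros HU Hf. apply locally_Cmod in HU. destruct HU as [d [Hd HU]].
  apply holo_analytic with d; auto. now apply holo_sub with U.
Qed.

Lemma rows_rhp X T G x1m x2m x1p x2p y1m y2m y1p y2p :
  row_sol (jump X T G) x1m x2m x1p x2p 1 0 -> row_sol (jump X T G) y1m y2m y1p y2p 0 1 ->
  is_RHP_solution X T G (fun z => if Rlt_dec (Cmod z) 1 then mk2 (x1m z) (x2m z) (y1m z) (y2m z) else mk2 (x1p z) (x2p z) (y1p z) (y2p z)).
Proof.
  intros R1 R2. set (P := fun z => if Rlt_dec (Cmod z) 1 then _ else _).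
  pose (Pm := fun z => mk2 (x1m z) (x2m z) (y1m z) (y2m z)). pose (Pp := fun z => mk2 (x1p z) (x2p z) (y1p z) (y2p z)).
  assert (Em : forall z, (Cmod z < 1)%R -> Pm z = P z) by (intros z Hz; unfold P; destruct (Rlt_dec (Cmod z) 1); [reflexivity | lra]).
  assert (Ep : forall z, (1 < Cmod z)%R -> Pp z = P z) by (intros z Hz; unfold P; destruct (Rlt_dec (Cmod z) 1); [lra | reflexivity]).
  split; [| split].
  - intros z Hz i j Hi Hj. destruct (Rlt_dec (Cmod z) 1) as [L | L].
    + apply analytic_at_ext_loc with (fun w => entry (Pm w) i j).
      * generalize (locally_Cmod_lt 1 z L). apply filter_imp. intros w Hw. now rewrite Em.
      * apply holo_open_analytic with (1 := locally_Cmod_lt 1 z L).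
        destruct i as [| [| i]], j as [| [| j]]; try lia; (apply R1 || apply R2).
    + assert (L' : (1 < Cmod z)%R) by lra. apply analytic_at_ext_loc with (fun w => entry (Pp w) i j).
      * generalize (locally_Cmod_gt 1 z L'). apply filter_imp. intros w Hw. now rewrite Ep.
      * apply holo_open_analytic with (1 := locally_Cmod_gt 1 z L').
        destruct i as [| [| i]], j as [| [| j]]; try lia; (apply R1 || apply R2).
  - exists Pm, Pp. repeat split; auto.
    + intros i j Hi Hj. apply cont_within_continuous_on. destruct i as [| [| i]], j as [| [| j]]; try lia; (apply R1 || apply R2).
    + intros i j Hi Hj. apply cont_within_continuous_on. destruct i as [| [| i]], j as [| [| j]]; try lia; (apply R1 || apply R2).
    + intros z Hz. apply (coeff_mat_ext_aux (m := 2) (n := 2) (RtoC 0) (RtoC 0)). intros i j Hi Hj.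
      change (entry (Pp z) i j = entry (mul2 (Pm z) (jump X T G z)) i j). rewrite entry_mul2 by auto.
      destruct i as [| [| i]], j as [| [| j]]; try lia.
      * now apply (rs_x _ _ _ _ _ _ _ R1).
      * now apply (rs_y _ _ _ _ _ _ _ R1).
      * now apply (rs_x _ _ _ _ _ _ _ R2).
      * now apply (rs_y _ _ _ _ _ _ _ R2).
  - intros i j Hi Hj. apply tends_filterlim; [apply filter_filter |].
    apply tends_ext_loc with (fun z => entry (Pp z) i j); [apply filter_filter | |].
    + exists 1%R. intros z Hz. now rewrite Ep.
    + destruct i as [| [| i]], j as [| [| j]]; try lia; (apply R1 || apply R2).
Qed.

(** [Psi] involves P_12 alone, so an arbitrary solution is only compared through its first row. *)
Lemma rhp_first_row X T G P :
  is_RHP_solution X T G P ->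
  exists xm ym xp yp, row_sol (jump X T G) xm ym xp yp 1 0 /\ forall z, (1 < Cmod z)%R -> entry (P z) 0 1 = yp z.
Proof.
  intros [Han [[Pm [Pp [Em [Cm [Ep [Cp HJ]]]]]] Hinf]].
  assert (Hm : forall j, (j < 2)%nat -> holo (fun z => Cmod z < 1)%R (fun z => entry (Pm z) 0 j)).
  { intros j Hj. apply holo_ext with (fun z => entry (P z) 0 j).
    - intros z. apply locally_Cmod_lt.
    - intros z Hz. now rewrite Em.
    - apply analytic_holo. intros z Hz. apply Han; auto. lra. }
  assert (Hp : forall j, (j < 2)%nat -> holo (fun z => 1 < Cmod z)%R (fun z => entry (Pp z) 0 j)).
  { intros j Hj. apply holo_ext with (fun z => entry (P z) 0 j).
    - intros z. apply locally_Cmod_gt.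
    - intros z Hz. now rewrite Ep.
    - apply analytic_holo. intros z Hz. apply Han; auto. lra. }
  assert (Hl : forall j l, (j < 2)%nat -> entry id2 0 j = l -> tends C_infty (fun z => entry (Pp z) 0 j) l).
  { intros j l Hj <-. apply tends_ext_loc with (fun z => entry (P z) 0 j).
    - apply filter_filter.
    - exists 1%R. intros z Hz. now rewrite Ep.
    - apply tends_filterlim; [apply filter_filter |]. apply Hinf; lia. }
  exists (fun z => entry (Pm z) 0 0), (fun z => entry (Pm z) 0 1), (fun z => entry (Pp z) 0 0), (fun z => entry (Pp z) 0 1).
  split; [| intros z Hz; now rewrite Ep].
  split; try (apply Hm; lia); try (apply Hp; lia); try (apply cont_within_continuous_on; (apply Cm || apply Cp); lia).
  - intros z Hz. rewrite HJ by auto. apply entry_mul2; lia.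
  - intros z Hz. rewrite HJ by auto. apply entry_mul2; lia.
  - apply Hl; [lia | reflexivity].
  - apply Hl; [lia | reflexivity].
Qed.

(** At T = 0 the phase is odd in z: the exponential of the upper right entry is that of the lower
    left one at -z. This makes the column symmetry compatible with the jump. *)
Lemma entry_jump X (A B C0 D z : C) (x : R) : X = RtoC x ->
  let J := jump x 0 (mk2 A B C0 D) z in
  let e := Cexp (4 * Ci * / z) * Cexp (2 * Ci * z * X) in
  z <> 0 ->
  entry J 0 0 = A /\ entry J 1 1 = D /\ entry J 1 0 = C0 * e /\ entry J 0 1 = B * (Cexp (4 * Ci * / - z) * Cexp (2 * Ci * - z * X)) /\
  entry J 0 0 * entry J 1 1 - entry J 0 1 * entry J 1 0 = A * D - B * C0.
Proof.
  intros -> J e Hz.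
  assert (E4 : RtoC 4 = 2 * 2) by (rewrite <- RtoC_mult; apply f_equal; lra).
  assert (J00 : entry J 0 0 = A).
  { unfold J, jump. rewrite !entry_mul2 by lia. unfold exp_sigma3, mk2, entry. rewrite !coeff_mat_bij by lia.
    set (p := Ci * phase x 0 z). transitivity (A * (Cexp (- p) * Cexp p)); [ring |].
    rewrite <- Cexp_plus. replace (- p + p) with (RtoC 0) by ring. rewrite Cexp_0. ring. }
  assert (J11 : entry J 1 1 = D).
  { unfold J, jump. rewrite !entry_mul2 by lia. unfold exp_sigma3, mk2, entry. rewrite !coeff_mat_bij by lia.
    set (p := Ci * phase x 0 z). transitivity (D * (Cexp (- - p) * Cexp (- p))); [ring |].
    rewrite <- Cexp_plus. replace (- - p + - p) with (RtoC 0) by ring. rewrite Cexp_0. ring. }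
  assert (J10 : entry J 1 0 = C0 * e).
  { unfold J, jump. rewrite !entry_mul2 by lia. unfold exp_sigma3, mk2, entry. rewrite !coeff_mat_bij by lia.
    transitivity (C0 * (Cexp (- - (Ci * phase x 0 z)) * Cexp (Ci * phase x 0 z))); [ring |].
    unfold e. rewrite <- !Cexp_plus. do 2 f_equal. unfold phase. rewrite E4. field. auto. }
  assert (J01 : entry J 0 1 = B * (Cexp (4 * Ci * / - z) * Cexp (2 * Ci * - z * RtoC x))).
  { unfold J, jump. rewrite !entry_mul2 by lia. unfold exp_sigma3, mk2, entry. rewrite !coeff_mat_bij by lia.
    transitivity (B * (Cexp (- (Ci * phase x 0 z)) * Cexp (- (Ci * phase x 0 z)))); [ring |].
    rewrite <- !Cexp_plus. do 2 f_equal. unfold phase. rewrite E4. field. auto. }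
  repeat split; auto. rewrite J00, J11, J10, J01. unfold e.
  transitivity (A * D - B * C0 * (Cexp (4 * Ci * / - z) * Cexp (2 * Ci * - z * RtoC x) * (Cexp (4 * Ci * / z) * Cexp (2 * Ci * z * RtoC x)))); [ring |].
  rewrite <- !Cexp_plus.
  replace (4 * Ci * / - z + 2 * Ci * - z * RtoC x + (4 * Ci * / z + 2 * Ci * z * RtoC x)) with (RtoC 0) by (field; auto).
  rewrite Cexp_0. ring.
Qed.

Lemma tends_infty_opp f l : tends C_infty f l -> tends C_infty (fun z => f (- z)) l.
Proof.
  intros H eps He. destruct (H eps He) as [K HK]. exists K. intros z Hz. apply HK. now rewrite Cmod_opp.
Qed.

Lemma holo_opp_arg (U : C -> Prop) f :
  (forall z, U z -> U (- z)) -> holo U f -> holo U (fun z => f (- z)).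
Proof. intros HU Hf. apply holo_comp with U; auto. apply holo_opp, holo_id. Qed.

(** Both factors continue across the circle, to the common annulus 1/2 < |z| < 2, so the continuity
    of the boundary values is inherited from holomorphy. *)
Lemma row_sol_intro V xm ym xp yp a b :
  holo (fun z => Cmod z < 2)%R xm -> holo (fun z => Cmod z < 2)%R ym ->
  holo (fun z => 1 / 2 < Cmod z)%R xp -> holo (fun z => 1 / 2 < Cmod z)%R yp ->
  (forall z, Cmod z = 1%R -> xp z = xm z * entry (V z) 0 0 + ym z * entry (V z) 1 0 /\
    yp z = xm z * entry (V z) 0 1 + ym z * entry (V z) 1 1) ->
  tends C_infty xp a -> tends C_infty yp b -> row_sol V xm ym xp yp a b.
Proof.
  intros Hxm Hym Hxp Hyp HJ Ha Hb.
  split; try (intros z Hz; now apply HJ); auto; try apply cont_within_holo;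
  (apply holo_sub with (2 := Hxm) || apply holo_sub with (2 := Hym) || apply holo_sub with (2 := Hxp) || apply holo_sub with (2 := Hyp));
  intros z Hz; simpl in Hz; lra.
Qed.

(** The explicit solution serves twice: it is the witness that turns [epsilon] into a genuine
    solution, and it is the reference whose Wronskians with that solution determine P_12. *)
Lemma Psi_eq (A B C0 D : C) (psi phi nn al be : fps) (N M : R) (x : R) :
  A * D - B * C0 = 1 -> lax psi phi nn al be ->
  nn O = A * D + B * C0 -> al O = 2 * (B * D) -> be O = - (2 * (A * C0)) ->
  (1 <= N)%R -> (1 <= M)%R -> fbound psi N M -> fbound phi N M -> fbound nn N M -> fbound al N M -> fbound be N M ->
  (Rabs x * rho N M <= 1 / 2)%R ->
  csum (fun k => RtoC x ^ k * psi k) (Psi x 0 (mk2 A B C0 D)).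
Proof.
  intros Hdet HL Hnn Hal Hbe HN HM Bpsi Bphi Bnn Bal Bbe Hx.
  assert (HX : (Cmod (RtoC x) * rho N M <= 1 / 2)%R) by now rewrite Cmod_R.
  set (X := RtoC x) in *.
  assert (HL' := lax_swap _ _ _ _ _ HL).
  assert (Bopp : forall a, fbound a N M -> fbound (- a)%fps N M) by (intros a Ha k; unfold fopp; rewrite Cmod_opp; auto).
  assert (Hdet' : D * A - C0 * B = 1) by (rewrite <- Hdet; ring).
  assert (Hnn' : nn O = D * A + C0 * B) by (rewrite Hnn; ring).
  assert (Hal' : (- be)%fps O = 2 * (C0 * A)) by (unfold fopp; rewrite Hbe; ring).
  assert (Hbe' : (- al)%fps O = - (2 * (D * B))) by (unfold fopp; rewrite Hal; ring).
  pose (i1 := inner C0 D psi phi X). pose (i2 := inner B A phi psi X).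
  pose (o1 := outer nn al be X). pose (o2 := outer nn (- be)%fps (- al)%fps X).
  destruct (inner_holo C0 D psi phi N M HN HM Bpsi Bphi X HX) as [Hi1f Hi1s].
  destruct (inner_holo B A phi psi N M HN HM Bphi Bpsi X HX) as [Hi2f Hi2s].
  destruct (outer_holo A B C0 D Hdet psi phi nn al be HL Hnn Hal Hbe N M HN HM Bnn Bal Bbe X HX) as [Ho1f Ho1s].
  destruct (outer_holo D C0 B A Hdet' phi psi nn _ _ HL' Hnn' Hal' Hbe' N M HN HM Bnn (Bopp _ Bbe) (Bopp _ Bal) X HX) as [Ho2f Ho2s].
  fold i1 in Hi1f, Hi1s. fold i2 in Hi2f, Hi2s. fold o1 in Ho1f, Ho1s. fold o2 in Ho2f, Ho2s.
  apply (holo_opp_arg (fun z => Cmod z < 2)%R (fun z => fst (i2 z))) in Hi2f; [| intros z; now rewrite Cmod_opp].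
  apply (holo_opp_arg (fun z => Cmod z < 2)%R (fun z => snd (i2 z))) in Hi2s; [| intros z; now rewrite Cmod_opp].
  apply (holo_opp_arg (fun z => 1 / 2 < Cmod z)%R (fun z => fst (o2 z))) in Ho2f; [| intros z; now rewrite Cmod_opp].
  apply (holo_opp_arg (fun z => 1 / 2 < Cmod z)%R (fun z => snd (o2 z))) in Ho2s; [| intros z; now rewrite Cmod_opp].
  assert (Hj1 : forall z, Cmod z = 1%R ->
    fst (o1 z) = A * fst (i1 z) + C0 * (Cexp (4 * Ci * / z) * Cexp (2 * Ci * z * X)) * snd (i2 (- z)) /\
    snd (o1 z) = A * snd (i1 z) + C0 * (Cexp (4 * Ci * / z) * Cexp (2 * Ci * z * X)) * fst (i2 (- z))).
  { intros z Hz.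
    assert (Hl : (Cmod (2 * Ci * z) <= 4)%R) by (rewrite Cmod_2Ci; lra).
    assert (Hzz : (1 / 2 < Cmod z < 2)%R) by lra.
    pose proof (outer_jump A B C0 D Hdet psi phi nn al be HL Hnn Hal Hbe N M HN HM Bpsi Bphi Bnn Bal Bbe X HX z Hzz) as HJ.
    cbv zeta in HJ.
    pose proof (solX_swap psi phi N M X (2 * Ci * z) (A, - B) HN HM Bpsi Bphi HX Hl) as HS.
    assert (S1 : fst (solX psi phi X (2 * Ci * z) (- B, A)) = Cexp (2 * Ci * z * X) * snd (solX phi psi X (- (2 * Ci * z)) (A, - B))) by exact (f_equal fst HS).
    assert (S2 : snd (solX psi phi X (2 * Ci * z) (- B, A)) = Cexp (2 * Ci * z * X) * fst (solX phi psi X (- (2 * Ci * z)) (A, - B))) by exact (f_equal snd HS).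
    destruct HJ as [J1 J2]. rewrite S1 in J1. rewrite S2 in J2. fold o1 in J1, J2.
    replace (- (2 * Ci * z)) with (2 * Ci * - z) in J1, J2 by ring.
    split; [rewrite J1 | rewrite J2]; unfold i1, i2, inner; ring. }
  assert (Hj2 : forall z, Cmod z = 1%R ->
    fst (o2 (- z)) = D * fst (i2 (- z)) + B * (Cexp (4 * Ci * / - z) * Cexp (2 * Ci * - z * X)) * snd (i1 z) /\
    snd (o2 (- z)) = D * snd (i2 (- z)) + B * (Cexp (4 * Ci * / - z) * Cexp (2 * Ci * - z * X)) * fst (i1 z)).
  { intros z Hz.
    assert (Hl : (Cmod (2 * Ci * - z) <= 4)%R) by (rewrite Cmod_2Ci, Cmod_opp; lra).
    assert (Hzz : (1 / 2 < Cmod (- z) < 2)%R) by (rewrite Cmod_opp; lra).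
    pose proof (outer_jump D C0 B A Hdet' phi psi nn _ _ HL' Hnn' Hal' Hbe' N M HN HM Bphi Bpsi Bnn (Bopp _ Bbe) (Bopp _ Bal) X HX (- z) Hzz) as HJ.
    cbv zeta in HJ.
    pose proof (solX_swap phi psi N M X (2 * Ci * - z) (D, - C0) HN HM Bphi Bpsi HX Hl) as HS.
    assert (S1 : fst (solX phi psi X (2 * Ci * - z) (- C0, D)) = Cexp (2 * Ci * - z * X) * snd (solX psi phi X (- (2 * Ci * - z)) (D, - C0))) by exact (f_equal fst HS).
    assert (S2 : snd (solX phi psi X (2 * Ci * - z) (- C0, D)) = Cexp (2 * Ci * - z * X) * fst (solX psi phi X (- (2 * Ci * - z)) (D, - C0))) by exact (f_equal snd HS).
    destruct HJ as [J1 J2]. rewrite S1 in J1. rewrite S2 in J2. fold o2 in J1, J2.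
    replace (- (2 * Ci * - z)) with (2 * Ci * z) in J1, J2 by ring.
    split; [rewrite J1 | rewrite J2]; unfold i1, i2, inner; ring. }
  assert (HJ : forall z, Cmod z = 1%R -> z <> 0) by (intros z Hz; apply Cmod_gt_0; lra).
  assert (L1 := outer_infty nn al be N M HN HM Bnn Bal Bbe X HX).
  assert (L1' := outer_infty_snd nn al be N M HN HM Bnn Bal Bbe X HX).
  assert (L2 := outer_infty nn (- be)%fps (- al)%fps N M HN HM Bnn (Bopp _ Bbe) (Bopp _ Bal) X HX).
  assert (L2' := outer_infty_snd nn (- be)%fps (- al)%fps N M HN HM Bnn (Bopp _ Bbe) (Bopp _ Bal) X HX).
  destruct L1 as [L1 _]. destruct L2 as [L2 L2r]. fold o1 in L1, L1'. fold o2 in L2, L2', L2r.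
  (* For the exchanged problem the components of a column are swapped as well: the first row pairs
     [fst] of the first column with [snd] of the second, evaluated at -z. *)
  assert (R1 : row_sol (jump x 0 (mk2 A B C0 D)) (fun z => fst (i1 z)) (fun z => snd (i2 (- z))) (fun z => fst (o1 z)) (fun z => snd (o2 (- z))) 1 0).
  { apply row_sol_intro; auto; [| exact (tends_infty_opp (fun z => snd (o2 z)) 0 L2')].
    intros z Hz. destruct (entry_jump X A B C0 D z x eq_refl (HJ z Hz)) as [E00 [E11 [E10 [E01 _]]]].
    rewrite E00, E10, E01, E11, (proj1 (Hj1 z Hz)), (proj2 (Hj2 z Hz)). split; ring. }
  assert (R2 : row_sol (jump x 0 (mk2 A B C0 D)) (fun z => snd (i1 z)) (fun z => fst (i2 (- z))) (fun z => snd (o1 z)) (fun z => fst (o2 (- z))) 0 1).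
  { apply row_sol_intro; auto; [| exact (tends_infty_opp (fun z => fst (o2 z)) 1 L2)].
    intros z Hz. destruct (entry_jump X A B C0 D z x eq_refl (HJ z Hz)) as [E00 [E11 [E10 [E01 _]]]].
    rewrite E00, E10, E01, E11, (proj2 (Hj1 z Hz)), (proj1 (Hj2 z Hz)). split; ring. }
  assert (HV : forall z, Cmod z = 1%R -> entry (jump x 0 (mk2 A B C0 D) z) 0 0 * entry (jump x 0 (mk2 A B C0 D) z) 1 1
     - entry (jump x 0 (mk2 A B C0 D) z) 0 1 * entry (jump x 0 (mk2 A B C0 D) z) 1 0 = 1).
  { intros z Hz. destruct (entry_jump X A B C0 D z x eq_refl (HJ z Hz)) as [_ [_ [_ [_ E]]]]. now rewrite E. }
  assert (HP : is_RHP_solution x 0 (mk2 A B C0 D) (RHP_solution x 0 (mk2 A B C0 D))).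
  { unfold RHP_solution. apply epsilon_spec. eexists. exact (rows_rhp _ _ _ _ _ _ _ _ _ _ _ R1 R2). }
  destruct (rhp_first_row _ _ _ _ HP) as [xm [ym [xp [yp [R3 HE]]]]].
  assert (Hyp : forall z, (1 < Cmod z)%R -> entry (RHP_solution x 0 (mk2 A B C0 D) z) 0 1 = snd (o2 (- z))).
  { intros z Hz. rewrite HE by auto.
    pose proof (row_wronskian _ _ _ _ _ _ _ _ _ _ _ _ _ HV R1 R2 z Hz) as W12.
    pose proof (row_wronskian _ _ _ _ _ _ _ _ _ _ _ _ _ HV R3 R1 z Hz) as W31.
    pose proof (row_wronskian _ _ _ _ _ _ _ _ _ _ _ _ _ HV R3 R2 z Hz) as W32.
    cbv beta in *.
    (* Cramer's rule: the two explicit rows have Wronskian 1, and the unknown row has Wronskian 0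
       with the first and 1 with the second, hence equals the first. *)
    transitivity (yp z * (fst (o1 z) * fst (o2 (- z)) - snd (o2 (- z)) * snd (o1 z))); [rewrite W12; ring |].
    transitivity (snd (o2 (- z)) * (xp z * fst (o2 (- z)) - yp z * snd (o1 z)) - fst (o2 (- z)) * (xp z * snd (o2 (- z)) - yp z * fst (o1 z))); [ring |].
    rewrite W31, W32. ring. }
  assert (Hlim : tends C_infty (fun z => z * entry (RHP_solution x 0 (mk2 A B C0 D) z) 0 1) (- Csum (fun k => X ^ k * snd (fg nn (- be)%fps (- al)%fps 1) k))).
  { assert (FF : Filter C_infty) by apply filter_filter.
    (* The second column lives at -z, which is the origin of the minus sign in the limit. *)
    apply tends_ext_loc with (fun z => - (- z * snd (o2 (- z)))); [auto | |].
    - exists 1%R. intros z Hz. rewrite Hyp by auto. ring.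
    - apply tends_opp; auto. exact (tends_infty_opp (fun z => z * snd (o2 z)) _ L2r). }
  unfold Psi. rewrite (Clim_eq C_infty _ _ Hlim).
  assert (Hs : csum (fun k => X ^ k * psi k) (Csum (fun k => X ^ k * psi k))).
  { apply (X_csum N M X HX psi N M); [unfold rho; lra | lra | exact Bpsi]. }
  pose proof (phi_residue phi psi nn _ _ HL' N M HN HM Bnn (Bopp _ Bbe) (Bopp _ Bal) X HX _ Hs) as E.
  replace (2 * Ci * - Csum (fun k => X ^ k * snd (fg nn (- be)%fps (- al)%fps 1) k)) with (Csum (fun k => X ^ k * psi k)); [exact Hs |].
  rewrite E. ring.
Qed.

(** * Derivatives along the real and imaginary axes *)

Lemma real_or_imag_opp x : real_or_imag x -> real_or_imag (- x).
Proof. intros [H | H]; [left; rewrite im_opp | right; rewrite re_opp]; rewrite H; apply Ropp_0. Qed.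

Lemma within_cross_proper x : real_or_imag x -> ProperFilter (within real_or_imag (locally' x)).
Proof.
  intros Hx. constructor; [| apply within_filter, locally'_filter].
  intros P HP. unfold locally', within in HP. apply locally_Cmod in HP. destruct HP as [d [Hd HP]].
  assert (H0 : forall v, Cmod v = (d / 2)%R -> real_or_imag (x + v) -> exists y, P y).
  { intros v Hv Hr. exists (x + v). apply HP; auto.
    - replace (x + v - x) with v by ring. lra.
    - intros E. assert (v = 0) by (replace v with (x + v - x) by ring; rewrite E; ring).
      subst v. rewrite Cmod_0 in Hv. lra. }
  destruct Hx as [Hx | Hx].
  - apply (H0 (RtoC (d / 2))).
    + rewrite Cmod_R, Rabs_pos_eq; lra.
    + left. rewrite im_plus, Hx, im_RtoC. lra.
  - apply (H0 (Ci * RtoC (d / 2))).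
    + rewrite Cmod_mult, Cmod_Ci, Cmod_R, Rabs_pos_eq; lra.
    + right. rewrite re_plus, Hx. simpl. ring.
Qed.

Lemma D_within_eq f F x l d :
  real_or_imag x -> (0 < d)%R -> is_cderive F x l ->
  (forall y, real_or_imag y -> (Cmod (y - x) < d)%R -> f y = F y) -> D_within real_or_imag f x = l.
Proof.
  intros Hx Hd HF E. assert (PF := within_cross_proper x Hx).
  apply Clim_eq; auto. intros eps He. specialize (HF eps He).
  unfold locally', within in HF |- *.
  generalize (filter_and _ _ HF (locally_Cball x d Hd)). apply filter_imp.
  intros y [H1 H2] Hne Hy. rewrite !E; auto.
  replace (x - x) with (RtoC 0) by ring. now rewrite Cmod_0.
Qed.

Fixpoint dcoef (c : nat -> C) (n k : nat) : C :=
  match n with O => c k | S m => INR (S k) * dcoef c m (S k) end.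

(** A further derivative needs the previous one on the cross near the point, not only at it; the
    induction therefore carries a power series on the whole disc. *)
Lemma Dn_within_pseries f c F r :
  (forall x, (Cmod x < r)%R -> csum (fun k => x ^ k * c k) (F x)) ->
  (forall x, real_or_imag x -> (Cmod x < r)%R -> f x = F x) ->
  forall n, exists Fn, (forall x, (Cmod x < r)%R -> csum (fun k => x ^ k * dcoef c n k) (Fn x)) /\
    (forall x, real_or_imag x -> (Cmod x < r)%R -> Dn_within real_or_imag n f x = Fn x).
Proof.
  intros HF Hf n. induction n as [| n [Fn [H1 H2]]].
  - exists F. auto.
  - destruct (pseries_holo _ r Fn H1) as [G HG]. exists G. split.
    + intros x Hx. apply HG, Hx.
    + intros x Hx Hr. simpl. destruct (HG x Hr) as [HD _].
      apply D_within_eq with Fn (r - Cmod x)%R; auto; [lra |].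
      intros y Hy Hyx. apply H2; auto. apply (ball_lt x y _ _ Hyx). lra.
Qed.

Lemma csum_at_0 c l : csum (fun k => 0 ^ k * c k) l -> l = c O.
Proof.
  intros H. apply (csum_unique _ _ _ H). intros eps He. exists 1%nat. intros n Hn.
  replace (psum (fun k => 0 ^ k * c k) n) with (c O); [replace (c O - c O) with (RtoC 0) by ring; now rewrite Cmod_0 |].
  induction Hn; [simpl; ring |]. simpl psum. rewrite <- IHHn. destruct m; [lia | simpl; ring].
Qed.

(** If there is no limit, both sides take the default 0 = -0. This lets the parity argument work
    without knowing that the derivative exists. *)
Lemma Clim_opp F F' (f f' : C -> C) :
  ProperFilter F -> ProperFilter F' -> (forall l, tends F f l <-> tends F' f' (- l)) -> Clim F' f' = - Clim F f.
Proof.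
  intros PF PF' H.
  destruct (classic (exists l, tends F f l)) as [[l Hl] | Hn].
  - rewrite (Clim_eq F f l Hl). now apply Clim_eq, H.
  - assert (E0 : forall G g, ProperFilter G -> ~ (exists l, tends G g l) -> Clim G g = 0).
    { intros G g PG HG. unfold Clim.
      match goal with |- context [excluded_middle_informative ?P] => destruct (excluded_middle_informative P) as [E | E] end; auto.
      exfalso. apply HG. destruct E as [l Hl]. exists l. apply tends_filterlim; auto. apply filter_filter. }
    assert (Hn' : ~ (exists l, tends F' f' l)).
    { intros [l Hl]. apply Hn. exists (- l). apply H.
      assert (El : - (- l) = l) by ring. rewrite El. exact Hl. }
    rewrite (E0 F f PF Hn), (E0 F' f' PF' Hn'). ring.
Qed.

Lemma Cinv_opp (z : C) : / - z = - / z.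
Proof.
  destruct (Ceq_dec z 0) as [-> | H].
  - replace (- 0) with (RtoC 0) by ring. unfold Cinv. simpl. apply injective_projections; simpl; unfold Rdiv; ring.
  - field. exact H.
Qed.

Lemma D_within_even f x :
  (forall y, f (- y) = f y) -> real_or_imag x -> D_within real_or_imag f (- x) = - D_within real_or_imag f x.
Proof.
  intros Hf Hx. unfold D_within.
  assert (K : forall z l, tends (within real_or_imag (locally' z)) (fun y => (f y - f z) / (y - z)) l ->
    tends (within real_or_imag (locally' (- z))) (fun y => (f y - f (- z)) / (y - - z)) (- l)).
  { intros z l H eps He. specialize (H eps He). unfold locally', within in H |- *.
    apply locally_Cmod in H. destruct H as [d [Hd H]]. apply locally_Cmod. exists d. split; auto.
    intros w Hw Hne Hr. specialize (H (- w)). rewrite !Hf in *.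
    assert (Hwz : w + z <> 0).
    { intros E. apply Hne. assert (Ew : w = - z) by (replace w with (w + z - z) by ring; rewrite E; ring). exact Ew. }
    replace ((f w - f z) / (w - - z) - - l) with (- ((f w - f z) / (- w - z) - l)).
    - rewrite Cmod_opp. apply H.
      + rewrite <- Cmod_opp. now replace (- (- w - z)) with (w - - z) by ring.
      + intros E. apply Hne. assert (Ew : w = - z) by (rewrite <- E; ring). exact Ew.
      + now apply real_or_imag_opp.
    - replace (w - - z) with (w + z) by ring. replace (- w - z) with (- (w + z)) by ring.
      unfold Cdiv. rewrite Cinv_opp. ring. }
  apply Clim_opp; [now apply within_cross_proper | now apply within_cross_proper, real_or_imag_opp |].
  intros l. split; [apply K |]. intros H. apply K in H.
  replace (- - x) with x in H by ring. now replace (- - l) with l in H by ring.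
Qed.

Lemma x2Psi_even G x : x2Psi G (- x) = x2Psi G x.
Proof. unfold x2Psi. now replace ((- x) ^ 2) with (x ^ 2) by ring. Qed.

(** [x2Psi] is even by its very form, so its derivative is odd. The argument is valid on both full
    axes, also where [Psi] is not controlled, thanks to the defaults of [Clim] and of [/ 0]. *)
Lemma u_odd G x : real_or_imag x -> u G (- x) = - u G x.
Proof.
  intros Hx. unfold u, Dlog_within.
  rewrite (D_within_even (x2Psi G) x (x2Psi_even G) Hx), x2Psi_even.
  unfold Cdiv. replace (- D_within real_or_imag (x2Psi G) x * / x2Psi G x) with (- (D_within real_or_imag (x2Psi G) x * / x2Psi G x)) by ring.
  rewrite Cinv_opp. ring.
Qed.

(** * The expansion of u *)

(** Taylor coefficients of x H(-x^2/8) when [h] lists those of H. *)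
Definition odd_coef (h : nat -> C) (n : nat) : C :=
  if Nat.even n then 0 else RtoC (- (1 / 8)) ^ (Nat.div2 n) * h (Nat.div2 n).

Lemma odd_coef_even h n : odd_coef h (2 * n) = 0.
Proof. unfold odd_coef. now rewrite Nat.even_mul. Qed.

Lemma odd_coef_odd h n : odd_coef h (S (2 * n)) = RtoC (- (1 / 8)) ^ n * h n.
Proof.
  unfold odd_coef. rewrite Nat.even_succ, Nat.odd_mul. simpl (Nat.odd 2 && _)%bool. cbv iota.
  now rewrite Nat.div2_succ_double.
Qed.

Lemma csum_odd h x l :
  csum (fun n => (RtoC (- (1 / 8)) * x ^ 2) ^ n * h n) l -> csum (fun n => x ^ n * odd_coef h n) (x * l).
Proof.
  intros H. apply (csum_scal x) in H.
  assert (E : forall n, psum (fun n => x ^ n * odd_coef h n) (2 * n) = psum (fun n => x * ((RtoC (- (1 / 8)) * x ^ 2) ^ n * h n)) n).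
  { induction n; [reflexivity |]. replace (2 * S n)%nat with (S (S (2 * n))) by lia. simpl psum at 1.
    change (psum (fun n => x ^ n * odd_coef h n) (2 * n) + x ^ (2 * n) * odd_coef h (2 * n) + x ^ S (2 * n) * odd_coef h (S (2 * n))
     = psum (fun n => x * ((RtoC (- (1 / 8)) * x ^ 2) ^ n * h n)) n + x * ((RtoC (- (1 / 8)) * x ^ 2) ^ n * h n)).
    rewrite IHn, odd_coef_even, odd_coef_odd, Cpow_mult_l.
    change (x ^ S (2 * n)) with (x * x ^ (2 * n)). rewrite Cpow_mult_r.
    generalize ((x ^ 2) ^ n). intros y. ring. }
  intros eps He. destruct (H eps He) as [N HN]. exists (2 * N)%nat. intros n Hn.
  destruct (Nat.Even_or_Odd n) as [[m ->] | [m ->]].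
  - rewrite E. apply HN. lia.
  - replace (2 * m + 1)%nat with (S (2 * m)) by lia. simpl psum.
    change (Rlt (Cmod (psum (fun n => x ^ n * odd_coef h n) (2 * m) + x ^ (2 * m) * odd_coef h (2 * m) - x * l)) eps).
    rewrite E, odd_coef_even, Cmult_0_r, Cplus_0_r. apply HN. lia.
Qed.

Lemma csum_shift_n a l n : csum a l -> csum (fun k => a (n + k)%nat) (l - psum a n).
Proof.
  intros H. induction n.
  - simpl. now replace (l - 0) with l by ring.
  - apply csum_ext with (fun k => a (n + S k)%nat); [intros k; f_equal; lia |].
    apply (csum_shift (fun k => a (n + k)%nat)). rewrite Nat.add_0_r.
    simpl psum. now replace (a n + (l - (psum a n + a n))) with (l - psum a n) by ring.
Qed.

Lemma pseries_remainder c F r n :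
  (0 < r)%R -> (forall x, (Cmod x < r)%R -> csum (fun k => x ^ k * c k) (F x)) ->
  exists K, forall x, (Cmod x < r / 4)%R -> (Cmod (F x - psum (fun k => x ^ k * c k) n)%C <= K * Cmod x ^ n)%R.
Proof.
  intros Hr HF. pose (s := (r / 2)%R).
  destruct (pseries_coeff_bound c r s) as [B [HB0 HB]]; [unfold s; lra | eauto |].
  exists (B / s ^ n / (1 - 1 / 2))%R. intros x Hx.
  assert (Hs : (0 < s)%R) by (unfold s; lra). assert (Hsn := pow_lt s n Hs).
  assert (H1 := csum_shift_n _ _ n (HF x ltac:(lra))).
  replace (B / s ^ n / (1 - 1 / 2) * Cmod x ^ n)%R with (Cmod x ^ n * (B / s ^ n) / (1 - 1 / 2))%R by (field; lra).
  apply (csum_bound _ _ (1 / 2) _ ltac:(lra)) with (2 := H1).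
  intros k. rewrite Cmod_mult, Cmod_pow, pow_add, !Rmult_assoc.
  apply Rmult_le_compat_l; [apply pow_le, Cmod_ge_0 |].
  specialize (HB (n + k)%nat). rewrite pow_add in HB.
  assert (Hxs : (Cmod x ^ k <= (1 / 2 * s) ^ k)%R).
  { apply pow_incr. split; [apply Cmod_ge_0 | unfold s; lra]. }
  apply Rle_trans with ((1 / 2 * s) ^ k * Cmod (c (n + k)%nat))%R.
  - apply Rmult_le_compat_r; [apply Cmod_ge_0 | exact Hxs].
  - rewrite Rpow_mult_distr. apply Rmult_le_reg_l with (s ^ n)%R; auto.
    replace (s ^ n * (B / s ^ n * (1 / 2) ^ k))%R with (B * (1 / 2) ^ k)%R by (field; lra).
    replace (s ^ n * ((1 / 2) ^ k * s ^ k * Cmod (c (n + k)%nat)))%R with (Cmod (c (n + k)%nat) * (s ^ n * s ^ k) * (1 / 2) ^ k)%R by ring.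
    apply Rmult_le_compat_r; auto. apply pow_le. lra.
Qed.

Lemma cross_sq x : real_or_imag x -> RtoC (Re (x ^ 2)) = x ^ 2.
Proof. destruct x as [p q]. intros [H | H]; simpl in H; subst; apply injective_projections; simpl; ring. Qed.

(* [h] lists the Taylor coefficients of [H = psi / (psi + X psi')], for which
   [u x = x H(-x^2/8)]. *)
Lemma u_expansion (G : mat2) (psi : fps) (R0 : R) :
  (0 < R0)%R -> psi O <> 0 ->
  (forall X, (Cmod X < R0)%R -> exists l, csum (fun k => X ^ k * psi k) l) ->
  (forall x, (Rabs x < R0)%R -> csum (fun k => RtoC x ^ k * psi k) (Psi x 0 G)) ->
  exists (h : nat -> C) (r : R) (U : C -> C), (0 < r)%R /\ h O = 1 /\ h 1%nat * psi O = - psi 1%nat /\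
    (forall x, (Cmod x < r)%R -> csum (fun n => x ^ n * odd_coef h n) (U x)) /\
    (forall x, real_or_imag x -> (Cmod x < r)%R -> u G x = U x).
Proof.
  intros HR0 Hpsi0 Hex HPsi.
  pose (p := fun X => Csum (fun k => X ^ k * psi k)).
  assert (Hp : forall X, (Cmod X < R0)%R -> csum (fun k => X ^ k * psi k) (p X)) by (intros X HX; now apply Csum_correct, Hex).
  destruct (pseries_holo psi R0 p Hp) as [p1 Hp1].
  destruct (pseries_holo _ R0 p1 (fun z Hz => proj2 (proj2 (Hp1 z Hz)))) as [p2 Hp2].
  assert (Hph : holo (fun z => Cmod z < R0)%R p) by (exists p1; intros z Hz; destruct (Hp1 z Hz) as [? [? ?]]; auto).
  assert (Hp1h : holo (fun z => Cmod z < R0)%R p1) by (exists p2; intros z Hz; destruct (Hp2 z Hz) as [? [? ?]]; auto).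
  assert (Hm0 : (Cmod 0 < R0)%R) by now rewrite Cmod_0.
  assert (Hp0 : p 0 = psi O) by (apply csum_at_0, Hp, Hm0).
  assert (Hp10 : p1 0 = psi 1%nat).
  { rewrite (csum_at_0 _ _ (proj2 (proj2 (Hp1 0 Hm0)))). simpl. ring. }
  pose (q := fun X => p X + X * p1 X).
  assert (Hqh : holo (fun z => Cmod z < R0)%R q) by (apply holo_plus; auto; apply holo_mult; auto; apply holo_id).
  assert (Hnz : locally (RtoC 0) (fun X : C => p X <> 0 /\ q X <> 0)).
  { assert (Hnz1 : forall f, holo (fun z => Cmod z < R0)%R f -> f 0 = psi O -> locally (RtoC 0) (fun X : C => f X <> 0)).
    { intros f Hf Hf0. assert (Hpos : (0 < Cmod (psi O))%R) by (apply Cmod_gt_0; exact Hpsi0).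
      generalize (holo_cont _ _ _ Hf Hm0 _ Hpos). apply filter_imp. intros X HX E. rewrite E, Hf0 in HX.
      replace (0 - psi O) with (- psi O) in HX by ring. rewrite Cmod_opp in HX. lra. }
    apply filter_and; apply Hnz1; auto. unfold q. rewrite Hp0. ring. }
  apply locally_Cmod in Hnz. destruct Hnz as [d [Hd Hnz]].
  assert (Hnz' : forall X, (Cmod X < d)%R -> p X <> 0 /\ q X <> 0) by (intros X HX; apply Hnz; now rewrite Cmod_minus_0).
  pose (R1 := Rmin R0 d). assert (HR1 : (0 < R1)%R) by now apply Rmin_pos.
  assert (HR10 : forall X, (Cmod X < R1)%R -> (Cmod X < R0)%R) by (intros X HX; eapply Rlt_le_trans; [exact HX | apply Rmin_l]).
  assert (HR1d : forall X, (Cmod X < R1)%R -> (Cmod X < d)%R) by (intros X HX; eapply Rlt_le_trans; [exact HX | apply Rmin_r]).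
  pose (H := fun X => p X * / q X).
  assert (HH : holo (fun z => Cmod z < R1)%R H).
  { apply holo_mult; [now apply holo_sub with (2 := Hph) |]. apply holo_inv; [intros z Hz; now apply Hnz', HR1d | now apply holo_sub with (2 := Hqh)]. }
  assert (HHan : analytic_at H 0).
  { apply holo_open_analytic with (2 := HH). apply locally_Cmod_lt. now rewrite Cmod_0. }
  destruct HHan as [h [R2 [HR2 Hh]]].
  assert (Hh' : forall X, (Cmod X < R2)%R -> csum (fun k => X ^ k * h k) (H X)).
  { intros X HX. apply csum_is_pseries. replace X with (X - 0) at 1 by ring. apply Hh; auto. now rewrite Cmod_minus_0. }
  assert (Hh0 : h O = 1).
  { rewrite <- (csum_at_0 _ _ (Hh' 0 ltac:(now rewrite Cmod_0))). unfold H, q. rewrite Hp0. field.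
    intros E. apply Hpsi0. rewrite <- E. ring. }
  assert (Hh1 : h 1%nat * psi O = - psi 1%nat).
  (* Differentiate H q = p at 0, where H = 1, q = psi_0 and q' = 2 psi_1: h_1 psi_0 + 2 psi_1 =
     psi_1. *)
  { destruct (pseries_derive h R2 H Hh' 0 ltac:(now rewrite Cmod_0)) as [l [Hl Hls]].
    apply csum_at_0 in Hls. simpl in Hls.
    assert (Dp : is_cderive p 0 (psi 1%nat)) by (rewrite <- Hp10; now apply Hp1).
    assert (Dq : is_cderive q 0 (psi 1%nat + (1 * p1 0 + 0 * p2 0))).
    { apply dquot_plus; [apply approach_C | exact Dp |]. apply (dquot_mult (approach_C 0) (fun y => y) p1); [apply dquot_id, approach_C | now apply Hp2]. }
    assert (DHq : is_cderive (fun X => H X * q X) 0 (l * q 0 + H 0 * (psi 1%nat + (1 * p1 0 + 0 * p2 0)))).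
    { apply dquot_mult; [apply approach_C | exact Hl | exact Dq]. }
    assert (DHq' : is_cderive (fun X => H X * q X) 0 (psi 1%nat)).
    { apply is_cderive_ext_loc with p; auto. apply locally_Cmod. exists d. split; auto. intros X HX.
      rewrite Cmod_minus_0 in HX. unfold H. field. now apply Hnz'. }
    assert (E := is_cderive_unique _ _ _ _ DHq DHq').
    rewrite <- (csum_at_0 _ _ (Hh' 0 ltac:(now rewrite Cmod_0))) in Hh0. rewrite Hh0, Hp10, Hls in E.
    unfold q in E. rewrite Hp0 in E.
    replace (h 1%nat * psi O) with ((1 * h 1%nat * (psi O + 0 * p1 0) + 1 * (psi 1%nat + (1 * psi 1%nat + 0 * p2 0))) - 2 * psi 1%nat) by ring.
    rewrite E. ring. }
  (* For |x| < 1, |x^2/8| <= |x|, so the radii for X also serve for x. *)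
  pose (r := Rmin 1 (Rmin R1 R2)).
  assert (Hr : (0 < r)%R) by (apply Rmin_pos; [lra | now apply Rmin_pos]).
  assert (HX : forall x, (Cmod x < r)%R -> (Cmod (RtoC (- (1 / 8)) * x ^ 2) < R1 /\ Cmod (RtoC (- (1 / 8)) * x ^ 2) < R2)%R).
  { intros x Hx. assert (H1 : (Cmod (RtoC (- (1 / 8)) * x ^ 2) <= Cmod x)%R).
    { rewrite Cmod_mult, Cmod_pow, Cmod_R, Rabs_Ropp, Rabs_pos_eq by lra. pose proof (Cmod_ge_0 x).
      assert (Cmod x < 1)%R by (eapply Rlt_le_trans; [exact Hx | apply Rmin_l]). simpl. nra. }
    assert (H2 : (Cmod x < Rmin R1 R2)%R) by (eapply Rlt_le_trans; [exact Hx | apply Rmin_r]).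
    pose proof (Rmin_l R1 R2). pose proof (Rmin_r R1 R2). lra. }
  exists h, r, (fun x => x * H (RtoC (- (1 / 8)) * x ^ 2)).
  repeat split; auto.
  - intros x Hx. apply csum_odd, Hh', HX, Hx.
  - assert (Hf : forall x, real_or_imag x -> (Cmod x < r)%R -> x2Psi G x = x ^ 2 * p (RtoC (- (1 / 8)) * x ^ 2)).
    { intros x Hx Hxr. unfold x2Psi. f_equal. destruct (HX x Hxr) as [H1 _]. apply HR10 in H1.
      assert (E : RtoC (- (1 / 8) * Re (x ^ 2)) = RtoC (- (1 / 8)) * x ^ 2) by (rewrite RtoC_mult; now rewrite cross_sq).
      apply (csum_unique _ _ _ (HPsi (- (1 / 8) * Re (x ^ 2))%R ltac:(now rewrite <- Cmod_R, E))).
      rewrite E. now apply Hp. }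
    intros x Hx Hxr. unfold u, Dlog_within.
    destruct (Ceq_dec x 0) as [-> | Hne].
    (* At the origin [x2Psi] is 0; the convention [/ 0 = 0], used twice, gives u(0) = 0. *)
    + rewrite Hf by auto. replace (0 ^ 2 * p (RtoC (- (1 / 8)) * 0 ^ 2)) with (RtoC 0) by (simpl; ring).
      assert (I0 : / RtoC 0 = 0) by (unfold Cinv; simpl; apply injective_projections; simpl; unfold Rdiv; ring).
      unfold Cdiv. rewrite I0, Cmult_0_r, I0. ring.
    + set (X := RtoC (- (1 / 8)) * x ^ 2). destruct (HX x Hxr) as [HX1 HX2]. fold X in HX1, HX2.
      destruct (Hnz' X (HR1d X HX1)) as [Np Nq].
      assert (HD : D_within real_or_imag (x2Psi G) x = 2 * x * q X).
      { apply D_within_eq with (fun x => x ^ 2 * p (RtoC (- (1 / 8)) * x ^ 2)) (r - Cmod x)%R; auto; [lra | |].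
        - assert (Dsq : is_cderive (fun y => y ^ 2) x (2 * x)).
          { assert (Q := dquot_mult (approach_C x) (fun y => y) (fun y => y) 1 1 (dquot_id (approach_C x)) (dquot_id (approach_C x))).
            cbv beta in Q. assert (Ex : 1 * x + x * 1 = 2 * x) by ring. rewrite Ex in Q.
            apply is_cderive_ext_loc with (2 := Q). apply filter_forall. intros y. simpl. ring. }
          assert (DX : is_cderive (fun y => RtoC (- (1 / 8)) * y ^ 2) x (RtoC (- (1 / 8)) * (2 * x))) by (apply dquot_scal; [apply approach_C | exact Dsq]).
          assert (DP : is_cderive (fun y => p (RtoC (- (1 / 8)) * y ^ 2)) x (p1 X * (RtoC (- (1 / 8)) * (2 * x)))).
          { apply (dquot_chain (approach_C x) (fun y => RtoC (- (1 / 8)) * y ^ 2) p); [exact DX | now apply Hp1, HR10]. }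
          assert (Q := dquot_mult (approach_C x) _ _ _ _ Dsq DP). cbv beta in Q. fold X in Q.
          replace (2 * x * q X) with (2 * x * p X + x ^ 2 * (p1 X * (RtoC (- (1 / 8)) * (2 * x)))); [exact Q |].
          unfold q. unfold X at 4. ring.
        - intros y Hy Hyx. apply Hf; auto. apply (ball_lt x y _ _ Hyx). lra. }
      rewrite HD, Hf by auto. fold X. unfold H. field. repeat split; auto.
Qed.

(** * The Taylor coefficients of u in terms of a and b *)

Lemma norm2_sq (a b : C) : (norm2 a b ^ 2 = Cmod a ^ 2 + Cmod b ^ 2)%R.
Proof.
  unfold norm2. rewrite pow2_sqrt; auto. pose proof (pow2_ge_0 (Cmod a)). pose proof (pow2_ge_0 (Cmod b)). lra.
Qed.

Theorem corollary1p12 (a b : C) (hab : a * b <> 0) :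
  let G : mat2 := Gmat a b in
  let af : R := (Cmod a / sqrt (Cmod a ^ 2 + Cmod b ^ 2))%R in
  let bf : R := (Cmod b / sqrt (Cmod a ^ 2 + Cmod b ^ 2))%R in
  let u3 : C := Dn_within real_or_imag 3 (u G) 0 in
  (forall x : C, real_or_imag x -> u G (- x) = - u G x) /\
  analytic_within real_or_imag (u G) 0 /\
  (exists K r : R, (0 < r)%R /\
     forall x : C, real_or_imag x -> (Cmod x < r)%R ->
       (Cmod (u G x - (x + u3 / INR (Factorial.fact 3) * x ^ 3)) <= K * Cmod x ^ 5)%R) /\
  u3 = RtoC (3 * (bf ^ 2 - af ^ 2))%R /\
  (3 * (bf ^ 2 - af ^ 2) =
     3 * ((Cmod b ^ 2 - Cmod a ^ 2) / (Cmod a ^ 2 + Cmod b ^ 2)))%R.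
Proof.
  intros G af bf u3.
  assert (Ha : a <> 0) by (intros E; apply hab; rewrite E; ring).
  assert (Hb : b <> 0) by (intros E; apply hab; rewrite E; ring).
  assert (Hpa : (0 < Cmod a)%R) by now apply Cmod_gt_0.
  assert (Hpb : (0 < Cmod b)%R) by now apply Cmod_gt_0.
  pose (nu := norm2 a b). assert (Hnu2 : (nu ^ 2 = Cmod a ^ 2 + Cmod b ^ 2)%R) by apply norm2_sq.
  assert (Hs : (0 < Cmod a ^ 2 + Cmod b ^ 2)%R) by (pose proof (pow_lt _ 2 Hpa); pose proof (pow_lt _ 2 Hpb); lra).
  assert (Hnu : (0 < nu)%R) by now apply sqrt_lt_R0.
  assert (HnuC : RtoC nu <> 0) by (intros E; apply RtoC_inj in E; lra).
  assert (Hca : Cconj a <> 0) by (apply Cmod_gt_0; rewrite Cmod_conj; auto).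
  assert (Hcb : Cconj b <> 0) by (apply Cmod_gt_0; rewrite Cmod_conj; auto).
  assert (HnuC2 : RtoC nu * RtoC nu = a * Cconj a + b * Cconj b).
  { rewrite <- !Cmod2_conj, <- RtoC_plus, <- RtoC_mult. apply f_equal. rewrite <- Hnu2. ring. }
  pose (A := a / RtoC nu). pose (B := Cconj b / RtoC nu). pose (C0 := - b / RtoC nu). pose (D := Cconj a / RtoC nu).
  assert (HG : G = mk2 A B C0 D) by reflexivity.
  assert (Hdet : A * D - B * C0 = 1).
  { unfold A, B, C0, D. transitivity ((a * Cconj a + b * Cconj b) / (RtoC nu * RtoC nu)); [field; auto |]. rewrite <- HnuC2. field. auto. }
  destruct (lax_exists (A * D + B * C0) (2 * (B * D)) (- (2 * (A * C0)))) as
    [psi [phi [nn [al [be [N [M [HL [Hnn [Hal [Hbe [HN [HM [Bpsi [Bphi [Bnn [Bal Bbe]]]]]]]]]]]]]]]]].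
  assert (E4 : RtoC 4 = 2 * 2) by (rewrite <- RtoC_mult; apply f_equal; lra).
  assert (H2 : RtoC 2 <> 0) by (intros E; apply RtoC_inj in E; lra).
  assert (Hpsi0 : psi O = 8 * (B * D)).
  { pose proof (f_equal (fun s : fps => s O) (lax_psi _ _ _ _ _ HL)) as E. cbv beta in E. unfold fadd, theta in E.
    rewrite cst_mul, Hal in E. change (RtoC (INR 0)) with (RtoC 0) in E.
    replace (psi O) with (0 * psi O + psi O) by ring. rewrite E. rewrite E4.
    replace (RtoC 8) with (2 * 2 * 2); [ring |]. rewrite <- !RtoC_mult. apply f_equal. lra. }
  (* The coefficient of X gives 2 psi_1 = 4 al_1, and al_1 = -2 nn_0 psi_0. *)
  assert (Hpsi1 : psi 1%nat = - (4 * (A * D + B * C0)) * psi O).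
  { pose proof (f_equal (fun s : fps => s 1%nat) (lax_psi _ _ _ _ _ HL)) as E. cbv beta in E. unfold fadd, theta in E.
    rewrite cst_mul in E. change (RtoC (INR 1)) with (RtoC 1) in E.
    pose proof (f_equal (fun s : fps => s O) (lax_al _ _ _ _ _ HL)) as E1. cbv beta in E1. unfold fopp, fD in E1.
    rewrite cst_mul in E1. change (RtoC (INR 1)) with (RtoC 1) in E1. change ((nn * psi)%fps O) with (nn O * psi O) in E1. rewrite Hnn in E1.
    replace (psi 1%nat) with (/ 2 * (1 * psi 1%nat + psi 1%nat)) by (field; auto). rewrite E.
    replace (al 1%nat) with (1 * al 1%nat) by ring. rewrite E1, E4. field; auto. }
  assert (Hpsi0n : psi O <> 0).
  (* [B] and [D] are the conjugates of b and a divided by [nu]; both factors are non-zero precisely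
     because ab <> 0, and u divides by psi near 0. *)
  { assert (Hinu : / RtoC nu <> 0) by (intros E; apply C1_nz; rewrite <- (Cinv_l _ HnuC), E; ring).
    rewrite Hpsi0. apply Cmult_neq_0; [intros E; apply RtoC_inj in E; lra |].
    unfold B, D, Cdiv. apply Cmult_neq_0; apply Cmult_neq_0; assumption. }
  assert (Hrho : (0 < rho N M)%R) by (unfold rho; lra).
  pose (R0 := (/ (2 * rho N M))%R).
  assert (HR0 : (0 < R0)%R) by (apply Rinv_0_lt_compat; lra).
  assert (HRr : forall t, (t < R0)%R -> (t * rho N M <= 1 / 2)%R).
  { intros t Ht. apply Rle_trans with (R0 * rho N M)%R; [apply Rmult_le_compat_r; lra |]. unfold R0. right. field. lra. }
  destruct (u_expansion G psi R0 HR0 Hpsi0n) as [h [r [U [Hr [Hh0 [Hh1 [HU Hu]]]]]]].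
  { intros X HX. eexists. apply (X_csum N M X (HRr _ HX) psi N M); [unfold rho; lra | lra | exact Bpsi]. }
  { intros x Hx. rewrite HG. apply (Psi_eq A B C0 D psi phi nn al be N M x); auto. }
  assert (Hc0 : odd_coef h 0 = 0) by apply (odd_coef_even h 0).
  assert (Hc1 : odd_coef h 1 = 1) by (change (odd_coef h (S (2 * 0)) = 1); rewrite odd_coef_odd, Hh0; simpl; ring).
  assert (Hc2 : odd_coef h 2 = 0) by apply (odd_coef_even h 1).
  assert (Hc4 : odd_coef h 4 = 0) by apply (odd_coef_even h 2).
  assert (Hh1' : h 1%nat = 4 * (A * D + B * C0)).
  { replace (h 1%nat) with (h 1%nat * psi O * / psi O) by (field; auto). rewrite Hh1, Hpsi1. field; auto. }
  assert (Hc3 : odd_coef h 3 = - (1 / 2) * (A * D + B * C0)).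
  { change (odd_coef h (S (2 * 1)) = - (1 / 2) * (A * D + B * C0)). rewrite odd_coef_odd, Hh1', Cpow_1_r. rewrite Cmult_assoc. f_equal.
    rewrite <- RtoC_mult, <- RtoC_div, <- RtoC_opp by lra. apply f_equal. lra. }
  assert (Hroi0 : real_or_imag 0) by (left; reflexivity).
  assert (Hu3 : u3 = 6 * odd_coef h 3).
  { destruct (Dn_within_pseries (u G) (odd_coef h) U r HU Hu 3) as [F3 [HF3 HD3]].
    unfold u3. rewrite HD3 by (auto; now rewrite Cmod_0).
    rewrite (csum_at_0 _ _ (HF3 0 ltac:(now rewrite Cmod_0))).
    change (dcoef (odd_coef h) 3 0) with (RtoC (INR 1) * (RtoC (INR 2) * (RtoC (INR 3) * odd_coef h 3))).
    rewrite !Cmult_assoc, <- !RtoC_mult. f_equal. apply f_equal. simpl. lra. }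
  assert (Hsq : forall t, ((t / sqrt (Cmod a ^ 2 + Cmod b ^ 2)) ^ 2 = t ^ 2 / (Cmod a ^ 2 + Cmod b ^ 2))%R).
  { intros t. rewrite Rpow_div, pow2_sqrt; lra. }
  assert (Hlast : (3 * (bf ^ 2 - af ^ 2) = 3 * ((Cmod b ^ 2 - Cmod a ^ 2) / (Cmod a ^ 2 + Cmod b ^ 2)))%R).
  { unfold af, bf. rewrite !Hsq. field. lra. }
  split; [| split; [| split; [| split]]].
  - intros x Hx. now apply u_odd.
  - exists (odd_coef h), r. split; auto. intros z Hz Hzr. rewrite Cmod_minus_0 in Hzr.
    apply csum_is_pseries. replace (z - 0) with z by ring. rewrite Hu by auto. now apply HU.
  (* Order 5 is reached because the coefficient of x^4 vanishes. *)
  - destruct (pseries_remainder (odd_coef h) U r 5 Hr HU) as [K HK].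
    exists K, (r / 4)%R. split; [lra |]. intros x Hx Hxr. rewrite Hu by (auto; lra).
    replace (x + u3 / INR (Factorial.fact 3) * x ^ 3) with (psum (fun k => x ^ k * odd_coef h k) 5); [now apply HK |].
    rewrite Hu3. simpl psum. rewrite Hc0, Hc1, Hc2, Hc4.
    replace (RtoC (INR (Factorial.fact 3))) with (RtoC 6) by (apply f_equal; simpl; lra).
    simpl. field.
  - rewrite Hu3, Hc3, Hlast.
    rewrite RtoC_mult, RtoC_div, RtoC_minus, RtoC_plus, !Cmod2_conj, <- HnuC2 by lra.
    unfold A, B, C0, D.
    (* [C0] carries the sign of -b, so AD + B C0 is the difference |a|^2 - |b|^2 over nu^2, while
       the determinant is the sum. *)
    transitivity (6 * - (1 / 2) * ((a * Cconj a - b * Cconj b) / (RtoC nu * RtoC nu))); [field; auto |].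
    replace (RtoC 6) with (3 * 2) by (rewrite <- RtoC_mult; apply f_equal; lra). field. auto.
  - exact Hlast.
Qed.
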